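(* Let $d \geq 2$ be an integer, let $\xi_1, \xi_2, \dots$ be independent random vectors, each uniform on the unit Euclidean sphere $S^{d-1}$ in $\mathbb{R}^d$, and let $Z$ be a Gaussian random vector in $\mathbb{R}^d$ with mean $0$ and covariance matrix $\frac{1}{d}I_d$. Let $p \geq 2$ be a real number. Then for every integer $n \geq 1$ and all real scalars $a_1, \dots, a_n$ with $\sum_{j=1}^n a_j^2 = 1$, we have \[ \mathbb{E}\left|\sum_{j=1}^n a_j\xi_j\right|^p \leq \mathbb{E}|Z|^p - c_{p,d}\sum_{j=1}^n a_j^4, \] where \[ c_{p,d} = \frac{(p+d-2)(p+d-4)}{24d^2(d+2)}\cdot \begin{cases} 3p(p-2), & 2 \leq p \leq 4, \\ 1, & p > 4. \end{cases} \]
   Context: $|\cdot|$ denotes the standard Euclidean norm on $\mathbb{R}^d$, and $S^{d-1} = \{x \in \mathbb{R}^d : |x| = 1\}$. ''Uniform on $S^{d-1}$'' means distributed according to the normalised (rotation-invariant) surface probability measure on $S^{d-1}$. *)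

(* Defs.v *)
From HB Require Import structures.
From mathcomp Require Import all_boot all_order all_algebra.
From mathcomp Require Import all_classical all_reals all_analysis.

Set Implicit Arguments.
Unset Strict Implicit.
Unset Printing Implicit Defensive.

Import Order.TTheory GRing.Theory Num.Theory.
Import numFieldNormedType.Exports.

Local Open Scope classical_set_scope.
Local Open Scope ring_scope.

Definition measure_row_display : measure_display -> measure_display.
Proof. exact. Qed.

(* Row vectors carry the sigma-algebra generated by the coordinate maps, as
   n.-tuple T does in the library; on 'rV[R]_n this is the Borel one. *)
Section measurable_row.
Context {d} {T : sigmaRingType d}.
Variable n : nat.

Let coors : 'I_n -> 'rV[T]_n -> T := fun i x => x ord0 i.

Let row_set0 : g_sigma_preimage coors set0.
Proof. exact: sigma_algebra0. Qed.

Let row_setC A : g_sigma_preimage coors A -> g_sigma_preimage coors (~` A).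
Proof. exact: sigma_algebraC. Qed.

Let row_bigcup (F : _^nat) : (forall i, g_sigma_preimage coors (F i)) ->
  g_sigma_preimage coors (\bigcup_i (F i)).
Proof. exact: sigma_algebra_bigcup. Qed.

HB.instance Definition _ := @isMeasurable.Build (measure_row_display d)
  'rV[T]_n (g_sigma_preimage coors) row_set0 row_setC row_bigcup.

End measurable_row.

Section euclidean.
Context {R : realType} {d : nat}.

Definition dotr (x y : 'rV[R]_d) : R := \sum_(i < d) x ord0 i * y ord0 i.

(* The norm `|x| of the library on 'rV[R]_d is the sup norm. *)
Definition enorm (x : 'rV[R]_d) : R := Num.sqrt (dotr x x).

Definition sphere : set 'rV[R]_d := [set x | enorm x = 1].

Definition orthogonal_mx (U : 'M[R]_d) : Prop := U *m U^T = 1%:M.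

End euclidean.

Section random_vectors.
Context {disp : measure_display} {T : measurableType disp} {R : realType}.
Variable P : probability T R.

(* The normalised surface measure on the sphere is the unique Borel probability
   measure on the sphere that is invariant under the orthogonal group. *)
Definition uniform_on_sphere d (X : {RV P >-> 'rV[R]_d}) : Prop :=
  distribution P X sphere = 1%E /\
  forall U : 'M[R]_d, orthogonal_mx U ->
  forall B : set 'rV[R]_d, measurable B ->
    distribution P X ((fun x => x *m U) @^-1` B) = distribution P X B.

Definition independent d (X : nat -> {RV P >-> 'rV[R]_d}) : Prop :=
  forall (J : seq nat) (B : nat -> set 'rV[R]_d), uniq J ->
  (forall j, measurable (B j)) ->
  P (\bigcap_(j in [set` J]) (X j @^-1` B j)) =
  (\prod_(j <- J) P (X j @^-1` B j))%E.

(* normal_prob m 0 is not the degenerate normal law in the library. *)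
Definition normal_law (m s : R) (B : set R) : \bar R :=
  if s == 0 then \d_m B else normal_prob m s B.

Definition gaussian_vector d (X : {RV P >-> 'rV[R]_d}) : Prop :=
  forall u : 'rV[R]_d, exists m s : R, 0 <= s /\
  forall B : set R, measurable B ->
    P ((fun t => dotr u (X t)) @^-1` B) = normal_law m s B.

Definition has_mean d (X : {RV P >-> 'rV[R]_d}) (m : 'rV[R]_d) : Prop :=
  forall i, ('E_P[fun t => X t ord0 i] = (m ord0 i)%:E)%E.

Definition has_covariance d (X : {RV P >-> 'rV[R]_d}) (S : 'M[R]_d) : Prop :=
  forall i j,
    covariance P (fun t => X t ord0 i) (fun t => X t ord0 j) = (S i j)%:E.

End random_vectors.

Definition deficit_const {R : realType} (p : R) (d : nat) : R :=
  (p + d%:R - 2) * (p + d%:R - 4) / (24 * d%:R ^+ 2 * (d%:R + 2)) *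
  (if p <= 4 then 3 * p * (p - 2) else 1).

(* Main.v *)
(* Lindeberg replacement: the xi_j are exchanged one by one for independent
   copies of Z. Write q = p / 2. Conditionally on |z|, a Gaussian step a z is a
   uniform step of length r = a |z|, so one exchange at the point x compares
   the spherical mean S(r) of |x + r u|^(2q) at r = a with its mean over
   r = a |z|, where E |z|^2 = 1. As r^2 has mean a^2, it suffices to bound
   S(r) below by a cubic polynomial in r^2 - a^2 whose constant term is S(a):
   the linear term averages out, the quadratic and cubic ones give the deficit.
   - For q <= 2 the bound holds because S minus the polynomial is convex in r^2,
     which by the Euler-Poisson-Darboux equation reduces to an upper bound on
     the bilaplacian of |x|^(2q).
   - For q >= 2 the function S(r) - (|x|^2 + r^2)^q is convex in r^2, and
     (|x|^2 + r^2)^q is bounded below by a Taylor polynomial.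
   To stay away from the singularity at 0, |x|^(2q) is first replaced by
   (|x|^2 + e)^q, and e tends to 0 at the end. *)

Require Import Defs.
From HB Require Import structures.
From mathcomp Require Import all_boot all_order all_algebra.
From mathcomp Require Import all_classical all_reals all_analysis.
From mathcomp Require Import measurable_realfun.
From mathcomp Require Import ring lra.

Set Implicit Arguments.
Unset Strict Implicit.
Unset Printing Implicit Defensive.

Import Order.TTheory GRing.Theory Num.Theory.
Import numFieldNormedType.Exports.

Local Open Scope classical_set_scope.
Local Open Scope ring_scope.

(** Both laws are given only indirectly: the uniform one by orthogonal invariance, the Gaussian one
    by its one-dimensional marginals, mean and covariance. So neither a surface density nor a joint
    density appears. On the sphere, Householder reflections turn <x, u> into |x| u_i, and invariance
    along a one-parameter family of reflections gives a Stein identity, the source of both the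
    moments of u_i and the Euler-Poisson-Darboux equation. On the Gaussian side, averaging |<v,
    u>|^p over unit u reduces E |v|^p to marginals of v.

    The obstacle is that the exchange bound at x is integrated over the law of the remaining sum x,
    of which only E |x|^2 = 1 - a^2 is known exactly. Its terms are therefore made affine in |x|^2,
    except for 2 < q <= 3, where E (|x|^2 + a^2)^2 <= 2 is needed too; this is bootstrapped from the
    exchange for q = 2.

    The constants come from E (|z|^2 - 1)^2 = 2 / d and E (|z|^2 - 1)^3 = 8 / d^2. For q <= 2 the
    bilaplacian is bounded below, which gives c_{p,d}; for 2 < q <= 3 the deficit is (q - 1) / d and
    for q > 3 it is q (q - 1) / d, both at least c_{p,d}. *)

Section measurable_row_theory.
Context {disp} {T : measurableType disp} {R : realType} {d : nat}.

Lemma measurable_coord (i : 'I_d) :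
  measurable_fun [set: 'rV[R]_d] (fun x => x ord0 i).
Proof.
move=> _ B mB; rewrite setTI; apply: sub_sigma_algebra.
rewrite -bigcup_seq /=; exists i => /=; first by rewrite mem_index_enum.
by exists B; rewrite ?setTI.
Qed.

Lemma measurable_fun_rowP (f : T -> 'rV[R]_d) :
  (forall i, measurable_fun setT (fun t => f t ord0 i)) ->
  measurable_fun setT f.
Proof.
move=> mf.
have : g_sigma_preimage (fun i t => f t ord0 i) `<=` measurable.
  apply: smallest_sub; first exact: sigma_algebra_measurable.
  rewrite -bigcup_seq; apply: bigcup_sub => i _ A [B mB <-].
  exact: mf.
rewrite (_ : (fun i t => f t ord0 i) =
  (fun i => (fun x : 'rV[R]_d => x ord0 i) \o f))//.
rewrite g_sigma_preimage_comp => sub _ B mB.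
by apply: sub; exists B.
Qed.

End measurable_row_theory.

(** * Euclidean norm, reflections, measurability *)

Section euclidean_theory.
Context {R : realType} {d : nat}.
Implicit Types x y z : 'rV[R]_d.

Lemma dotrE x y : dotr x y = (x *m y^T) ord0 ord0.
Proof. by rewrite /dotr !mxE; apply: eq_bigr => i _; rewrite mxE. Qed.

Lemma dotrC x y : dotr x y = dotr y x.
Proof. by apply: eq_bigr => i _; rewrite mulrC. Qed.

Lemma dotrDl x y z : dotr (x + y) z = dotr x z + dotr y z.
Proof. by rewrite !dotrE mulmxDl mxE. Qed.

Lemma dotrDr x y z : dotr x (y + z) = dotr x y + dotr x z.
Proof. by rewrite dotrC dotrDl !(dotrC _ x). Qed.

Lemma dotrZl c x y : dotr (c *: x) y = c * dotr x y.
Proof. by rewrite !dotrE -scalemxAl mxE. Qed.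

Lemma dotrZr c x y : dotr x (c *: y) = c * dotr x y.
Proof. by rewrite dotrC dotrZl dotrC. Qed.

Lemma dotr0l y : dotr 0 y = 0.
Proof. by rewrite dotrE mul0mx mxE. Qed.

Lemma dotr_ge0 x : 0 <= dotr x x.
Proof. by apply: sumr_ge0 => i _; rewrite -expr2 sqr_ge0. Qed.

Lemma dotr_eq0 x : dotr x x = 0 -> x = 0.
Proof.
move/eqP; rewrite psumr_eq0; last by move=> i _; rewrite -expr2 sqr_ge0.
move=> /allP x0; apply/rowP => i; rewrite mxE.
by have /eqP/eqP := x0 i (mem_index_enum i); rewrite mulf_eq0 orbb => /eqP.
Qed.

Lemma enorm_ge0 x : 0 <= enorm x.
Proof. exact: sqrtr_ge0. Qed.

Lemma sqr_enorm x : enorm x ^+ 2 = dotr x x.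
Proof. by rewrite sqr_sqrtr ?dotr_ge0. Qed.

Lemma enorm0 : enorm (0 : 'rV[R]_d) = 0.
Proof. by rewrite /enorm dotr0l sqrtr0. Qed.

Lemma enorm_eq0 x : enorm x = 0 -> x = 0.
Proof. by move=> x0; apply: dotr_eq0; rewrite -sqr_enorm x0 expr0n. Qed.

Lemma enormZ c x : enorm (c *: x) = `|c| * enorm x.
Proof.
by rewrite /enorm dotrZl dotrZr mulrA -expr2 sqrtrM ?sqr_ge0// sqrtr_sqr.
Qed.

Lemma dotr_delta x i : dotr x (delta_mx ord0 i) = x ord0 i.
Proof.
rewrite /dotr (bigD1 i)//= big1 ?addr0; first by rewrite mxE !eqxx mulr1.
by move=> j ji; rewrite mxE (negbTE ji) andbF mulr0.
Qed.

Lemma enorm_delta i : enorm (delta_mx ord0 i : 'rV[R]_d) = 1.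
Proof. by rewrite /enorm dotr_delta mxE !eqxx sqrtr1. Qed.

Lemma dotr_mulmx (U : 'M[R]_d) x y :
  orthogonal_mx U -> dotr (x *m U) (y *m U) = dotr x y.
Proof. by move=> UU; rewrite !dotrE trmx_mul mulmxA -(mulmxA x) UU mulmx1. Qed.

Lemma sphereE x : sphere x -> dotr x x = 1.
Proof. by rewrite -sqr_enorm => ->; rewrite expr1n. Qed.

Lemma sphere_coord_le1 x i : sphere x -> `|x ord0 i| <= 1.
Proof.
move=> /sphereE x1; rewrite -(@ler_pXn2r _ 2)// ?nnegrE// expr1n.
rewrite real_normK ?num_real// -x1 /dotr (bigD1 i)//= -expr2 lerDl.
by apply: sumr_ge0 => j _; rewrite -expr2 sqr_ge0.
Qed.

Definition reflection (v : 'rV[R]_d) : 'M[R]_d :=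
  1%:M - (2 / dotr v v) *: (v^T *m v).

Lemma mulmx_reflection x v :
  x *m reflection v = x - (2 / dotr v v * dotr x v) *: v.
Proof.
rewrite /reflection mulmxBr mulmx1 -scalemxAr mulmxA [x *m v^T]mx11_scalar.
by rewrite -dotrE mul_scalar_mx scalerA.
Qed.

Lemma reflection_orthogonal v : v != 0 -> orthogonal_mx (reflection v).
Proof.
move=> v0; rewrite /orthogonal_mx /reflection.
have c0 : dotr v v != 0 by apply: contra_neq v0 => /dotr_eq0.
have vv : v *m v^T = (dotr v v)%:M by rewrite [LHS]mx11_scalar -dotrE.
set c := dotr v v in c0 vv *; clearbody c.
have -> : (1%:M - (2 / c) *: (v^T *m v))^T = 1%:M - (2 / c) *: (v^T *m v).
  by apply/matrixP => j k; rewrite !mxE eq_sym !big_ord1 !mxE (mulrC (v _ j)).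
have vTv a b : (a *: (v^T *m v)) *m (b *: (v^T *m v)) = (a * b * c) *: (v^T *m v).
  rewrite -scalemxAl -scalemxAr scalerA -(mulmxA v^T) (mulmxA v) vv.
  by rewrite mul_scalar_mx -scalemxAr scalerA.
rewrite mulmxBl mul1mx mulmxBr mulmx1 vTv.
rewrite (_ : 2 / c * (2 / c) * c = 2 / c + 2 / c); last by field.
by rewrite scalerDl opprB addrK subrK.
Qed.

(** The reflection along v = x - |x| e_i works because x and |x| e_i have the same norm, so that <x,
    v> = |v|^2 / 2. When v = 0 the identity matrix serves. *)
Lemma householder x i : exists2 U : 'M[R]_d, orthogonal_mx U &
  x *m U = enorm x *: delta_mx ord0 i.
Proof.
set e : 'rV[R]_d := delta_mx ord0 i.
have [xe|xe] := eqVneq x (enorm x *: e).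
  by exists 1%:M; rewrite /orthogonal_mx ?trmx1 mulmx1.
exists (reflection (x - enorm x *: e)).
  by apply: reflection_orthogonal; rewrite subr_eq0.
rewrite mulmx_reflection; set v := x - enorm x *: e; set c := dotr v v.
have c0 : c != 0.
  by apply: contra_neq xe => /dotr_eq0 /eqP; rewrite subr_eq0 => /eqP.
have ee : dotr e e = 1 by rewrite dotr_delta mxE !eqxx.
have xv : dotr x v = c / 2.
  have vN : v = x + (- enorm x) *: e by rewrite /v scaleNr.
  rewrite /c vN !(dotrDl, dotrDr, dotrZl, dotrZr) ee (dotrC e x) -sqr_enorm.
  by field.
rewrite xv (_ : 2 / c * (c / 2) = 1) ?scale1r; last by field.
by rewrite /v opprB addrC subrK.
Qed.

End euclidean_theory.

Section measurable_euclidean.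
Context {R : realType} {d : nat} {disp} {T : measurableType disp}.
Implicit Types f g : T -> 'rV[R]_d.

Lemma measurable_coord_comp f i : measurable_fun setT f ->
  measurable_fun setT (fun t => f t ord0 i).
Proof. exact: (measurableT_comp (measurable_coord i)). Qed.

Lemma measurable_fun_rowD f g :
  measurable_fun setT f -> measurable_fun setT g ->
  measurable_fun setT (fun t => f t + g t).
Proof.
move=> mf mg; apply: measurable_fun_rowP => i.
under eq_fun do rewrite mxE.
by apply: measurable_funD; exact: measurable_coord_comp.
Qed.

Lemma measurable_fun_rowZ (c : T -> R) f :
  measurable_fun setT c -> measurable_fun setT f ->
  measurable_fun setT (fun t => c t *: f t).
Proof.
move=> mc mf; apply: measurable_fun_rowP => i.
under eq_fun do rewrite mxE.
by apply: measurable_funM => //; exact: measurable_coord_comp.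
Qed.

Lemma measurable_fun_row_mulmx (U : 'M[R]_d) f :
  measurable_fun setT f -> measurable_fun setT (fun t => f t *m U).
Proof.
move=> mf; apply: measurable_fun_rowP => i.
under eq_fun do rewrite mxE.
by apply: measurable_sum => j; apply: measurable_funM => //; exact: measurable_coord_comp.
Qed.

Lemma measurable_fun_dotr f g :
  measurable_fun setT f -> measurable_fun setT g ->
  measurable_fun setT (fun t => dotr (f t) (g t)).
Proof.
move=> mf mg; rewrite /dotr.
by apply: measurable_sum => j; apply: measurable_funM => //; exact: measurable_coord_comp.
Qed.

Lemma measurable_fun_enorm f :
  measurable_fun setT f -> measurable_fun setT (fun t => enorm (f t)).
Proof.
move=> mf; rewrite /enorm.
under eq_fun do rewrite -powR12_sqrt ?dotr_ge0//.
by apply: (measurableT_comp (measurable_powR _)); exact: measurable_fun_dotr.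
Qed.

End measurable_euclidean.

Lemma measurable_sphere {R : realType} {d : nat} :
  measurable (@sphere R d).
Proof.
rewrite (_ : sphere = (@enorm R d) @^-1` [set 1])//.
rewrite -[X in measurable X]setTI; apply: measurable_fun_enorm => //.
Qed.

(** * Convexity in r^2 from differential inequalities *)

Section real_lemmas.
Context {R : realType}.
Implicit Types (a b r : R).

Lemma is_derive_expr (m : nat) (x : R) :
  is_derive x (1 : R) (fun y => y ^+ m.+1) (m.+1%:R * x ^+ m).
Proof.
rewrite (_ : (fun z : R => z ^+ m.+1) = id ^+ m.+1); last first.
  by apply/funext => y; rewrite exprfctE.
by apply: (is_derive_eq (is_deriveX m.+1 (@is_derive_id R R x 1))); rewrite /GRing.scale /= mulr1.
Qed.

Lemma is_derive_MVT (f f' : R -> R) a b : a < b ->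
  (forall x : R, a <= x <= b -> is_derive x (1 : R) f (f' x)) ->
  exists2 c, a < c < b & f b - f a = f' c * (b - a).
Proof.
move=> ab df.
have [|||c cab fab] := @MVT R f f' a b.
- by [].
- by move=> x; rewrite in_itv /= => /andP[ax xb]; apply: df; rewrite !ltW.
- apply: derivable_within_continuous => x; rewrite in_itv /= => xab.
  by case: (df x xab).
- by exists c => //; move: cab; rewrite in_itv.
Qed.

Lemma is_derive_ge0_le (f f' : R -> R) a b : a <= b ->
  (forall x : R, a <= x <= b -> is_derive x (1 : R) f (f' x)) ->
  (forall x, a < x < b -> 0 <= f' x) -> f a <= f b.
Proof.
rewrite le_eqVlt => /predU1P[-> //|ab] df f'0.
have [c cab fab] := is_derive_MVT ab df.
by rewrite -subr_ge0 fab mulr_ge0 ?f'0// subr_ge0 ltW.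
Qed.

(* If f = F(r^2), the hypothesis r f'' >= f' says that F is convex, and the
   conclusion is its tangent inequality. *)
Lemma sqr_convex_tangent (f f1 f2 : R -> R) :
  (forall r : R, is_derive r (1 : R) f (f1 r)) ->
  (forall r : R, is_derive r (1 : R) f1 (f2 r)) ->
  (forall r, 0 < r -> f1 r <= r * f2 r) ->
  forall a r, 0 < a -> 0 <= r ->
    f a + f1 a / (2 * a) * (r ^+ 2 - a ^+ 2) <= f r.
Proof.
move=> df df1 f12 a r a0 r0.
(* [f1 z / z] is twice the derivative of f with respect to z^2, so its monotonicity is the
   convexity. *)
have f1_div x y : 0 < x -> x <= y -> f1 x / x <= f1 y / y.
  move=> x0 xy.
  apply: (@is_derive_ge0_le (fun z => f1 z / z)
    (fun z => (z * f2 z - f1 z) / z ^+ 2)) => // z /andP[xz zy].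
    have z0 : 0 < z by exact: lt_le_trans xz.
    have zn0 : z != 0 by rewrite gt_eqF.
    have dV := @is_deriveV R id z 1 1 zn0 (@is_derive_id R R z 1).
    apply: (is_derive_eq (is_deriveM (df1 z) dV)).
    by rewrite /GRing.scale /=; field.
  have z0 : 0 < z by exact: lt_trans xz.
  by rewrite divr_ge0 ?sqr_ge0// subr_ge0 f12.
(* [k] is the derivative of f with respect to r^2 at r = a; it remains to see that f - k r^2 is
   smallest at r = a. *)
pose k := f1 a / (2 * a).
have dm (x : R) : is_derive x (1 : R) (fun y => f y - k * y ^+ 2) (f1 x - 2 * k * x).
  have dX := is_deriveX 2 (@is_derive_id R R x 1).
  have dZ := is_deriveZ k dX.
  apply: (is_derive_eq (is_deriveB (df x) dZ)).
  by rewrite /GRing.scale /=; ring.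
have an0 : a != 0 by rewrite gt_eqF.
rewrite -/k -subr_ge0.
have -> : f r - (f a + k * (r ^+ 2 - a ^+ 2)) =
    (f r - k * r ^+ 2) - (f a - k * a ^+ 2) by ring.
rewrite subr_ge0.
have kE : 2 * k = f1 a / a by rewrite /k; field.
have [ar|ra] := leP a r.
  apply: (is_derive_ge0_le ar (fun x _ => dm x)) => x /andP[ax xr].
  have x0 : 0 < x by exact: lt_trans ax.
  rewrite kE subr_ge0 -ler_pdivlMr//.
  by apply: f1_div => //; exact: ltW.
rewrite -lerN2.
have dmN (x : R) : is_derive x (1 : R) (fun y => - (f y - k * y ^+ 2)) (- (f1 x - 2 * k * x)).
  exact: (is_deriveN (dm x)).
apply: (is_derive_ge0_le (ltW ra) (fun x _ => dmN x)) => x /andP[rx xa].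
have x0 : 0 < x by exact: le_lt_trans rx.
rewrite kE opprB subr_ge0 -ler_pdivrMr//.
by apply: f1_div => //; exact: ltW.
Qed.

(** In dimension n + 2, [W] and [Q] are the radial Laplacian and bilaplacian of [M]. As Q >= 0,
    r^(n+1) W' increases from 0, so W is nondecreasing. Then r^(n+1) M', the integral of y^(n+1) W
    over [0, r], is at most r^(n+2) W / (n + 2), and the equation for M turns this into M' <= r
    M''. *)
Lemma radial_ode_convex (n : nat) (M M1 M2 W W1 W2 Q : R -> R) :
  (forall r : R, is_derive r (1 : R) M (M1 r)) ->
  (forall r : R, is_derive r (1 : R) M1 (M2 r)) ->
  (forall r : R, is_derive r (1 : R) W (W1 r)) ->
  (forall r : R, is_derive r (1 : R) W1 (W2 r)) ->
  (forall r, 0 <= r -> r * M2 r + n.+1%:R * M1 r = r * W r) ->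
  (forall r, 0 <= r -> r * W2 r + n.+1%:R * W1 r = r * Q r) ->
  (forall r, 0 <= r -> 0 <= Q r) ->
  forall r, 0 < r -> M1 r <= r * M2 r.
Proof.
move=> dM dM1 dW dW1 odeM odeW Q0 r r0.
have W1_ge0 x : 0 < x -> 0 <= W1 x.
  move=> x0; rewrite -(@pmulr_rge0 _ (x ^+ n.+1)) ?exprn_gt0//.
  have -> : 0 = 0 ^+ n.+1 * W1 0 by rewrite exprS !mul0r.
  apply: (@is_derive_ge0_le (fun y => y ^+ n.+1 * W1 y)
      (fun y => y ^+ n * (y * Q y)) _ _ (ltW x0)) => y /andP[y0 yx].
    apply: (is_derive_eq (is_deriveM (is_derive_expr n y) (dW1 y))).
    by rewrite -odeW// /GRing.scale /= exprS; ring.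
  by rewrite mulr_ge0 ?exprn_ge0 ?mulr_ge0 ?Q0// ltW.
have n2 : n.+2%:R != 0 :> R by rewrite pnatr_eq0.
have : r ^+ n.+2 * W r / n.+2%:R - r ^+ n.+1 * M1 r >= 0.
  have -> : 0 = 0 ^+ n.+2 * W 0 / n.+2%:R - 0 ^+ n.+1 * M1 0.
    by rewrite !exprS !mul0r subr0.
  apply: (@is_derive_ge0_le (fun y => y ^+ n.+2 * W y / n.+2%:R - y ^+ n.+1 * M1 y)
      (fun y => y ^+ n.+2 * W1 y / n.+2%:R) _ _ (ltW r0)) => y /andP[y0 yx].
    have d1 := is_deriveM (is_derive_expr n.+1 y) (dW y).
    have d2 := is_deriveM d1 (is_derive_cst (n.+2%:R^-1 : R) y 1).
    have d3 := is_deriveM (is_derive_expr n y) (dM1 y).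
    apply: (is_derive_eq (is_deriveB d2 d3)).
    have e : y * M2 y + n.+1%:R * M1 y - y * W y = 0 by rewrite odeM ?subrr.
    rewrite /GRing.scale /=; apply/eqP; rewrite -subr_eq0; apply/eqP.
    transitivity (- (y ^+ n * (y * M2 y + n.+1%:R * M1 y - y * W y))).
      by rewrite !exprS; field.
    by rewrite e mulr0 oppr0.
  apply: mulr_ge0; last by rewrite invr_ge0.
  by apply: mulr_ge0; [apply/exprn_ge0/ltW|exact: W1_ge0].
rewrite subr_ge0 ler_pdivlMr ?ltr0n// => h.
have {}h : n.+2%:R * M1 r <= r * W r.
  rewrite -(@ler_pM2l _ (r ^+ n.+1)) ?exprn_gt0// mulrCA mulrC.
  by rewrite mulrA -exprSr.
have := odeM r (ltW r0); rewrite -natr1 in h *; rewrite -natr1 => h'.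
lra.
Qed.

End real_lemmas.

(** * The uniform law on the sphere *)

Section uniform_law.
Context {R : realType} {d : nat}.
Variable mu : probability 'rV[R]_d R.

(** The property [uniform_on_sphere] restated for a measure; for [distribution P X] the two are
    convertible. *)
Definition sphere_law :=
  mu sphere = 1%E /\
  forall U : 'M[R]_d, orthogonal_mx U ->
  forall B : set 'rV[R]_d, measurable B -> mu ((fun x => x *m U) @^-1` B) = mu B.

Hypothesis mu_unif : sphere_law.

Local Open Scope ereal_scope.

Lemma sphere_law_setC : mu (~` sphere) = 0.
Proof.
rewrite probability_setC ?mu_unif.1 ?subee//; exact: measurable_sphere.
Qed.

(** Nonnegative integrands are treated on the whole space, where Tonelli and pushforwards apply
    directly, signed ones on the sphere, where they are bounded. This passes between the two. *)
Lemma ge0_integral_sphere (f : 'rV[R]_d -> \bar R) :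
  measurable_fun setT f -> (forall x, 0 <= f x) ->
  \int[mu]_x f x = \int[mu]_(x in sphere) f x.
Proof.
move=> mf f0.
rewrite (@ge0_negligible_integral _ _ _ mu setT (~` sphere))//.
- by rewrite setTD setCK.
- by apply: measurableC; exact: measurable_sphere.
- exact: sphere_law_setC.
Qed.

Lemma ge0_integral_mulmx (f : 'rV[R]_d -> \bar R) (U : 'M[R]_d) :
  orthogonal_mx U -> measurable_fun setT f -> (forall x, 0 <= f x) ->
  \int[mu]_x f (x *m U) = \int[mu]_x f x.
Proof.
move=> UU mf f0.
have mU : measurable_fun setT (fun x : 'rV[R]_d => x *m U)%R.
  by apply: measurable_fun_row_mulmx.
rewrite -[LHS](@ge0_integral_pushforward _ _ _ _ _ _ mU mu setT)//.
apply: eq_measure_integral => A mA _.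
exact: mu_unif.2.
Qed.

(** A Householder matrix sends x to |x| e_i, and the measure does not see it: zonal integrals depend
    on x only through |x|. *)
Lemma ge0_integral_dotr (g : R -> \bar R) (x : 'rV[R]_d) i :
  measurable_fun setT g -> (forall r, 0 <= g r) ->
  \int[mu]_u g (dotr x u) = \int[mu]_u g (enorm x * u ord0 i)%R.
Proof.
move=> mg g0; have [U UU xU] := householder x i.
rewrite -[RHS](ge0_integral_mulmx UU)//; last first.
  apply: measurableT_comp => //; apply: measurable_funM => //.
  exact: measurable_coord.
apply: eq_integral => u _; congr g.
rewrite -(dotr_mulmx x u UU) xU dotrZl; congr (_ * _)%R.
by rewrite dotrC dotr_delta.
Qed.

Lemma sphere_integrable (f : 'rV[R]_d -> R) (C : R) :
  measurable_fun setT f -> (forall x, sphere x -> `|f x| <= C)%R ->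
  mu.-integrable sphere (EFin \o f).
Proof.
move=> mf fC; apply: measurable_bounded_integrable => //.
- exact: measurable_sphere.
- by rewrite (le_lt_trans (probability_le1 mu measurable_sphere))// ltry.
- exact: measurable_funTS.
- exists C; split; first exact: num_real.
  by move=> r Cr x /= /fC/le_trans; apply; exact: ltW.
Qed.

Lemma Rintegral_mulmx (f : 'rV[R]_d -> R) (C : R) (U : 'M[R]_d) :
  orthogonal_mx U -> measurable_fun setT f ->
  (forall x, sphere x -> `|f x| <= C)%R ->
  (\int[mu]_(x in sphere) f (x *m U) = \int[mu]_(x in sphere) f x)%R.
Proof.
move=> UU mf fC.
have mU : measurable_fun setT (fun x : 'rV[R]_d => x *m U)%R.
  by apply: measurable_fun_row_mulmx.
have sU : [set x | sphere (x *m U)%R] = @sphere R d.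
  by apply/seteqP; split => x /=; rewrite /sphere /= /enorm dotr_mulmx.
rewrite /Rintegral; congr fine.
rewrite -[in LHS]sU.
rewrite -[LHS](@integral_pushforward _ _ _ _ _ _ mU mu sphere (EFin \o f))//.
- by apply: eq_measure_integral => A mA _; exact: mu_unif.2.
- exact/measurable_EFinP.
- rewrite [X in _.-integrable X _]sU.
  apply: (@sphere_integrable (fun x => f (x *m U)%R) C).
    exact: measurableT_comp.
  by move=> x sx; apply: fC; rewrite -[sphere _]/([set x | sphere (x *m U)%R] x) sU.
- exact: measurable_sphere.
Qed.

End uniform_law.

(** * A Stein identity and the moments of one coordinate *)

Section stein.
Context {R : realType} {d : nat}.
Variable mu : probability 'rV[R]_d R.
Hypothesis mu_unif : sphere_law mu.

(** Reflections take the place of rotations in the plane of coordinates i and j. Reflecting along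
    the unit vector (sin (b/2), - cos (b/2)) produces the angle b by the half-angle formulas. *)
Lemma exists_reflection (i j : 'I_d) (b : R) : i != j ->
  exists2 U : 'M[R]_d, orthogonal_mx U & forall x : 'rV[R]_d,
    (x *m U) ord0 i = x ord0 i * cos b + x ord0 j * sin b /\
    (x *m U) ord0 j = x ord0 i * sin b - x ord0 j * cos b.
Proof.
move=> ij.
set v : 'rV[R]_d := sin (b / 2) *: delta_mx ord0 i - cos (b / 2) *: delta_mx ord0 j.
have vi : v ord0 i = sin (b / 2).
  by rewrite !mxE !eqxx (negbTE ij) /= mulr0 subr0 mulr1.
have vj : v ord0 j = - cos (b / 2).
  by rewrite !mxE !eqxx eq_sym (negbTE ij) /= mulr0 sub0r mulr1.
have xv x : dotr x v = sin (b / 2) * x ord0 i - cos (b / 2) * x ord0 j.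
  by rewrite /v -scaleNr dotrDr !dotrZr !dotr_delta mulNr.
have sc : cos (b / 2) ^+ 2 + sin (b / 2) ^+ 2 = 1 :> R by rewrite cos2Dsin2.
have vv : dotr v v = 1 by rewrite xv vi vj; lra.
clearbody v.
have bE : b = b / 2 + b / 2 by field.
have cE : cos b = 1 - 2 * sin (b / 2) ^+ 2.
  by rewrite {1}bE cosD; lra.
have cE' : cos b = 2 * cos (b / 2) ^+ 2 - 1.
  by rewrite {1}bE cosD; lra.
have sE : sin b = 2 * sin (b / 2) * cos (b / 2).
  by rewrite {1}bE sinD; ring.
exists (reflection v).
  apply: reflection_orthogonal; apply/eqP => v0.
  by have := vv; rewrite v0 dotr0l => /eqP; rewrite eq_sym oner_eq0.
move=> x; rewrite mulmx_reflection vv xv divr1.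
split.
  by rewrite !mxE vi cE sE; ring.
by rewrite !mxE vj cE' sE; ring.
Qed.

(** The mean of x_j g(x_i) does not change along the reflections of angle b, so its derivative in b
    vanishes; at b = 0 that derivative is this integral. *)
Lemma stein_coord (g g' : R -> R) (C : R) (i j : 'I_d) : i != j ->
  measurable_fun setT g ->
  (forall z : R, `|z| <= 1 -> is_derive z (1 : R) g (g' z)) ->
  (forall z : R, `|z| <= 1 -> `|g z| <= C) ->
  (forall z : R, `|z| <= 1 -> `|g' z| <= C) ->
  \int[mu]_(x in sphere)
    (x ord0 i * g (x ord0 i) - x ord0 j ^+ 2 * g' (x ord0 i)) = 0.
Proof.
move=> ij mg dg gC g'C.
have C0 : 0 <= C by apply: le_trans (gC 0 _); rewrite ?normr0.
pose xi b (x : 'rV[R]_d) := x ord0 i * cos b + x ord0 j * sin b.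
pose xj b (x : 'rV[R]_d) := x ord0 i * sin b - x ord0 j * cos b.
have xi1 b x : sphere x -> `|xi b x| <= 1.
  move=> sx; have [U UU xU] := exists_reflection b ij.
  rewrite /xi -(xU x).1; apply: sphere_coord_le1.
  by rewrite /sphere/= /enorm dotr_mulmx.
have xj1 b x : sphere x -> `|xj b x| <= 1.
  move=> sx; have [U UU xU] := exists_reflection b ij.
  rewrite /xj -(xU x).2; apply: sphere_coord_le1.
  by rewrite /sphere/= /enorm dotr_mulmx.
pose f b x := xj b x * g (xi b x).
have mf b : measurable_fun setT (f b).
  apply: measurable_funM.
    by apply: measurable_funB; apply: measurable_funM => //; exact: measurable_coord.
  apply: measurableT_comp => //.
  by apply: measurable_funD; apply: measurable_funM => //; exact: measurable_coord.
have fC b x : sphere x -> `|f b x| <= C.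
  move=> sx; rewrite normrM -[C]mul1r.
  by rewrite ler_pM// ?xj1 ?gC ?xi1.
have df (b : R) (x : 'rV[R]_d) : sphere x ->
    is_derive b (1 : R) (f ^~ x) (xi b x * g (xi b x) - xj b x ^+ 2 * g' (xi b x)).
  move=> sx.
  have dxi : is_derive b (1 : R) (xi ^~ x) (- xj b x).
    by apply: is_derive_eq; rewrite /xj /GRing.scale /=; ring.
  have dxj : is_derive b (1 : R) (xj ^~ x) (xi b x).
    by apply: is_derive_eq; rewrite /xi /GRing.scale /=; ring.
  have dgxi : is_derive b (1 : R) (g \o (xi ^~ x)) (- xj b x * g' (xi b x)).
    have h := @is_derive1_comp R g (xi ^~ x) b _ _ (dg _ (xi1 b x sx)) dxi.
    by apply: (is_derive_eq h); rewrite mulrC.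
  have -> : f ^~ x = (xj ^~ x) * (g \o (xi ^~ x)) by [].
  apply: is_derive_eq; rewrite /GRing.scale /=; ring.
have F'0 := @differentiation_under_integral R _ _ mu f sphere measurable_sphere
  0 (-1) 1 _ _ _ (cst (C + C)).
have Fcst : (fun b => \int[mu]_(x in sphere) f b x) =
    cst (\int[mu]_(x in sphere) (x ord0 j * g (x ord0 i))).
  apply/funext => b.
  have [U UU xU] := exists_reflection b ij.
  rewrite -[RHS](@Rintegral_mulmx _ _ mu mu_unif (fun x => x ord0 j * g (x ord0 i)) C U UU).
  - by apply: eq_Rintegral => x _; rewrite (xU x).1 (xU x).2.
  - apply: measurable_funM; first exact: measurable_coord.
    by apply: measurableT_comp => //; exact: measurable_coord.
  - move=> x sx; rewrite normrM -[C]mul1r.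
    by rewrite ler_pM// ?gC ?sphere_coord_le1.
have d1f b x : sphere x -> partial1of2 f b x = xi b x * g (xi b x) - xj b x ^+ 2 * g' (xi b x).
  by move=> sx; rewrite partial1of2E; case: (df b x sx).
rewrite Fcst derive1_cst in F'0.
(* At b = 0 the reflection fixes x_i and sends x_j to - x_j; the square absorbs the sign. *)
transitivity (\int[mu]_(y in sphere) partial1of2 f 0 y).
  apply: eq_Rintegral => x; rewrite inE => sx.
  by rewrite d1f// /xi /xj sin0 cos0 !mulr1 !mulr0 addr0 sub0r sqrrN.
symmetry; apply: F'0.
- by rewrite /= in_itv /= ltrN10 ltr01.
- move=> b _; apply: sphere_integrable => //; exact: fC.
- by move=> b x _ sx; case: (df b x sx).
- by move=> x; rewrite addr_ge0.
- exact: (finite_measure_integrable_cst mu (C + C) measurable_sphere).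
- move=> b x _ sx; rewrite d1f// (le_trans (ler_normB _ _))// lerD//.
    by rewrite normrM -[C]mul1r ler_pM// ?gC ?xi1.
  by rewrite normrM -[C]mul1r ler_pM// ?g'C ?xi1// normrX exprn_ile1 ?xj1.
Qed.

(** Sum of the coordinate identities over j != i, where the x_j^2 add up to 1 - x_i^2. For d >= 2 it
    is integration by parts against the density of one coordinate, proportional to (1 - z^2)^((d -
    3) / 2). *)
Lemma stein (g g' : R -> R) (C : R) (i : 'I_d) :
  measurable_fun setT g -> measurable_fun setT g' ->
  (forall z : R, `|z| <= 1 -> is_derive z (1 : R) g (g' z)) ->
  (forall z : R, `|z| <= 1 -> `|g z| <= C) ->
  (forall z : R, `|z| <= 1 -> `|g' z| <= C) ->
  \int[mu]_(x in sphere) ((d%:R - 1) * (x ord0 i * g (x ord0 i)))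
  = \int[mu]_(x in sphere) ((1 - x ord0 i ^+ 2) * g' (x ord0 i)).
Proof.
move=> mg mg' dg gC g'C.
have C0 : 0 <= C by apply: le_trans (gC 0 _); rewrite ?normr0.
have mgi : measurable_fun setT (fun x : 'rV[R]_d => g (x ord0 i)).
  by apply: measurableT_comp => //; exact: measurable_coord.
have mg'i : measurable_fun setT (fun x : 'rV[R]_d => g' (x ord0 i)).
  by apply: measurableT_comp => //; exact: measurable_coord.
have iE j : mu.-integrable sphere
    (EFin \o (fun x : 'rV[R]_d => x ord0 i * g (x ord0 i) - x ord0 j ^+ 2 * g' (x ord0 i))).
  apply: (@sphere_integrable _ _ _ _ (C + C)) => //.
    apply: measurable_funB; apply: measurable_funM => //.
      exact: measurable_coord.
    by apply: measurable_funX; exact: measurable_coord.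
  move=> x sx; rewrite (le_trans (ler_normB _ _))// lerD//.
    by rewrite normrM -[C]mul1r ler_pM// ?gC ?sphere_coord_le1.
  rewrite normrM -[C]mul1r ler_pM// ?g'C ?sphere_coord_le1//.
  by rewrite normrX exprn_ile1 ?sphere_coord_le1.
apply/eqP; rewrite -subr_eq0 -RintegralB//; first last.
- apply: (@sphere_integrable _ _ _ _ C) => //.
    apply: measurable_funM => //; apply: measurable_funB => //.
    by apply: measurable_funX; exact: measurable_coord.
  move=> x sx; rewrite normrM -[C]mul1r ler_pM// ?g'C ?sphere_coord_le1//.
  have : x ord0 i ^+ 2 <= 1.
    by rewrite -real_normK ?num_real// exprn_ile1 ?sphere_coord_le1.
  by have := sqr_ge0 (x ord0 i); rewrite ler_norml; lra.
- apply: (@sphere_integrable _ _ _ _ (`|d%:R - 1| * C)) => //.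
    apply: measurable_funM => //; apply: measurable_funM => //.
    exact: measurable_coord.
  move=> x sx; rewrite normrM ler_pM//.
  by rewrite normrM -[C]mul1r ler_pM// ?gC ?sphere_coord_le1.
- exact: measurable_sphere.
rewrite (@eq_Rintegral _ _ _ _ _ (fun x : 'rV[R]_d => \sum_(j < d | j != i)
    (x ord0 i * g (x ord0 i) - x ord0 j ^+ 2 * g' (x ord0 i)))); last first.
  move=> x; rewrite inE => /sphereE; rewrite /dotr (bigD1 i)//= => x1.
  rewrite sumrB sumr_const -mulr_suml.
  have -> : \sum_(j < d | j != i) x ord0 j ^+ 2 = 1 - x ord0 i ^+ 2.
    by rewrite -x1 expr2; under [in RHS]eq_bigr do rewrite -expr2; ring.
  congr (_ - _); rewrite -[RHS]mulr_natl; congr (_ * _).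
  have -> : #|[pred j : 'I_d | j != i]| = d.-1.
    by rewrite (eq_card (B := predC (pred1 i)))// cardC1 card_ord.
  by case: d i {mgi mg'i iE x x1} => [[]//|n _]; rewrite -addn1 natrD addrK addn1.
rewrite /Rintegral.
under eq_integral do rewrite -sumEFin.
rewrite integral_sum//; [|exact: measurable_sphere].
rewrite big1// => j ji.
have := @stein_coord g g' C i j; rewrite eq_sym ji => /(_ isT mg dg gC g'C).
rewrite /Rintegral => E.
rewrite -[LHS]fineK ?E//.
exact: (integrable_fin_num measurable_sphere (iE j)).
Qed.

(** The Stein identity for g(z) = z^(k+1). *)
Lemma sphere_moment_rec (i : 'I_d) (k : nat) :
  (d%:R + k%:R) * \int[mu]_(x in sphere) (x ord0 i ^+ k.+2) =
  k.+1%:R * \int[mu]_(x in sphere) (x ord0 i ^+ k).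
Proof.
have iX m : mu.-integrable sphere (EFin \o (fun x : 'rV[R]_d => x ord0 i ^+ m)).
  apply: (@sphere_integrable _ _ _ _ 1) => //.
    by apply: measurable_funX; exact: measurable_coord.
  by move=> x sx; rewrite normrX exprn_ile1// sphere_coord_le1.
have mE : measurable (@sphere R d) by exact: measurable_sphere.
have E1 : \int[mu]_(x in sphere) ((d%:R - 1) * (x ord0 i * x ord0 i ^+ k.+1)) =
    (d%:R - 1) * \int[mu]_(x in sphere) (x ord0 i ^+ k.+2).
  by rewrite -RintegralZl//; apply: eq_Rintegral => x _; rewrite -exprS.
have E2 : \int[mu]_(x in sphere) ((1 - x ord0 i ^+ 2) * (k.+1%:R * x ord0 i ^+ k)) =
    k.+1%:R * (\int[mu]_(x in sphere) (x ord0 i ^+ k) -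
               \int[mu]_(x in sphere) (x ord0 i ^+ k.+2)).
  rewrite -RintegralB// -RintegralZl//.
    by apply: eq_Rintegral => x _; rewrite !exprS; ring.
  exact: (integrableB mE (iX k) (iX k.+2)).
suff : (d%:R - 1) * \int[mu]_(x in sphere) (x ord0 i ^+ k.+2) =
    k.+1%:R * (\int[mu]_(x in sphere) (x ord0 i ^+ k) -
               \int[mu]_(x in sphere) (x ord0 i ^+ k.+2)).
  by rewrite -[k.+1%:R]natr1; lra.
rewrite -E1 -E2.
apply: (@stein (fun z => z ^+ k.+1) (fun z => k.+1%:R * z ^+ k) k.+1%:R i).
- exact: measurable_funX.
- by apply: measurable_funM => //; exact: measurable_funX.
- by move=> z _; exact: is_derive_expr.
- by move=> z z1; rewrite normrX (le_trans (exprn_ile1 _ _ z1))// ler1n.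
- by move=> z z1; rewrite normrM normrX ger0_norm// ler_piMr// exprn_ile1.
Qed.

Lemma sphere_moment0 (i : 'I_d) : \int[mu]_(x in sphere) (x ord0 i ^+ 0) = 1.
Proof.
rewrite (@eq_Rintegral _ _ _ _ _ (cst 1)); last by move=> x _; rewrite expr0.
rewrite Rintegral_cst ?mul1r; last exact: measurable_sphere.
by rewrite [X in fine X](mu_unif.1).
Qed.

Lemma sphere_moment1 (i : 'I_d) : \int[mu]_(x in sphere) (x ord0 i ^+ 1) = 0.
Proof.
have mf : measurable_fun setT (fun x : 'rV[R]_d => x ord0 i ^+ 1).
  by apply: measurable_funX; exact: measurable_coord.
have fC (x : 'rV[R]_d) : sphere x -> `|x ord0 i ^+ 1| <= 1.
  by move=> sx; rewrite expr1 sphere_coord_le1.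
have NN : orthogonal_mx (- 1%:M : 'M[R]_d).
  by rewrite /orthogonal_mx linearN /= trmx1 mulmxN mulNmx opprK mulmx1.
have := Rintegral_mulmx mu_unif NN mf fC.
rewrite (@eq_Rintegral _ _ _ _ _ (fun x : 'rV[R]_d => -1 * x ord0 i ^+ 1)); last first.
  by move=> x _; rewrite mulmxN mulmx1 !mxE mulN1r.
rewrite RintegralZl; [lra|exact: measurable_sphere|].
exact: (sphere_integrable mu mf fC).
Qed.

Lemma sphere_moment2 (i : 'I_d) :
  \int[mu]_(x in sphere) (x ord0 i ^+ 2) = d%:R^-1.
Proof.
have d0 : d%:R != 0 :> R by rewrite pnatr_eq0; case: d i => // -[].
have := sphere_moment_rec i 0; rewrite sphere_moment0 addr0 => h.
by apply: (mulfI d0); rewrite h mulfV// mulr1.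
Qed.

Lemma sphere_moment3 (i : 'I_d) : \int[mu]_(x in sphere) (x ord0 i ^+ 3) = 0.
Proof.
have d0 : d%:R + 1 != 0 :> R by rewrite natr1 pnatr_eq0.
have := sphere_moment_rec i 1; rewrite sphere_moment1 mulr0 => h.
by apply: (mulfI d0); rewrite h mulr0.
Qed.

End stein.

(** * Bernoulli and Taylor bounds for real powers *)

Section powR_inequalities.
Context {R : realType}.
Implicit Types (q v u : R).

(** As [k1] is nondecreasing and vanishes at 1, [k] decreases before 1 and increases after it.
    Applied to differences of v^q and a polynomial tangent to it at v = 1. *)
Lemma convex_tangent_ge0 (k k1 k2 : R -> R) :
  (forall v : R, 0 < v -> is_derive v (1 : R) k (k1 v)) ->
  (forall v : R, 0 < v -> is_derive v (1 : R) k1 (k2 v)) ->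
  (forall v, 0 < v -> 0 <= k2 v) -> k 1 = 0 -> k1 1 = 0 ->
  forall v, 0 < v -> 0 <= k v.
Proof.
move=> dk dk1 k2_ge0 k10 k110 v v0.
have k1_le x y : 0 < x -> x <= y -> k1 x <= k1 y.
  move=> x0 xy; apply: (@is_derive_ge0_le _ k1 k2) => // z /andP[xz zy].
    by apply: dk1; exact: lt_le_trans xz.
  by apply: k2_ge0; exact: lt_trans xz.
have [v1|v1] := leP 1 v.
  rewrite -k10; apply: (@is_derive_ge0_le _ k k1) => // z /andP[z1 zv].
    by apply: dk; exact: lt_le_trans z1.
  by rewrite -k110; apply: k1_le => //; exact: ltW.
rewrite -oppr_le0 -oppr0 -k10.
apply: (@is_derive_ge0_le _ (fun x => - k x) (fun x => - k1 x)); first exact: ltW.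
  move=> z /andP[vz z1]; apply: is_deriveN; apply: dk; exact: lt_le_trans vz.
move=> z /andP[vz z1]; rewrite oppr_ge0 -k110 k1_le//; last exact: ltW.
exact: lt_trans vz.
Qed.

Lemma measurable_powR_comp {disp} {T : measurableType disp} (f : T -> R) q :
  measurable_fun setT f -> measurable_fun setT (fun x => f x `^ q).
Proof. exact: (measurableT_comp (measurable_powR q)). Qed.

Lemma is_derive_powR_shift q e v : 0 < v + e ->
  is_derive v (1 : R) (fun x => (x + e) `^ q) (q * (v + e) `^ (q - 1)).
Proof.
move=> ve.
have d1 : is_derive v (1 : R) (fun x => x + e) 1.
  have d0 := is_deriveD (@is_derive_id R R v 1) (is_derive_cst e v (1 : R)).
  by apply: (is_derive_eq d0); rewrite addr0.
have h := @is_derive1_comp R (fun x => x `^ q) (fun x => x + e) v _ _ (is_derive1_powR q ve) d1.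
by apply: (is_derive_eq h); rewrite ?mulr1 ?mul1r.
Qed.

Lemma is_derive_powR q v : 0 < v ->
  is_derive v (1 : R) (fun x => x `^ q) (q * v `^ (q - 1)).
Proof. exact: is_derive1_powR. Qed.

(** The hypothesis on q is exactly convexity of v^q, so exponents q <= 0 are included; the case of
    small exponents uses one. *)
Lemma powR_bernoulli q v : 0 <= q * (q - 1) -> 0 < v -> 1 + q * (v - 1) <= v `^ q.
Proof.
move=> q2 v0; rewrite -subr_ge0.
apply: (@convex_tangent_ge0 (fun v => v `^ q - (1 + q * (v - 1)))
  (fun v => q * v `^ (q - 1) - q) (fun v => q * ((q - 1) * v `^ (q - 1 - 1)))) => //.
- move=> x x0.
  have d0 := is_deriveM (is_derive_cst q x (1 : R))
    (is_deriveB (@is_derive_id R R x 1) (is_derive_cst (1 : R) x (1 : R))).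
  have d1 := is_deriveB (is_derive_powR q x0) (is_deriveD (is_derive_cst (1 : R) x (1 : R)) d0).
  by apply: (is_derive_eq d1); rewrite /GRing.scale /= !fctE; ring.
- move=> x x0.
  have d0 := is_deriveM (is_derive_cst q x (1 : R)) (is_derive_powR (q - 1) x0).
  have d1 := is_deriveB d0 (is_derive_cst q x (1 : R)).
  by apply: (is_derive_eq d1); rewrite /GRing.scale /=; ring.
- by move=> x x0; rewrite mulrA mulr_ge0// powR_ge0.
- by rewrite powR1 subrr mulr0 addr0 subrr.
- by rewrite powR1 mulr1 subrr.
Qed.

(** The second derivative of the difference is q (q - 1) times the gap in Bernoulli's inequality for
    the exponent q - 2, which must be at least 1 for v^(q-2) to be convex. *)
Lemma powR_taylor3 q v : 3 <= q -> 0 < v ->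
  1 + q * (v - 1) + q * (q - 1) / 2 * (v - 1) ^+ 2 +
  q * (q - 1) * (q - 2) / 6 * (v - 1) ^+ 3 <= v `^ q.
Proof.
move=> q3 v0; rewrite -subr_ge0.
apply: (@convex_tangent_ge0
  (fun v => v `^ q - (1 + q * (v - 1) + q * (q - 1) / 2 * (v - 1) ^+ 2 +
     q * (q - 1) * (q - 2) / 6 * (v - 1) ^+ 3))
  (fun v => q * v `^ (q - 1) - (q + q * (q - 1) * (v - 1) +
     q * (q - 1) * (q - 2) / 2 * (v - 1) ^+ 2))
  (fun v => q * (q - 1) * (v `^ (q - 1 - 1) - (1 + (q - 2) * (v - 1))))) => //.
- move=> x x0.
  have db : is_derive x (1 : R) (fun x => x - 1) 1.
    have d0 := is_deriveB (@is_derive_id R R x 1) (is_derive_cst (1 : R) x (1 : R)).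
    by apply: (is_derive_eq d0); rewrite subr0.
  have dX n : is_derive x (1 : R) (fun x => (x - 1) ^+ n.+1) (n.+1%:R * (x - 1) ^+ n).
    have h := @is_derive1_comp R (fun x => x ^+ n.+1) (fun x => x - 1) x _ _ (is_derive_expr n (x - 1)) db.
    by apply: (is_derive_eq h); rewrite ?mulr1 ?mul1r.
  have d1 := is_deriveM (is_derive_cst q x (1 : R)) db.
  have d2 := is_deriveM (is_derive_cst (q * (q - 1) / 2) x (1 : R)) (dX 1%N).
  have d3 := is_deriveM (is_derive_cst (q * (q - 1) * (q - 2) / 6) x (1 : R)) (dX 2%N).
  have d := is_deriveB (is_derive_powR q x0)
    (is_deriveD (is_deriveD (is_deriveD (is_derive_cst (1 : R) x (1 : R)) d1) d2) d3).
  by apply: (is_derive_eq d); rewrite /GRing.scale /=; field.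
- move=> x x0.
  have db : is_derive x (1 : R) (fun x => x - 1) 1.
    have d0 := is_deriveB (@is_derive_id R R x 1) (is_derive_cst (1 : R) x (1 : R)).
    by apply: (is_derive_eq d0); rewrite subr0.
  have dX n : is_derive x (1 : R) (fun x => (x - 1) ^+ n.+1) (n.+1%:R * (x - 1) ^+ n).
    have h := @is_derive1_comp R (fun x => x ^+ n.+1) (fun x => x - 1) x _ _ (is_derive_expr n (x - 1)) db.
    by apply: (is_derive_eq h); rewrite ?mulr1 ?mul1r.
  have d1 := is_deriveM (is_derive_cst (q * (q - 1)) x (1 : R)) db.
  have d2 := is_deriveM (is_derive_cst (q * (q - 1) * (q - 2) / 2) x (1 : R)) (dX 1%N).
  have d0 := is_deriveM (is_derive_cst q x (1 : R)) (is_derive_powR (q - 1) x0).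
  have d := is_deriveB d0 (is_deriveD (is_deriveD (is_derive_cst q x (1 : R)) d1) d2).
  by apply: (is_derive_eq d); rewrite /GRing.scale /=; field.
- move=> x x0; rewrite mulr_ge0//; first by nra.
  rewrite subr_ge0 (_ : q - 1 - 1 = q - 2); last by ring.
  by apply: powR_bernoulli => //; nra.
- by rewrite powR1 subrr !expr0n /=; ring.
- by rewrite powR1 subrr !expr0n /=; ring.
Qed.

(** Bernoulli's inequality for the exponent q - 1, multiplied by v. The quadratic coefficient q - 1
    is smaller than the Taylor coefficient q (q - 1) / 2, the price for having no cubic term. *)
Lemma powR_taylor2 q v : 2 <= q -> 0 < v ->
  1 + q * (v - 1) + (q - 1) * (v - 1) ^+ 2 <= v `^ q.
Proof.
move=> q2 v0.
have h : 1 + (q - 1) * (v - 1) <= v `^ (q - 1) by apply: powR_bernoulli => //; nra.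
have <- : v * v `^ (q - 1) = v `^ q by rewrite mulr_powRB1//; [exact: ltW|lra].
by have := ler_wpM2l (ltW v0) h; lra.
Qed.

End powR_inequalities.

(** * Spherical means *)

Section radial_mean.
Context {R : realType} {d : nat}.
Variable mu : probability 'rV[R]_d R.
Hypothesis mu_unif : sphere_law mu.
Variable i : 'I_d.

Lemma sphere_mean_is_derive (h h1 : R -> R -> R) :
  (forall r, measurable_fun setT (h r)) ->
  (forall r z : R, `|z| <= 1 -> is_derive r (1 : R) (h ^~ z) (h1 r z)) ->
  (forall B : R, exists C : R, forall r z, `|r| <= B -> `|z| <= 1 ->
    `|h r z| <= C /\ `|h1 r z| <= C) ->
  forall r : R, is_derive r (1 : R) (fun r => \int[mu]_(x in sphere) h r (x ord0 i))
    (\int[mu]_(x in sphere) h1 r (x ord0 i)).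
Proof.
move=> mh dh hC r.
have mE : measurable (@sphere R d) by exact: measurable_sphere.
have [C {}hC] := hC (`|r| + 1).
have rC (y : R) : `](r - 1), (r + 1)[%classic y -> `|y| <= `|r| + 1.
  rewrite /= in_itv /= => /andP[y1 y2].
  rewrite -lerBlDl (le_trans (lerB_dist _ _))// ler_norml; apply/andP; split; lra.
have C0 : 0 <= C.
  have [|//|+ _] := hC r 0; first by rewrite lerDl.
    by rewrite normr0.
  exact: le_trans.
have d1E y (x : 'rV[R]_d) : sphere x ->
    partial1of2 (fun r (x : 'rV[R]_d) => h r (x ord0 i)) y x = h1 y (x ord0 i).
  move=> sx; rewrite partial1of2E.
  by case: (dh y (x ord0 i) (sphere_coord_le1 i sx)).
have H0 : `](r - 1), (r + 1)[%classic r by rewrite /= in_itv /=; apply/andP; split; lra.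
have H1 y : `](r - 1), (r + 1)[%classic y ->
    mu.-integrable sphere (EFin \o (fun x : 'rV[R]_d => h y (x ord0 i))).
  move=> /rC yC; apply: (@sphere_integrable _ _ _ _ C).
    by apply: measurableT_comp => //; exact: measurable_coord.
  by move=> x sx; have [] := hC y (x ord0 i) yC (sphere_coord_le1 i sx).
have H2 y (x : 'rV[R]_d) : `](r - 1), (r + 1)[%classic y -> sphere x ->
    derivable ((fun r (x : 'rV[R]_d) => h r (x ord0 i)) ^~ x) y 1.
  by move=> _ sx; case: (dh y (x ord0 i) (sphere_coord_le1 i sx)).
have H3 (x : 'rV[R]_d) : 0 <= cst C x by [].
have H4 := finite_measure_integrable_cst mu C mE.
have H5 y (x : 'rV[R]_d) : `](r - 1), (r + 1)[%classic y -> sphere x ->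
    `|partial1of2 (fun r (x : 'rV[R]_d) => h r (x ord0 i)) y x| <= cst C x.
  move=> /rC yC sx; rewrite d1E//.
  by have [] := hC y (x ord0 i) yC (sphere_coord_le1 i sx).
apply: DeriveDef.
  exact: (derivable_under_integral mE H0 H1 H2 H3 H4 H5).
rewrite -derive1E (differentiation_under_integral mE H0 H1 H2 H3 H4 H5).
by apply: eq_Rintegral => x; rewrite inE => sx; rewrite d1E.
Qed.

(** A function on u >= 0 with all its derivatives. Derivatives at u = 0 are two-sided, which u^q
    does not provide; the shift by e does. *)
Definition derivative_tower (F : nat -> R -> R) :=
  (forall n, measurable_fun setT (F n)) /\
  forall n (u : R), 0 <= u -> is_derive u (1 : R) (F n) (F n.+1 u).

Lemma derivative_tower_bounded F n (B : R) : derivative_tower F ->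
  exists C : R, forall u, 0 <= u <= B -> `|F n u| <= C.
Proof.
move=> [_ dF].
have [B0|B0] := ltP B 0.
  by exists 0 => u /andP[u0 uB]; have := le_lt_trans (le_trans u0 uB) B0; rewrite ltxx.
have cF : {within `[0, B], continuous (F n)}.
  apply: derivable_within_continuous => u; rewrite in_itv /= => /andP[u0 _].
  by case: (dF n u u0).
have [c1 _ c1P] := EVT_max B0 cF.
have [c2 _ c2P] := EVT_min B0 cF.
exists (`|F n c1| + `|F n c2|) => u uB.
have uB' : u \in `[0, B] by rewrite in_itv.
have h1 := c1P u uB'; have h2 := c2P u uB'.
have := ler_norm (F n c1); have := ler_norm (- F n c2).
have := normr_ge0 (F n c1); have := normr_ge0 (F n c2).
rewrite normrN ler_norml => *; apply/andP; split; lra.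
Qed.

Definition sphere_mean (k : R -> R) : R := \int[mu]_(x in sphere) k (x ord0 i).

(** Only |z| <= 1 is controlled, the range of a coordinate on the sphere. *)
Definition bounded_mfun (k : R -> R) := measurable_fun setT k /\
  exists C : R, forall z, `|z| <= 1 -> `|k z| <= C.

Lemma bounded_mfun_integrable k : bounded_mfun k ->
  mu.-integrable sphere (EFin \o (fun x : 'rV[R]_d => k (x ord0 i))).
Proof.
move=> [mk [C kC]]; apply: (@sphere_integrable _ _ _ _ C).
  by apply: measurableT_comp => //; exact: measurable_coord.
by move=> x sx; apply: kC; exact: sphere_coord_le1.
Qed.

Lemma bounded_mfunD k l : bounded_mfun k -> bounded_mfun l ->
  bounded_mfun (fun z => k z + l z).
Proof.
move=> [mk [C kC]] [ml [D lD]]; split; first exact: measurable_funD.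
by exists (C + D) => z z1; rewrite (le_trans (ler_normD _ _))// lerD ?kC ?lD.
Qed.

Lemma bounded_mfunM k l : bounded_mfun k -> bounded_mfun l ->
  bounded_mfun (fun z => k z * l z).
Proof.
move=> [mk [C kC]] [ml [D lD]]; split; first exact: measurable_funM.
by exists (C * D) => z z1; rewrite normrM ler_pM ?kC ?lD.
Qed.

Lemma bounded_mfun_cst c : bounded_mfun (fun=> c).
Proof. by split=> //; exists `|c|. Qed.

Lemma bounded_mfun_id : bounded_mfun (fun z => z).
Proof. by split=> //; exists 1. Qed.

Lemma sphere_meanD k l : bounded_mfun k -> bounded_mfun l ->
  sphere_mean (fun z => k z + l z) = sphere_mean k + sphere_mean l.
Proof.
move=> bk bl; rewrite /sphere_mean RintegralD//; first exact: measurable_sphere.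
  exact: bounded_mfun_integrable.
exact: bounded_mfun_integrable.
Qed.

Lemma sphere_meanZ c k : bounded_mfun k ->
  sphere_mean (fun z => c * k z) = c * sphere_mean k.
Proof.
move=> bk; rewrite /sphere_mean RintegralZl//; first exact: measurable_sphere.
exact: bounded_mfun_integrable.
Qed.

Lemma eq_sphere_mean k l : (forall z, `|z| <= 1 -> k z = l z) ->
  sphere_mean k = sphere_mean l.
Proof.
move=> kl; apply: eq_Rintegral => x; rewrite inE => sx.
exact/kl/sphere_coord_le1.
Qed.

Lemma sphere_mean_cst c : sphere_mean (fun=> c) = c.
Proof.
rewrite /sphere_mean (Rintegral_cst _ measurable_sphere).
by rewrite [X in fine X](mu_unif.1) mulr1.
Qed.

Lemma le_sphere_mean k l : bounded_mfun k -> bounded_mfun l ->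
  (forall z, `|z| <= 1 -> k z <= l z) -> sphere_mean k <= sphere_mean l.
Proof.
move=> bk bl kl; apply: le_Rintegral.
- exact: measurable_sphere.
- exact: bounded_mfun_integrable.
- exact: bounded_mfun_integrable.
- by move=> x sx; exact/kl/sphere_coord_le1.
Qed.

Section radial.
Variables (s : R) (F : nat -> R -> R).
Hypothesis s_ge0 : 0 <= s.
Hypothesis dF : derivative_tower F.

(** This is |x + r u|^2 for |x| = s, |u| = 1 and <x, u> = s z. *)
Definition sqr_dist (s r z : R) := s ^+ 2 + r ^+ 2 + 2 * r * s * z.

Lemma sqr_dist_ge0 (t r z : R) : `|z| <= 1 -> 0 <= sqr_dist t r z.
Proof.
move=> z1; rewrite /sqr_dist.
have -> : t ^+ 2 + r ^+ 2 + 2 * r * t * z =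
  (r + t * z) ^+ 2 + t ^+ 2 * (1 - z ^+ 2) by ring.
rewrite addr_ge0 ?sqr_ge0// mulr_ge0 ?sqr_ge0// subr_ge0.
by rewrite -real_normK ?num_real// exprn_ile1.
Qed.

Lemma sqr_dist_le (B r z : R) : `|r| <= B -> `|z| <= 1 ->
  sqr_dist s r z <= (s + B) ^+ 2.
Proof.
move=> rB z1; rewrite /sqr_dist.
have B0 : 0 <= B by exact: le_trans rB.
have h1 : r ^+ 2 <= B ^+ 2 by rewrite -[r ^+ 2]real_normK ?num_real// ler_pXn2r.
have h2 : r * z <= B.
  rewrite (le_trans (ler_norm _))// normrM -[B]mulr1 ler_pM//.
have := ler_wpM2l s_ge0 h2; lra.
Qed.

Lemma measurable_sqr_dist r : measurable_fun setT (sqr_dist s r).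
Proof. by apply: measurable_funD => //; apply: measurable_funM. Qed.

Lemma measurable_tower_dist n r : measurable_fun setT (fun z => F n (sqr_dist s r z)).
Proof. by apply: measurableT_comp; [exact: dF.1|exact: measurable_sqr_dist]. Qed.

Lemma tower_dist_bounded n (B : R) : exists C : R, forall r z,
  `|r| <= B -> `|z| <= 1 -> `|F n (sqr_dist s r z)| <= C.
Proof.
have [C FC] := derivative_tower_bounded n ((s + B) ^+ 2) dF.
by exists C => r z rB z1; rewrite FC// sqr_dist_ge0// sqr_dist_le.
Qed.

Lemma tower_dist_bounded_mfun n r :
  bounded_mfun (fun z => F n (sqr_dist s r z)).
Proof.
split; first exact: measurable_tower_dist.
have [C FC] := tower_dist_bounded n `|r|.
by exists C => z z1; exact: FC.
Qed.

Lemma is_derive_tower_dist n (r z : R) : `|z| <= 1 ->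
  is_derive r (1 : R) (fun r => F n (sqr_dist s r z))
    (2 * (r + s * z) * F n.+1 (sqr_dist s r z)).
Proof.
move=> z1.
have dw : is_derive r (1 : R) (sqr_dist s ^~ z) (2 * (r + s * z)).
  have d1 := is_deriveM (is_derive_cst (2 * s * z) r (1 : R)) (@is_derive_id R R r 1).
  have d2 := is_deriveD (is_deriveD (is_derive_cst (s ^+ 2) r (1 : R)) (is_derive_expr 1 r)) d1.
  rewrite (_ : sqr_dist s ^~ z = cst (s ^+ 2) + (fun y => y ^+ 2) + cst (2 * s * z) * id).
    by apply: (is_derive_eq d2); rewrite /GRing.scale /=; ring.
  by apply/funext => y; rewrite /sqr_dist !fctE; ring.
have h := @is_derive1_comp R (F n) (sqr_dist s ^~ z) r _ _
  (dF.2 n _ (sqr_dist_ge0 s r z1)) dw.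
by apply: (is_derive_eq h); rewrite mulrC.
Qed.

Definition radial0 r := sphere_mean (fun z => F 0%N (sqr_dist s r z)).
Definition radial1 r := sphere_mean (fun z => 2 * (r + s * z) * F 1%N (sqr_dist s r z)).
Definition radial2 r := sphere_mean (fun z =>
  4 * (r + s * z) ^+ 2 * F 2%N (sqr_dist s r z) + 2 * F 1%N (sqr_dist s r z)).

Let affine_bound (B r z : R) : `|r| <= B -> `|z| <= 1 -> `|r + s * z| <= B + s.
Proof.
move=> rB z1; rewrite (le_trans (ler_normD _ _))// lerD// normrM ger0_norm//.
by rewrite ler_piMr.
Qed.

Lemma is_derive_radial0 (r : R) : is_derive r (1 : R) radial0 (radial1 r).
Proof.
apply: (@sphere_mean_is_derive (fun r z => F 0%N (sqr_dist s r z))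
  (fun r z => 2 * (r + s * z) * F 1%N (sqr_dist s r z))).
- by move=> y; exact: measurable_tower_dist.
- by move=> y z; exact: is_derive_tower_dist.
- move=> B.
  have [C0 FC0] := tower_dist_bounded 0 B.
  have [C1 FC1] := tower_dist_bounded 1 B.
  exists (C0 + 2 * (B + s) * C1) => y z yB z1.
  have h0 := FC0 y z yB z1; have h1 := FC1 y z yB z1.
  have h := affine_bound yB z1.
  have h2 : `|2 * (y + s * z) * F 1 (sqr_dist s y z)| <= 2 * (B + s) * C1.
    by rewrite !normrM ger0_norm// ler_pM ?mulr_ge0// ler_pM.
  have := le_trans (normr_ge0 _) h0; have := le_trans (normr_ge0 _) h2.
  by split; lra.
Qed.

Lemma is_derive_radial1 (r : R) : is_derive r (1 : R) radial1 (radial2 r).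
Proof.
apply: (@sphere_mean_is_derive (fun r z => 2 * (r + s * z) * F 1%N (sqr_dist s r z))
 (fun r z => 4 * (r + s * z) ^+ 2 * F 2%N (sqr_dist s r z) + 2 * F 1%N (sqr_dist s r z))).
- move=> y; apply: measurable_funM; last exact: measurable_tower_dist.
  by apply: measurable_funM => //; apply: measurable_funD => //; apply: measurable_funM.
- move=> y z z1.
  have d1 : is_derive y (1 : R) (fun y => 2 * (y + s * z)) 2.
    have d0 := is_deriveM (is_derive_cst (2 : R) y (1 : R))
      (is_deriveD (@is_derive_id R R y 1) (is_derive_cst (s * z) y (1 : R))).
    by apply: (is_derive_eq d0); rewrite /GRing.scale /= !fctE; ring.
  apply: (is_derive_eq (is_deriveM d1 (is_derive_tower_dist 1 y z1))).
  by rewrite /GRing.scale /=; ring.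
- move=> B.
  have [C1 FC1] := tower_dist_bounded 1 B.
  have [C2 FC2] := tower_dist_bounded 2 B.
  exists (2 * (B + s) * C1 + (4 * (B + s) ^+ 2 * C2 + 2 * C1)) => y z yB z1.
  have h0 := FC1 y z yB z1; have h1 := FC2 y z yB z1.
  have h := affine_bound yB z1.
  have h2 : `|2 * (y + s * z) * F 1 (sqr_dist s y z)| <= 2 * (B + s) * C1.
    by rewrite !normrM ger0_norm// ler_pM ?mulr_ge0// ler_pM.
  have h3 : `|4 * (y + s * z) ^+ 2 * F 2 (sqr_dist s y z)| <= 4 * (B + s) ^+ 2 * C2.
    rewrite normrM ler_pM// normrM (ger0_norm (_ : 0 <= 4))// ler_pM// normrX.
    by rewrite ler_pXn2r ?nnegrE// (le_trans _ h).
  have h4 : `|2 * F 1 (sqr_dist s y z)| <= 2 * C1 by rewrite normrM ger0_norm// ler_pM.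
  have h5 := ler_normD (4 * (y + s * z) ^+ 2 * F 2 (sqr_dist s y z)) (2 * F 1 (sqr_dist s y z)).
  have := le_trans (normr_ge0 _) h2; have := le_trans (normr_ge0 _) h3.
  have := le_trans (normr_ge0 _) h4.
  by split; lra.
Qed.

(* The Euler-Poisson-Darboux equation for spherical means: 4 u F'' + 2 d F' is
   the Laplacian of the radial function F(|x|^2). *)
Lemma radial_ode (r : R) :
  r * radial2 r + (d%:R - 1) * radial1 r =
  r * sphere_mean (fun z => 4 * sqr_dist s r z * F 2%N (sqr_dist s r z) +
                            2 * d%:R * F 1%N (sqr_dist s r z)).
Proof.
have b1 := tower_dist_bounded_mfun 1 r.
have b2 := tower_dist_bounded_mfun 2 r.
have bz := bounded_mfun_id.
have bc := bounded_mfun_cst.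
have bw : bounded_mfun (sqr_dist s r).
  by apply: (bounded_mfunD (bc _)); apply: (bounded_mfunM (bc _)).
have bl : bounded_mfun (fun z => r + s * z).
  by apply: (bounded_mfunD (bc _)); apply: (bounded_mfunM (bc _)).
(* The Stein identity for g(z) = F'(s^2 + r^2 + 2 r s z), whose derivative carries the factor 2 r
   s. *)
have stE : sphere_mean (fun z => (d%:R - 1) * (z * F 1%N (sqr_dist s r z))) =
    sphere_mean (fun z => (1 - z ^+ 2) * (2 * r * s * F 2%N (sqr_dist s r z))).
  have [C1 FC1] := tower_dist_bounded 1 `|r|.
  have [C2 FC2] := tower_dist_bounded 2 `|r|.
  apply: (@stein _ _ mu mu_unif (fun z => F 1%N (sqr_dist s r z))
    (fun z => 2 * r * s * F 2%N (sqr_dist s r z)) (C1 + 2 * `|r| * s * C2) i).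
  - exact: measurable_tower_dist.
  - by apply: measurable_funM => //; exact: measurable_tower_dist.
  - move=> z z1.
    have dw : is_derive z (1 : R) (sqr_dist s r) (2 * r * s).
      have d1 := is_deriveM (is_derive_cst (2 * r * s) z (1 : R)) (@is_derive_id R R z 1).
      have d2 := is_deriveD (is_derive_cst (s ^+ 2 + r ^+ 2) z (1 : R)) d1.
      by apply: (is_derive_eq d2); rewrite /GRing.scale /=; ring.
    have h := @is_derive1_comp R (F 1%N) (sqr_dist s r) z _ _
      (dF.2 1%N _ (sqr_dist_ge0 s r z1)) dw.
    by apply: (is_derive_eq h); rewrite mulrC.
  - move=> z z1; rewrite (le_trans (FC1 r z (lexx _) z1))// lerDl.
    by rewrite !mulr_ge0// (le_trans _ (FC2 r 0 _ _)) ?normr0.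
  - move=> z z1; rewrite !normrM (ger0_norm s_ge0) ger0_norm//.
    rewrite -[leLHS]add0r lerD//.
      by rewrite (le_trans _ (FC1 r 0 _ _)) ?normr0.
    by rewrite ler_pM ?mulr_ge0// FC2.
have bL1 : bounded_mfun (fun z => 2 * (r + s * z) * F 1%N (sqr_dist s r z)).
  by apply: bounded_mfunM => //; exact: bounded_mfunM.
have bL2 : bounded_mfun (fun z => 4 * (r + s * z) ^+ 2 * F 2%N (sqr_dist s r z) + 2 * F 1%N (sqr_dist s r z)).
  apply: bounded_mfunD; last exact: bounded_mfunM.
  by apply: bounded_mfunM => //; apply: bounded_mfunM => //; exact: (bounded_mfunM bl bl).
have bL3 : bounded_mfun (fun z => 4 * sqr_dist s r z * F 2%N (sqr_dist s r z) +
                            2 * d%:R * F 1%N (sqr_dist s r z)).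
  apply: bounded_mfunD; last exact: bounded_mfunM.
  by apply: bounded_mfunM => //; exact: bounded_mfunM.
have bS1 : bounded_mfun (fun z => (d%:R - 1) * (z * F 1%N (sqr_dist s r z))).
  by apply: bounded_mfunM => //; exact: bounded_mfunM.
have bS2 : bounded_mfun (fun z => (1 - z ^+ 2) * (2 * r * s * F 2%N (sqr_dist s r z))).
  apply: bounded_mfunM; last exact: bounded_mfunM.
  apply: bounded_mfunD => //.
  rewrite (_ : (fun z => - z ^+ 2) = (fun z => (-1 * z) * z)).
    by apply: bounded_mfunM => //; exact: bounded_mfunM.
  by apply/funext => z; rewrite mulN1r mulNr.
rewrite /radial1 /radial2 -!sphere_meanZ//.
rewrite -sphere_meanD; [|exact: bounded_mfunM|exact: bounded_mfunM].
apply/eqP; rewrite -subr_eq0; apply/eqP; rewrite -[- sphere_mean _]mulN1r.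
rewrite -sphere_meanZ; last exact: bounded_mfunM.
rewrite -sphere_meanD; last 2 first.
- by apply: bounded_mfunD; exact: bounded_mfunM.
- by apply: bounded_mfunM => //; exact: bounded_mfunM.
(* With everything under one mean, the difference of the two sides is 2 s times the difference in
   [stE]. *)
transitivity (sphere_mean (fun z =>
  2 * s * ((d%:R - 1) * (z * F 1%N (sqr_dist s r z))) +
  (- (2 * s)) * ((1 - z ^+ 2) * (2 * r * s * F 2%N (sqr_dist s r z))))).
  by apply: eq_sphere_mean => z _; rewrite {1 4}/sqr_dist; ring.
rewrite sphere_meanD; [|exact: bounded_mfunM|exact: bounded_mfunM].
by rewrite (sphere_meanZ _ bS1) (sphere_meanZ _ bS2) stE mulNr subrr.
Qed.

End radial.

(** The hypothesis says that F(|x|^2) has nonnegative bilaplacian. The Euler-Poisson-Darboux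
    equation, used for F and again for its Laplacian, feeds [radial_ode_convex], and convexity in
    r^2 gives the tangent at r = a. *)
Lemma radial_convex_tangent (s : R) (F : nat -> R -> R) : (2 <= d)%N ->
  0 <= s -> derivative_tower F ->
  (forall u, 0 <= u -> 0 <= 16 * u ^+ 2 * F 4%N u +
    (32 + 16 * d%:R) * u * F 3%N u + (8 * d%:R + 4 * d%:R ^+ 2) * F 2%N u) ->
  forall a r, 0 < a -> 0 <= r ->
  sphere_mean (fun z => F 0%N (sqr_dist s a z)) +
    radial1 s F a / (2 * a) * (r ^+ 2 - a ^+ 2) <=
  sphere_mean (fun z => F 0%N (sqr_dist s r z)).
Proof.
move=> d2 s0 tF bilap.
(* The n-th derivative of the Laplacian 4 u F'' + 2 d F'; the term 4 n is from Leibniz' rule. *)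
pose G n u := 4 * u * F n.+2 u + (4 * n%:R + 2 * d%:R) * F n.+1 u.
have tG : derivative_tower G.
  split=> [n|n u u0].
    apply: measurable_funD; (apply: measurable_funM; last exact: tF.1) => //.
  have d1 : is_derive u (1 : R) (fun u => 4 * u) 4.
    have d0 := is_deriveM (is_derive_cst (4 : R) u (1 : R)) (@is_derive_id R R u 1).
    by apply: (is_derive_eq d0); rewrite /GRing.scale /=; ring.
  have d2' := is_deriveM d1 (tF.2 n.+2 u u0).
  have d3 := is_deriveM (is_derive_cst (4 * n%:R + 2 * d%:R : R) u (1 : R)) (tF.2 n.+1 u u0).
  by apply: (is_derive_eq (is_deriveD d2' d3)); rewrite /GRing.scale /= /G -natr1; ring.
have dE : d%:R - 1 = d.-2.+1%:R :> R by rewrite -[X in X%:R - 1](subnK d2) addn2 /= -natr1 addrK subn2.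
have WE r : sphere_mean (fun z => 4 * sqr_dist s r z * F 2%N (sqr_dist s r z) +
    2 * d%:R * F 1%N (sqr_dist s r z)) = radial0 s G r.
  by apply: eq_sphere_mean => z _; rewrite /G mulr0 add0r.
move=> a r a0 r0.
apply: (@sqr_convex_tangent _ (radial0 s F) (radial1 s F) (radial2 s F) _ _ _ a r a0 r0).
- exact: is_derive_radial0.
- exact: is_derive_radial1.
apply: (@radial_ode_convex _ d.-2 (radial0 s F) _ _ (radial0 s G) (radial1 s G) (radial2 s G)
  (fun r => sphere_mean (fun z => 4 * sqr_dist s r z * G 2%N (sqr_dist s r z) +
    2 * d%:R * G 1%N (sqr_dist s r z)))).
- exact: is_derive_radial0.
- exact: is_derive_radial1.
- exact: is_derive_radial0.
- exact: is_derive_radial1.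
- by move=> y _; rewrite -dE radial_ode// WE.
- by move=> y _; rewrite -dE radial_ode.
- move=> y y0; apply: Rintegral_ge0 => x sx.
  have w0 := sqr_dist_ge0 s y (sphere_coord_le1 i sx).
  have := bilap _ w0; rewrite /G; set w := sqr_dist _ _ _.
  by congr (_ <= _); ring.
Qed.

End radial_mean.

(** * Spherical means for q <= 2 *)

Section small_exponent.
Context {R : realType} {d : nat}.
Variable mu : probability 'rV[R]_d R.
Hypothesis mu_unif : sphere_law mu.
Variable i : 'I_d.
Hypothesis d_ge2 : (2 <= d)%N.

Definition powR_tower (q e : R) (n : nat) (u : R) : R :=
  (\prod_(k < n) (q - k%:R)) * (u + e) `^ (q - n%:R).

Definition sqr_tower (n : nat) (u : R) : R :=
  match n with 0%N => u ^+ 2 | 1%N => 2 * u | 2%N => 2 | _ => 0 end.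

Definition cube_tower (n : nat) (u : R) : R :=
  match n with 0%N => u ^+ 3 | 1%N => 3 * u ^+ 2 | 2%N => 6 * u | 3%N => 6
  | _ => 0 end.

Lemma powR_tower_derivative q e : 0 < e -> derivative_tower (powR_tower q e).
Proof.
move=> e0; split=> [n|n u u0].
  apply: measurable_funM => //.
  by apply: measurable_powR_comp; exact: measurable_funD.
have ue : 0 < u + e by exact: ltr_wpDl.
have d0 := is_deriveM (is_derive_cst (\prod_(k < n) (q - k%:R)) u (1 : R))
  (is_derive_powR_shift (q - n%:R) ue).
apply: (is_derive_eq d0); rewrite /powR_tower big_ord_recr /GRing.scale /=.
by rewrite -natr1 opprD addrA; ring.
Qed.

Lemma sqr_tower_derivative : derivative_tower sqr_tower.
Proof.
split=> [n|n u _].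
  case: n => [|[|[|n]]]; rewrite /sqr_tower; [|exact: measurable_funM|exact: measurable_cst..].
  exact: measurable_funX.
case: n => [|[|n]] /=.
- by apply: (is_derive_eq (is_derive_expr 1 u)); rewrite expr1.
- have d0 := is_deriveM (is_derive_cst (2 : R) u (1 : R)) (@is_derive_id R R u 1).
  by apply: (is_derive_eq d0); rewrite /GRing.scale /=; ring.
- by case: n => [|n] /=; exact: is_derive_cst.
Qed.

Lemma cube_tower_derivative : derivative_tower cube_tower.
Proof.
split=> [n|n u _].
  case: n => [|[|[|[|n]]]]; rewrite /cube_tower; [| |exact: measurable_funM|exact: measurable_cst..].
    exact: measurable_funX.
  by apply: measurable_funM => //; exact: measurable_funX.
case: n => [|[|[|n]]] /=.
- by apply: (is_derive_eq (is_derive_expr 2 u)).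
- have d0 := is_deriveM (is_derive_cst (3 : R) u (1 : R)) (is_derive_expr 1 u).
  by apply: (is_derive_eq d0); rewrite /GRing.scale /=; ring.
- have d0 := is_deriveM (is_derive_cst (6 : R) u (1 : R)) (@is_derive_id R R u 1).
  by apply: (is_derive_eq d0); rewrite /GRing.scale /=; ring.
- by case: n => [|n] /=; exact: is_derive_cst.
Qed.

Lemma derivative_towerD (F G : nat -> R -> R) :
  derivative_tower F -> derivative_tower G ->
  derivative_tower (fun n u => F n u + G n u).
Proof.
move=> tF tG; split=> [n|n u u0].
  by apply: measurable_funD; [exact: tF.1|exact: tG.1].
exact: (is_deriveD (tF.2 n u u0) (tG.2 n u u0)).
Qed.

Lemma derivative_towerZ c (F : nat -> R -> R) :
  derivative_tower F -> derivative_tower (fun n u => c * F n u).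
Proof.
move=> tF; split=> [n|n u u0].
  by apply: measurable_funM => //; exact: tF.1.
apply: (is_derive_eq (is_deriveM (is_derive_cst c u (1 : R)) (tF.2 n u u0))).
by rewrite /GRing.scale /=; ring.
Qed.

Let dR : 2 <= d%:R :> R. Proof. by rewrite ler_nat. Qed.

(* With v = u + e, the bilaplacian of (|x|^2 + e)^q is
   q (q-1) v^(q-4) [(4q-4+2d)(4q-8+2d) v^2 - 4e(q-2)(8q-16+4d) v
                    + 16 e^2 (q-2)(q-3)]. *)
Lemma powR_bilaplacian q e u : 1 <= q <= 2 -> 0 < e -> 0 <= u ->
  q * (q - 1) * (4 * q - 4 + 2 * d%:R) * (4 * q - 8 + 2 * d%:R) *
    (u + e) `^ (q - 2) <=
  16 * u ^+ 2 * powR_tower q e 4 u +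
    (32 + 16 * d%:R) * u * powR_tower q e 3 u +
    (8 * d%:R + 4 * d%:R ^+ 2) * powR_tower q e 2 u.
Proof.
move=> /andP[q1 q2] e0 u0.
have v0 : 0 < u + e by exact: ltr_wpDl.
rewrite /powR_tower !big_ord_recr big_ord0 /= !mul1r.
set v := u + e.
have vD r : v `^ (r + (q - 4)) = v `^ r * v `^ (q - 4).
  by rewrite powRD// (gt_eqF v0) implybT.
have v1 : v `^ (q - 3) = v * v `^ (q - 4).
  by rewrite -{2}[v]powRr1 ?ltW// -vD; congr (_ `^ _); ring.
have v2 : v `^ (q - 2) = v ^+ 2 * v `^ (q - 4).
  by rewrite -powR_mulrn ?ltW// -vD; congr (_ `^ _); ring.
rewrite v1 v2 -subr_ge0.
(* What remains above the lower bound are the two terms in e of the expansion; for 1 <= q <= 2 both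
   are nonnegative, since 8 q - 16 + 4 d >= 0 as d >= 2. *)
rewrite (_ : _ - _ = q * (q - 1) * v `^ (q - 4) *
  (4 * e * (2 - q) * v * (8 * q - 16 + 4 * d%:R) + 16 * e ^+ 2 * (2 - q) * (3 - q))); last first.
  by rewrite (_ : u = v - e); [ring|rewrite /v addrK].
have h1 : 0 <= q * (q - 1) by nra.
apply: mulr_ge0; first by rewrite mulr_ge0 ?powR_ge0.
have h2 : 0 <= 8 * q - 16 + 4 * d%:R by have := dR; lra.
apply: addr_ge0; apply: mulr_ge0 => //; last lra.
  by apply: mulr_ge0; [apply: mulr_ge0; lra|exact: ltW].
by apply: mulr_ge0; [rewrite mulr_ge0 ?sqr_ge0|lra].
Qed.

Lemma sphere_mean_sqr (b c : R) :
  sphere_mean mu i (fun z => (b + c * z) ^+ 2) = b ^+ 2 + c ^+ 2 / d%:R.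
Proof.
have bc := @bounded_mfun_cst R.
have bX n : bounded_mfun (fun z : R => z ^+ n).
  split; first exact: measurable_funX.
  by exists 1 => z z1; rewrite normrX exprn_ile1.
have bZ k n : bounded_mfun (fun z : R => k * z ^+ n) by exact: bounded_mfunM.
transitivity (sphere_mean mu i (fun z => b ^+ 2 + (2 * b * c * z ^+ 1 + c ^+ 2 * z ^+ 2))).
  by apply: eq_sphere_mean => z _; ring.
rewrite !sphere_meanD//; last exact: bounded_mfunD.
rewrite !sphere_meanZ// sphere_mean_cst//.
by rewrite /sphere_mean sphere_moment1// sphere_moment2// mulr0 add0r.
Qed.

Lemma sphere_mean_cube (b c : R) :
  sphere_mean mu i (fun z => (b + c * z) ^+ 3) =
  b ^+ 3 + 3 * b * c ^+ 2 / d%:R.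
Proof.
have bc := @bounded_mfun_cst R.
have bX n : bounded_mfun (fun z : R => z ^+ n).
  split; first exact: measurable_funX.
  by exists 1 => z z1; rewrite normrX exprn_ile1.
have bZ k n : bounded_mfun (fun z : R => k * z ^+ n) by exact: bounded_mfunM.
transitivity (sphere_mean mu i (fun z => b ^+ 3 +
    (3 * b ^+ 2 * c * z ^+ 1 + (3 * b * c ^+ 2 * z ^+ 2 + c ^+ 3 * z ^+ 3)))).
  by apply: eq_sphere_mean => z _; ring.
have b1 : bounded_mfun (fun z => 3 * b * c ^+ 2 * z ^+ 2 + c ^+ 3 * z ^+ 3).
  exact: bounded_mfunD.
rewrite !sphere_meanD//; last exact: bounded_mfunD.
rewrite !sphere_meanZ// sphere_mean_cst//.
rewrite /sphere_mean sphere_moment1// sphere_moment2// sphere_moment3//.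
by rewrite !mulr0 add0r addr0.
Qed.

(** The bilaplacian of (|x|^2 + e)^q is at least C v^(q-2) with v = |x|^2 + e, hence, by the tangent
    of v^(q-2) at 1, at least an affine function of |x|^2. [K1] and [K2] make that function the
    bilaplacian of K1 |x|^4 - K2 |x|^6. Subtracting this polynomial leaves spherical means convex in
    r^2; the means of the polynomial itself are explicit and supply the quadratic and cubic
    terms. *)
Lemma sphere_mean_powR_small q e s a : 1 <= q <= 2 -> 0 < e <= 1 / 2 ->
  0 <= s -> 0 < a ->
  let C := q * (q - 1) * (4 * q - 4 + 2 * d%:R) * (4 * q - 8 + 2 * d%:R) in
  let K1 := C * (1 + (2 - q) / 2) / (8 * d%:R * (d%:R + 2)) in
  let K2 := C * (2 - q) / (24 * (d%:R + 2) * (d%:R + 4)) in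
  exists k : R, forall r, 0 <= r ->
  sphere_mean mu i (fun z => (sqr_dist s a z + e) `^ q) +
    k * (r ^+ 2 - a ^+ 2) +
    (K1 - K2 * (3 * a ^+ 2 + (3 + 12 / d%:R) * s ^+ 2)) * (r ^+ 2 - a ^+ 2) ^+ 2 -
    K2 * (r ^+ 2 - a ^+ 2) ^+ 3 <=
  sphere_mean mu i (fun z => (sqr_dist s r z + e) `^ q).
Proof.
move=> q12 /andP[e0 e2] s0 a0 C K1 K2.
have d0 : 0 < d%:R :> R by apply: lt_le_trans dR.
have C0 : 0 <= C.
  move: q12 => /andP[q1 q2]; rewrite /C.
  have h1 : 0 <= 4 * q - 4 + 2 * d%:R by have := dR; lra.
  have h2 : 0 <= 4 * q - 8 + 2 * d%:R by have := dR; lra.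
  have h3 : 0 <= q * (q - 1) by apply: mulr_ge0; lra.
  by apply: mulr_ge0 => //; apply: mulr_ge0.
pose F n u := powR_tower q e n u + ((- K1) * sqr_tower n u + K2 * cube_tower n u).
have tP := powR_tower_derivative q e0.
have tS := derivative_towerZ (- K1) sqr_tower_derivative.
have tC := derivative_towerZ K2 cube_tower_derivative.
have tF : derivative_tower F.
  exact: (derivative_towerD tP (derivative_towerD tS tC)).
have bilap u : 0 <= u -> 0 <= 16 * u ^+ 2 * F 4%N u +
    (32 + 16 * d%:R) * u * F 3%N u + (8 * d%:R + 4 * d%:R ^+ 2) * F 2%N u.
  move=> u0.
  have h1 := powR_bilaplacian q12 e0 u0.
  rewrite -/C in h1.
  (* Since e <= 1/2, the constant (2 - q) (1 - e) of this tangent is at least (2 - q) / 2, the extra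
     term in [K1]. *)
  have h2 : 1 + (q - 2) * (u + e - 1) <= (u + e) `^ (q - 2).
    by apply: powR_bernoulli; [move: q12 => /andP[]; nra|exact: ltr_wpDl].
  have h3 : (2 - q) * e <= (2 - q) / 2.
    by apply: ler_wpM2l; [move: q12 => /andP[]; lra|lra].
  have h4 : C * (1 + (2 - q) / 2 - (2 - q) * u) <= C * (u + e) `^ (q - 2).
    by apply: ler_wpM2l => //; lra.
  (* The bilaplacians of |x|^4 and |x|^6 are 8 d (d + 2) and 24 (d + 2) (d + 4) |x|^2; these are the
     denominators of [K1] and [K2]. *)
  rewrite (_ : 16 * u ^+ 2 * F 4%N u + _ + _ =
    (16 * u ^+ 2 * powR_tower q e 4 u + (32 + 16 * d%:R) * u * powR_tower q e 3 u +
    (8 * d%:R + 4 * d%:R ^+ 2) * powR_tower q e 2 u) -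
    C * (1 + (2 - q) / 2 - (2 - q) * u)).
    by rewrite subr_ge0; exact: le_trans h1.
  rewrite /F /K1 /K2 /=; field.
  by apply/and3P; split; rewrite gt_eqF//; lra.
have h := radial_convex_tangent mu_unif i d_ge2 s0 tF bilap a0.
have FE r : sphere_mean mu i (fun z => F 0%N (sqr_dist s r z)) =
    sphere_mean mu i (fun z => (sqr_dist s r z + e) `^ q) +
    ((- K1) * ((s ^+ 2 + r ^+ 2) ^+ 2 + (2 * r * s) ^+ 2 / d%:R) +
      K2 * ((s ^+ 2 + r ^+ 2) ^+ 3 + 3 * (s ^+ 2 + r ^+ 2) * (2 * r * s) ^+ 2 / d%:R)).
  have b0 := tower_dist_bounded_mfun s0 tP 0 r.
  have b1 := tower_dist_bounded_mfun s0 tS 0 r.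
  have b2 := tower_dist_bounded_mfun s0 tC 0 r.
  rewrite /F sphere_meanD//; last exact: bounded_mfunD.
  congr (_ + _).
    by apply: eq_sphere_mean => z _; rewrite /powR_tower big_ord0 mul1r subr0.
  rewrite sphere_meanD// !sphere_meanZ; last 2 first.
  - exact: (tower_dist_bounded_mfun s0 cube_tower_derivative 0 r).
  - exact: (tower_dist_bounded_mfun s0 sqr_tower_derivative 0 r).
  by rewrite -sphere_mean_sqr -sphere_mean_cube.
(* Besides the tangent slope, the coefficients of r^2 - a^2 in the means of K1 |x|^4 and K2 |x|^6,
   both expanded at r = a. *)
exists (radial1 mu i s F a / (2 * a) +
  K1 * (2 * a ^+ 2 + (2 + 4 / d%:R) * s ^+ 2) -
  K2 * (3 * a ^+ 4 + (3 + 12 / d%:R) * (s ^+ 4 + 2 * s ^+ 2 * a ^+ 2))) => r r0.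
have {}h := h r r0.
clearbody F C K1 K2; rewrite (FE a) (FE r) -subr_ge0 in h.
rewrite -subr_ge0; move: h.
set M1 := sphere_mean _ _ _; set M2 := sphere_mean _ _ _; set k := radial1 _ _ _ _ _ / _.
clearbody M1 M2 k.
congr (0 <= _); field.
by rewrite gt_eqF.
Qed.

End small_exponent.

(** * Spherical means for q >= 2 *)

Section large_exponent.
Context {R : realType}.

Lemma powR_bernoulli_concave (q v : R) : 0 <= q <= 1 -> 0 < v ->
  v `^ q <= 1 + q * (v - 1).
Proof.
move=> /andP[q0 q1] v0; rewrite -subr_ge0.
apply: (@convex_tangent_ge0 _ (fun v => 1 + q * (v - 1) - v `^ q)
  (fun v => q - q * v `^ (q - 1)) (fun v => q * ((1 - q) * v `^ (q - 1 - 1))) _ _ _ _ _ v v0).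
- move=> x x0.
  have d0 := is_deriveM (is_derive_cst q x (1 : R))
    (is_deriveB (@is_derive_id R R x 1) (is_derive_cst (1 : R) x (1 : R))).
  have d1 := is_deriveB (is_deriveD (is_derive_cst (1 : R) x (1 : R)) d0) (is_derive_powR q x0).
  by apply: (is_derive_eq d1); rewrite /GRing.scale /= !fctE; ring.
- move=> x x0.
  have d0 := is_deriveM (is_derive_cst q x (1 : R)) (is_derive_powR (q - 1) x0).
  have d1 := is_deriveB (is_derive_cst q x (1 : R)) d0.
  by apply: (is_derive_eq d1); rewrite /GRing.scale /=; ring.
- by move=> x x0; rewrite !mulr_ge0 ?powR_ge0 ?subr_ge0.
- by rewrite powR1 subrr mulr0 addr0 subrr.
- by rewrite powR1 mulr1 subrr.
Qed.

Let is_derive_1D (g y : R) : 0 < 1 + y ->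
  is_derive y (1 : R) (fun y => (1 + y) `^ g) (g * (1 + y) `^ (g - 1)).
Proof.
rewrite addrC => y1; have := is_derive_powR_shift g y1.
by rewrite (_ : (fun x => (x + 1) `^ g) = (fun y => (1 + y) `^ g))//; apply/funext => z; rewrite addrC.
Qed.

Let is_derive_1B (g y : R) : 0 < 1 - y ->
  is_derive y (1 : R) (fun y => (1 - y) `^ g) (- (g * (1 - y) `^ (g - 1))).
Proof.
move=> y1.
have d1 : is_derive y (1 : R) (fun y => 1 - y) (-1).
  have d0 := is_deriveB (is_derive_cst (1 : R) y (1 : R)) (@is_derive_id R R y 1).
  by apply: (is_derive_eq d0); rewrite sub0r.
have h := @is_derive1_comp R (fun x => x `^ g) (fun x => 1 - x) y _ _ (is_derive1_powR g y1) d1.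
by apply: (is_derive_eq h); ring.
Qed.

Lemma powR_sum_le2 (g y : R) : 0 <= g <= 1 -> 0 <= y < 1 ->
  (1 + y) `^ g + (1 - y) `^ g <= 2.
Proof.
move=> g01 /andP[y0 y1].
have h1 : (1 + y) `^ g <= 1 + g * (1 + y - 1) by apply: powR_bernoulli_concave => //; lra.
have h2 : (1 - y) `^ g <= 1 + g * (1 - y - 1) by apply: powR_bernoulli_concave => //; lra.
lra.
Qed.

Lemma powR_sum_ge2 (g y : R) : 1 <= g -> 0 <= y < 1 ->
  2 <= (1 + y) `^ g + (1 - y) `^ g.
Proof.
move=> g1 /andP[y0 y1].
have gg : 0 <= g * (g - 1) by nra.
have h1 : 1 + g * (1 + y - 1) <= (1 + y) `^ g by apply: powR_bernoulli => //; lra.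
have h2 : 1 + g * (1 - y - 1) <= (1 - y) `^ g by apply: powR_bernoulli => //; lra.
lra.
Qed.

Lemma powR_diff_ge0 (g y : R) : 0 <= g -> 0 <= y < 1 ->
  (1 - y) `^ g <= (1 + y) `^ g.
Proof.
by move=> g0 /andP[y0 y1]; apply: ge0_ler_powR; rewrite ?nnegrE//; lra.
Qed.

(** Midpoint bound: the left side is g + 1 times the integral of the concave function (1 + s)^g over
    [-y, y]. *)
Lemma powR_diff_le_small (g y : R) : 0 <= g <= 1 -> 0 <= y < 1 ->
  (1 + y) `^ (g + 1) - (1 - y) `^ (g + 1) <= 2 * (g + 1) * y.
Proof.
move=> g01 /andP[y0 y1]; rewrite -subr_ge0.
pose k (y : R) := 2 * (g + 1) * y - ((1 + y) `^ (g + 1) - (1 - y) `^ (g + 1)).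
have k0 : k 0 = 0 by rewrite /k !addr0 subr0 mulr0 subrr subr0.
rewrite -[leLHS]k0.
apply: (@is_derive_ge0_le _ k (fun y => (g + 1) * (2 - ((1 + y) `^ g + (1 - y) `^ g))) _ _ y0).
  move=> x /andP[x0 xy].
  have d1 := is_deriveM (is_derive_cst (2 * (g + 1)) x (1 : R)) (@is_derive_id R R x 1).
  have h1 : 0 < 1 + x by lra.
  have h2 : 0 < 1 - x by lra.
  have d2 := is_deriveB d1 (is_deriveB (is_derive_1D (g + 1) h1) (is_derive_1B (g + 1) h2)).
  by apply: (is_derive_eq d2); rewrite /GRing.scale /= addrK; ring.
move=> x /andP[x0 xy].
have h : (1 + x) `^ g + (1 - x) `^ g <= 2 by apply: powR_sum_le2 => //; lra.
by apply: mulr_ge0; lra.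
Qed.

(** Trapezoidal bound for the same integral, (1 + s)^g now being convex. *)
Lemma powR_diff_le_large (g y : R) : 1 <= g -> 0 <= y < 1 ->
  (1 + y) `^ (g + 1) - (1 - y) `^ (g + 1) <=
  (g + 1) * y * ((1 + y) `^ g + (1 - y) `^ g).
Proof.
move=> g1 /andP[y0 y1]; rewrite -subr_ge0.
pose k (y : R) := (g + 1) * y * ((1 + y) `^ g + (1 - y) `^ g) -
  ((1 + y) `^ (g + 1) - (1 - y) `^ (g + 1)).
have k0 : k 0 = 0 by rewrite /k !addr0 subr0 mulr0 mul0r subrr subr0.
rewrite -[leLHS]k0.
apply: (@is_derive_ge0_le _ k (fun y => (g + 1) * y *
  (g * ((1 + y) `^ (g - 1) - (1 - y) `^ (g - 1)))) _ _ y0).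
  move=> x /andP[x0 xy].
  have h1 : 0 < 1 + x by lra.
  have h2 : 0 < 1 - x by lra.
  have d1 := is_deriveM (is_derive_cst (g + 1) x (1 : R)) (@is_derive_id R R x 1).
  have d2 := is_deriveM d1 (is_deriveD (is_derive_1D g h1) (is_derive_1B g h2)).
  have d3 := is_deriveB d2 (is_deriveB (is_derive_1D (g + 1) h1) (is_derive_1B (g + 1) h2)).
  by apply: (is_derive_eq d3); rewrite /GRing.scale /= !fctE addrK; ring.
move=> x /andP[x0 xy].
have h : (1 - x) `^ (g - 1) <= (1 + x) `^ (g - 1) by apply: powR_diff_ge0; lra.
apply: mulr_ge0; first by apply: mulr_ge0; lra.
by apply: mulr_ge0; lra.
Qed.

(* The bracket below is what is left of r n'' - n' for
   n(r) = ((b + 2 r t)^q + (b - 2 r t)^q) / 2 - b^q, b = r^2 + const,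
   after division by 2 q (q - 1) r b^(q - 2); y = 2 r t / b. *)
Lemma antipodal_bracket (g y b r t : R) : 0 <= g -> 0 <= y < 1 ->
  0 < b -> 0 < r -> 0 <= t -> 2 * r * t = b * y -> r ^+ 2 + t ^+ 2 <= b ->
  t * ((1 + y) `^ (g + 1) - (1 - y) `^ (g + 1)) * b +
    2 * r * (g + 1) * 2 * r ^+ 2 <=
  2 * r * (g + 1) * ((1 + y) `^ g * (r + t) ^+ 2 + (1 - y) `^ g * (r - t) ^+ 2).
Proof.
move=> g0 y01 b0 r0 t0 rty rtb.
have /andP[y0 y1] := y01.
have h1 : 0 < 1 + y by lra.
have h2 : 0 < 1 - y by lra.
have E1 : (1 + y) `^ (g + 1) = (1 + y) * (1 + y) `^ g.
  by rewrite powRD ?(gt_eqF h1) ?implybT// powRr1 1?mulrC// ltW.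
have E2 : (1 - y) `^ (g + 1) = (1 - y) * (1 - y) `^ g.
  by rewrite powRD ?(gt_eqF h2) ?implybT// powRr1 1?mulrC// ltW.
have xD := powR_diff_ge0 g0 y01.
set A := (1 + y) `^ g in xD E1 *; set B := (1 - y) `^ g in xD E2 *.
have sq1 : (r + t) ^+ 2 = r ^+ 2 + t ^+ 2 + b * y by rewrite -rty; ring.
have sq2 : (r - t) ^+ 2 = r ^+ 2 + t ^+ 2 - b * y by rewrite -rty; ring.
have by0 : 0 <= b * y * (A - B) by rewrite !mulr_ge0 ?subr_ge0// ltW.
have rg : 0 <= 2 * r * (g + 1) by rewrite !mulr_ge0//; lra.
(* Because b y = 2 r t, a bound (g + 1) y T on the difference of powers contributes 2 r (g + 1) t^2
   T, so the common factor 2 r (g + 1) can be removed. *)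
suff [T hD hT] : exists2 T, (1 + y) `^ (g + 1) - (1 - y) `^ (g + 1) <= (g + 1) * y * T &
    t ^+ 2 * T + 2 * r ^+ 2 <= A * (r + t) ^+ 2 + B * (r - t) ^+ 2.
  have tb : 0 <= t * b by rewrite mulr_ge0// ltW.
  have := ler_wpM2l tb hD.
  rewrite (_ : t * b * ((g + 1) * y * T) = 2 * r * (g + 1) * (t ^+ 2 * T)); last first.
    transitivity (t * (g + 1) * T * (b * y)); first by ring.
    by rewrite -rty; ring.
  have := ler_wpM2l rg hT.
  by rewrite mulrDr; lra.
(* The trapezoidal bound gives T = A + B for g >= 1, the midpoint bound T = 2 for g < 1. *)
have [g1|g1] := leP 1 g.
  exists (A + B); first exact: powR_diff_le_large.
  have := powR_sum_ge2 g1 y01; rewrite -/A -/B => AB.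
  have : 0 <= r ^+ 2 * (A + B - 2) by rewrite mulr_ge0 ?sqr_ge0// subr_ge0.
  rewrite sq1 sq2; lra.
exists 2.
  by rewrite (_ : (g + 1) * y * 2 = 2 * (g + 1) * y); [apply: powR_diff_le_small => //; lra|ring].
have AB : A + B <= 2 by apply: powR_sum_le2 => //; lra.
(* Here A + B <= 2 goes the wrong way. Compensation comes from b ((1 + y) A + (1 - y) B) >= 2 b;
   adding this product lowers b to r^2 + t^2. *)
have : 0 <= (b - (r ^+ 2 + t ^+ 2)) * (2 - (A + B)) by rewrite mulr_ge0 ?subr_ge0.
have g11 : 1 <= g + 1 by lra.
have := powR_sum_ge2 g11 y01; rewrite E1 E2 => h.
have := ler_wpM2l (ltW b0) h.
rewrite sq1 sq2; lra.
Qed.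

(** With b = r^2 + const, the first bracket is r h'' - h' for h = (b + 2 r t)^q, the second the same
    with - t, and the left side is twice the same expression for b^q. So the antipodal average minus
    b^q is convex in r^2. *)
Lemma antipodal_convexity (q b r t : R) : 2 <= q -> 0 < r -> 0 <= t ->
  r ^+ 2 + t ^+ 2 <= b -> 2 * r * t < b ->
  8 * q * (q - 1) * r ^+ 3 * b `^ (q - 2) <=
  (4 * r * (r + t) ^+ 2 * (q * (q - 1) * (b + 2 * r * t) `^ (q - 2)) -
    2 * t * (q * (b + 2 * r * t) `^ (q - 1))) +
  (4 * r * (r - t) ^+ 2 * (q * (q - 1) * (b - 2 * r * t) `^ (q - 2)) +
    2 * t * (q * (b - 2 * r * t) `^ (q - 1))).
Proof.
move=> q2 r0 t0 rtb tb.
have b0 : 0 < b by apply: le_lt_trans tb; rewrite !mulr_ge0// ltW.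
pose y := 2 * r * t / b.
have yE : 2 * r * t = b * y by rewrite /y mulrCA mulfV ?mulr1// gt_eqF.
have y01 : 0 <= y < 1.
  rewrite /y ltr_pdivrMr// mul1r tb andbT.
  by rewrite divr_ge0// ?mulr_ge0// ltW.
have /andP[y0 y1] := y01.
have g0 : 0 <= q - 2 by lra.
have := antipodal_bracket g0 y01 b0 r0 t0 yE rtb.
have -> : q - 2 + 1 = q - 1 by ring.
have -> : b + 2 * r * t = b * (1 + y) by rewrite yE; ring.
have -> : b - 2 * r * t = b * (1 - y) by rewrite yE; ring.
rewrite !powRM ?(ltW b0)//; [|lra..].
have bE : b `^ (q - 1) = b * b `^ (q - 2).
  rewrite (_ : q - 1 = (q - 2) + 1); last by ring.
  by rewrite powRD ?(gt_eqF b0) ?implybT// powRr1 1?mulrC// ltW.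
rewrite bE.
set A := (1 + y) `^ _; set B := (1 - y) `^ _.
set C := (1 + y) `^ _; set D := (1 - y) `^ _ => h.
have k0 : 0 <= 2 * q * b `^ (q - 2) by rewrite !mulr_ge0 ?powR_ge0//; lra.
have := ler_wpM2l k0 h; lra.
Qed.

End large_exponent.

Section large_exponent_mean.
Context {R : realType} {d : nat}.
Variable mu : probability 'rV[R]_d R.
Hypothesis mu_unif : sphere_law mu.
Variable i : 'I_d.

Lemma sphere_mean_oppr (k : R -> R) : bounded_mfun k ->
  sphere_mean mu i (fun z => k (- z)) = sphere_mean mu i k.
Proof.
move=> [mk [C kC]].
have NN : orthogonal_mx (- 1%:M : 'M[R]_d).
  by rewrite /orthogonal_mx linearN /= trmx1 mulmxN mulNmx opprK mulmx1.
rewrite /sphere_mean -[RHS](@Rintegral_mulmx _ _ mu mu_unif (fun x => k (x ord0 i)) C _ NN).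
- by apply: eq_Rintegral => x _; rewrite mulmxN mulmx1 !mxE.
- by apply: measurableT_comp => //; exact: measurable_coord.
- by move=> x sx; apply: kC; exact: sphere_coord_le1.
Qed.

(** The convexity is not pointwise in z: if s z > 0, the term - 2 s z q w^(q-1) of r h'' - h'
    dominates for small r. It holds once z and - z are paired, which the symmetry of the sphere
    allows. *)
Lemma sphere_mean_powR_large q e s a : 2 <= q -> 0 < e -> 0 <= s -> 0 < a ->
  exists k : R, forall r, 0 <= r ->
  sphere_mean mu i (fun z => (sqr_dist s a z + e) `^ q) +
    k * (r ^+ 2 - a ^+ 2) +
    ((s ^+ 2 + r ^+ 2 + e) `^ q - (s ^+ 2 + a ^+ 2 + e) `^ q) <=
  sphere_mean mu i (fun z => (sqr_dist s r z + e) `^ q).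
Proof.
move=> q2 e0 s0 a0.
have tP := @powR_tower_derivative _ q e e0.
pose F := powR_tower q e.
pose b (r : R) := r ^+ 2 + (s ^+ 2 + e).
have b_gt0 r : 0 < b r by rewrite ltr_wpDl ?sqr_ge0// ltr_wpDl ?sqr_ge0.
have db p (r : R) : is_derive r (1 : R) (fun r => b r `^ p) (2 * r * (p * b r `^ (p - 1))).
  have d1 : is_derive r (1 : R) b (2 * r).
    have d0 := is_deriveD (is_derive_expr 1 r) (is_derive_cst (s ^+ 2 + e) r (1 : R)).
    by apply: (is_derive_eq d0); rewrite addr0 expr1.
  have h := @is_derive1_comp R (fun x => x `^ p) b r _ _ (is_derive1_powR p (b_gt0 r)) d1.
  by apply: (is_derive_eq h); ring.
have d0 (r : R) : is_derive r (1 : R) (fun r => radial0 mu i s F r - b r `^ q)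
    (radial1 mu i s F r - 2 * r * (q * b r `^ (q - 1))).
  exact: (is_deriveB (is_derive_radial0 mu i s0 tP r) (db q r)).
have d1 (r : R) : is_derive r (1 : R)
    (fun r => radial1 mu i s F r - 2 * r * (q * b r `^ (q - 1)))
    (radial2 mu i s F r - (2 * q * b r `^ (q - 1) +
       2 * r * (q * (2 * r * ((q - 1) * b r `^ (q - 1 - 1)))))).
  have d2 := is_deriveM (is_derive_cst (2 * q) r (1 : R)) (@is_derive_id R R r 1).
  have d3 := is_deriveM d2 (db (q - 1) r).
  have d4 := is_deriveB (is_derive_radial1 mu i s0 tP r) d3.
  rewrite [X in is_derive _ _ X _](_ : _ = radial1 mu i s F -
    (cst (2 * q) * id) * (fun r => b r `^ (q - 1))); last first.
    by apply/funext => y; rewrite !fctE; ring.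
  by apply: (is_derive_eq d4); rewrite /GRing.scale /= !fctE; ring.
have F1E u : F 1%N u = q * (u + e) `^ (q - 1).
  by rewrite /F /powR_tower big_ord_recr big_ord0 /= mul1r subr0.
have F2E u : F 2%N u = q * (q - 1) * (u + e) `^ (q - 2).
  by rewrite /F /powR_tower !big_ord_recr big_ord0 /= mul1r subr0.
have convex r : 0 < r -> radial1 mu i s F r - 2 * r * (q * b r `^ (q - 1)) <=
    r * (radial2 mu i s F r - (2 * q * b r `^ (q - 1) +
       2 * r * (q * (2 * r * ((q - 1) * b r `^ (q - 1 - 1)))))).
  move=> r0.
  have b1 := tower_dist_bounded_mfun s0 tP 1 r.
  have b2 := tower_dist_bounded_mfun s0 tP 2 r.
  have bc := @bounded_mfun_cst R.
  have bl : bounded_mfun (fun z => r + s * z).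
    apply: (bounded_mfunD (bc _)); apply: (bounded_mfunM (bc _)).
    exact: bounded_mfun_id.
  pose k1 z := 2 * (r + s * z) * F 1%N (sqr_dist s r z).
  pose k2 z := 4 * (r + s * z) ^+ 2 * F 2%N (sqr_dist s r z) + 2 * F 1%N (sqr_dist s r z).
  have bk1 : bounded_mfun k1 by apply: bounded_mfunM => //; exact: bounded_mfunM.
  have bk2 : bounded_mfun k2.
    apply: bounded_mfunD; last exact: bounded_mfunM.
    by apply: bounded_mfunM => //; apply: bounded_mfunM => //; exact: (bounded_mfunM bl bl).
  (* The integrand of r S'' - S'. *)
  pose P z := r * k2 z + (-1) * k1 z.
  have bP : bounded_mfun P by apply: bounded_mfunD; exact: bounded_mfunM.
  have bPN : bounded_mfun (fun z => P (- z)).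
    case: bP => mP [C PC]; split; first exact: measurableT_comp.
    by exists C => z z1; apply: PC; rewrite normrN.
  have PE : sphere_mean mu i P = r * radial2 mu i s F r - radial1 mu i s F r.
    rewrite /P sphere_meanD; [|exact: bounded_mfunM|exact: bounded_mfunM].
    by rewrite (sphere_meanZ _ _ _ bk2) (sphere_meanZ _ _ _ bk1) mulN1r.
  suff : 8 * q * (q - 1) * r ^+ 3 * b r `^ (q - 2) <= 2 * sphere_mean mu i P.
    by rewrite PE (_ : q - 1 - 1 = q - 2); [lra|ring].
  rewrite (_ : 2 * _ = sphere_mean mu i (fun z => P z + P (- z))); last first.
    by rewrite (sphere_meanD _ _ bP bPN) sphere_mean_oppr// mulr2n mulrDl mul1r.
  rewrite -[leLHS](sphere_mean_cst mu_unif i).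
  apply: le_sphere_mean => //; first exact: bounded_mfunD.
  (* Here t = s z. That z <= 1 gives r^2 + t^2 <= b, and e > 0 makes 2 r t < b strict. *)
  have key z : 0 <= z <= 1 -> 8 * q * (q - 1) * r ^+ 3 * b r `^ (q - 2) <= P z + P (- z).
    move=> /andP[z0 z1].
    have sz0 : 0 <= s * z by rewrite mulr_ge0.
    have sz : (s * z) ^+ 2 <= s ^+ 2.
      by rewrite exprMn ler_piMr ?sqr_ge0// exprn_ile1.
    have h1 : r ^+ 2 + (s * z) ^+ 2 <= b r by rewrite /b lerD2l; lra.
    have h2 : 2 * r * (s * z) < b r.
      by have := sqr_ge0 (r - s * z); rewrite /b sqrrB; lra.
    have := antipodal_convexity q2 r0 sz0 h1 h2.
    rewrite /P /k1 /k2 !F1E !F2E.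
    have -> : sqr_dist s r z + e = b r + 2 * r * (s * z) by rewrite /sqr_dist /b; ring.
    have -> : sqr_dist s r (- z) + e = b r - 2 * r * (s * z) by rewrite /sqr_dist /b; ring.
    by congr (_ <= _); ring.
  move=> z; rewrite ler_norml => /andP[z1 z2].
  have [z0|z0] := leP 0 z; first by apply: key; rewrite z0.
  have z01 : 0 <= - z <= 1 by apply/andP; split; lra.
  by have := key _ z01; rewrite opprK [in X in _ <= X]addrC.
exists ((radial1 mu i s F a - 2 * a * (q * b a `^ (q - 1))) / (2 * a)) => r r0.
have := sqr_convex_tangent d0 d1 convex a0 r0.
have FE y : radial0 mu i s F y = sphere_mean mu i (fun z => (sqr_dist s y z + e) `^ q).
  by apply: eq_sphere_mean => z _; rewrite /F /powR_tower big_ord0 mul1r subr0.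
rewrite (FE a) (FE r).
have bE y : s ^+ 2 + y ^+ 2 + e = b y by rewrite /b; ring.
rewrite !bE; set M1 := sphere_mean _ _ _; set M2 := sphere_mean _ _ _; lra.
Qed.

End large_exponent_mean.

(** * Normal laws *)

Section normal_integrals.
Context {R : realType}.
Local Open Scope ereal_scope.
Local Notation leb := (@lebesgue_measure R).
Implicit Types (m s : R) (G : R -> R).

(** The Radon-Nikodym derivative agrees almost everywhere with the explicit density, having the same
    integral over every measurable set. *)
Lemma ge0_integral_normal_prob m s (f : R -> \bar R) :
  measurable_fun setT f -> (forall x, 0 <= f x) ->
  \int[normal_prob m s]_x f x = \int[leb]_x (f x * (normal_pdf m s x)%:E).
Proof.
move=> mf f0.
have dom := normal_prob_dominates m s.
rewrite -(Radon_Nikodym_SigmaFinite.change_of_variables dom)//.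
apply: ae_eq_integral => //.
- apply: emeasurable_funM => //; apply: (measurable_int leb).
  exact: Radon_Nikodym_SigmaFinite.f_integrable.
- apply: emeasurable_funM => //; apply/measurable_EFinP.
  exact: measurable_normal_pdf.
- apply: ae_eqe_mul2l; apply: integral_ae_eq => //.
  + exact: Radon_Nikodym_SigmaFinite.f_integrable.
  + by apply/measurable_EFinP; exact: measurable_normal_pdf.
  + by move=> E _ mE; rewrite -Radon_Nikodym_SigmaFinite.f_integral.
Qed.

Lemma ge0_integral_lebesgue_affine m s G : (0 < s)%R -> continuous G ->
  (forall x, 0 <= G x)%R ->
  \int[leb]_x (G x)%:E = \int[leb]_x (G (m + s * x)%R * s)%:E.
Proof.
move=> s0 cG G0.
pose F (x : R) : R := (m + s * x)%R.
have dF (x : R) : is_derive x (1 : R)%R F s.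
  have d0 := is_deriveD (is_derive_cst m x (1 : R)%R)
    (is_deriveM (is_derive_cst s x (1 : R)%R) (@is_derive_id R R x 1%R)).
  by apply: (is_derive_eq d0); rewrite /GRing.scale /=; ring.
have F'E : F^`()%classic = cst s.
  by apply/funext => x; rewrite derive1E; case: (dF x).
rewrite (@increasing_ge0_integration_by_substitutionT R F G)//.
- by apply: eq_integral => x _; rewrite F'E.
- by move=> x y xy; rewrite /F ltrD2l ltr_pM2l.
- by rewrite F'E => x; exact: cvg_cst.
- by rewrite F'E; exact: is_cvg_cst.
- by rewrite F'E; exact: is_cvg_cst.
- have -> : F = (fun x => s * (x + m / s))%R.
    by apply/funext => x; rewrite /F; field; rewrite gt_eqF.
  by apply: (gt0_cvgMrNy s0); exact: cvg_addrr_Ny.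
- have -> : F = (fun x => s * (x + m / s))%R.
    by apply/funext => x; rewrite /F; field; rewrite gt_eqF.
  by apply: (gt0_cvgMry s0); exact: cvg_addrr.
Qed.

Lemma continuous_measurable_EFin G : continuous G ->
  measurable_fun setT (fun x => (G x)%:E).
Proof. by move=> cG; apply/measurable_EFinP; exact: continuous_measurable_fun. Qed.

Lemma ge0_integral_normal_affine m s G : (0 < s)%R -> continuous G ->
  (forall x, 0 <= G x)%R ->
  \int[normal_prob m s]_x (G x)%:E =
  \int[normal_prob 0%R 1%R]_x (G (m + s * x)%R)%:E.
Proof.
move=> s0 cG G0.
have sn0 : (s != 0)%R by rewrite gt_eqF.
have cF : continuous (fun x : R => m + s * x)%R.
  by move=> x; apply: cvgD; [exact: cvg_cst|apply: cvgM; [exact: cvg_cst|exact: cvg_id]].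
have cGF : continuous (fun x : R => G (m + s * x))%R.
  by move=> x; apply: continuous_comp; [exact: cF|exact: cG].
have mG := continuous_measurable_EFin cG.
have mGF := continuous_measurable_EFin cGF.
rewrite (ge0_integral_normal_prob m s mG) ; last by move=> x; rewrite lee_fin.
rewrite (ge0_integral_normal_prob 0%R 1%R mGF) ; last by move=> x; rewrite lee_fin.
transitivity (\int[leb]_x (G x * normal_pdf m s x)%R%:E).
  by apply: eq_integral => x _; rewrite EFinM.
rewrite (@ge0_integral_lebesgue_affine m s (fun x => G x * normal_pdf m s x)%R)//.
- apply: eq_integral => x _; rewrite -EFinM; congr _%:E.
  rewrite -mulrA; congr (_ * _)%R.
  rewrite !normal_pdfE ?oner_eq0// mulrAC; congr (_ * _)%R.
    rewrite /normal_peak -mulrnAr sqrtrM ?sqr_ge0// sqrtr_sqr gtr0_norm//.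
    by rewrite expr1n mul1r invfM mulrC mulrA mulfV// mul1r.
  rewrite /normal_fun; congr expR.
  by rewrite expr1n subr0; field.
- by move=> x; apply: cvgM; [exact: cG|exact: continuous_normal_pdf].
- by move=> x; rewrite mulr_ge0// normal_pdf_ge0.
Qed.

Lemma ge0_integral_lebesgue_opp (f : R -> \bar R) : measurable_fun setT f ->
  (forall x, 0 <= f x) -> \int[leb]_x f (- x)%R = \int[leb]_x f x.
Proof.
move=> mf f0.
have mN : measurable_fun setT (-%R : measurableTypeR R -> measurableTypeR R).
  exact: oppr_measurable.
rewrite -[LHS](@ge0_integral_pushforward _ _ _ _ _ _ mN leb setT f)//.
by apply: eq_measure_integral => A mA _; exact: lebesgue_measureN.
Qed.

Lemma ge0_integral_normal_opp s (f : R -> \bar R) : s != 0%R ->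
  measurable_fun setT f -> (forall x, 0 <= f x) ->
  \int[normal_prob 0%R s]_x f (- x)%R = \int[normal_prob 0%R s]_x f x.
Proof.
move=> s0 mf f0.
have mfN : measurable_fun setT (fun x : R => f (- x)%R).
  by apply: measurableT_comp => //; exact: oppr_measurable.
rewrite (ge0_integral_normal_prob 0%R s mfN) ; last by move=> x.
rewrite (ge0_integral_normal_prob 0%R s mf) ; last by move=> x.
rewrite -(@ge0_integral_lebesgue_opp (fun x => f x * (normal_pdf 0%R s x)%:E)).
- apply: eq_integral => x _; congr (_ * _%:E).
  by rewrite !normal_pdfE// /normal_fun !subr0 sqrrN.
- apply: emeasurable_funM => //; apply/measurable_EFinP.
  exact: measurable_normal_pdf.
- by move=> x; rewrite mule_ge0// lee_fin normal_pdf_ge0.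
Qed.

(** Completing the square in x: the joint density of (x, z) is the density of the sum z times the
    conditional density of x given z. *)
Lemma normal_pdf_conv s t x z : (0 < s)%R -> (0 < t)%R ->
  (normal_pdf 0 t (z - x) * normal_pdf 0 s x =
   normal_pdf 0 (Num.sqrt (s ^+ 2 + t ^+ 2)) z *
   normal_pdf (s ^+ 2 / (s ^+ 2 + t ^+ 2) * z)
     (s * t / Num.sqrt (s ^+ 2 + t ^+ 2)) x)%R.
Proof.
move=> s0 t0.
have st0 : (0 < s ^+ 2 + t ^+ 2)%R by rewrite addr_gt0// exprn_gt0.
set r := Num.sqrt _.
have r0 : (0 < r)%R by rewrite sqrtr_gt0.
have rE : (r ^+ 2 = s ^+ 2 + t ^+ 2)%R by rewrite sqr_sqrtr// ltW.
have peakE (a : R) : (0 < a)%R -> normal_peak a = ((a * Num.sqrt (pi *+ 2))^-1)%R.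
  by move=> a0; rewrite /normal_peak -mulrnAr sqrtrM ?sqr_ge0// sqrtr_sqr gtr0_norm.
have str0 : (0 < s * t / r)%R by rewrite divr_gt0// mulr_gt0.
rewrite !normal_pdfE ?gt_eqF//.
rewrite !peakE//.
have k0 : (0 < Num.sqrt (pi *+ 2 : R))%R by rewrite sqrtr_gt0 pmulrn_lgt0// pi_gt0.
set k := Num.sqrt _ in k0 *.
rewrite mulrACA [RHS]mulrACA /normal_fun -!expRD; congr (_ * expR _)%R.
  by field; rewrite !gt_eqF.
rewrite -rE -![(_ ^+ 2 *+ 2)%R]mulr_natr !exprMn !exprVn.
have -> : (t ^+ 2 = r ^+ 2 - s ^+ 2)%R by rewrite rE; ring.
have rs0 : (r ^+ 2 - s ^+ 2 != 0)%R by rewrite rE addrC addKr gt_eqF// exprn_gt0.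
by field; rewrite rs0 !gt_eqF.
Qed.

(** Substitute z = x + y, exchange the two Lebesgue integrals and factor the density; the
    conditional density of x integrates to 1. *)
Lemma ge0_integral_normal_conv s t G : (0 < s)%R -> (0 < t)%R -> continuous G ->
  (forall x, 0 <= G x)%R ->
  \int[normal_prob 0%R s]_x \int[normal_prob 0%R t]_y (G (x + y)%R)%:E =
  \int[normal_prob 0%R (Num.sqrt (s ^+ 2 + t ^+ 2))]_x (G x)%:E.
Proof.
move=> s0 t0 cG G0.
have sn0 : (s != 0)%R by rewrite gt_eqF.
have tn0 : (t != 0)%R by rewrite gt_eqF.
have mG : measurable_fun setT G by exact: continuous_measurable_fun.
have cGx x : continuous (fun y => G (x + y)%R).
  move=> y; apply: continuous_comp; last exact: cG.
  by apply: cvgD; [exact: cvg_cst|exact: cvg_id].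
have inner x : \int[normal_prob 0%R t]_y (G (x + y)%R)%:E =
    \int[leb]_z (G z * normal_pdf 0 t (z - x))%R%:E.
  rewrite (ge0_integral_normal_prob 0%R t (continuous_measurable_EFin (cGx x))); last first.
    by move=> y; rewrite lee_fin.
  rewrite (@ge0_integral_lebesgue_affine x 1%R (fun z => G z * normal_pdf 0 t (z - x))%R)//.
  - by apply: eq_integral => y _; rewrite !mul1r mulr1 [(x + y)%R]addrC addrK EFinM.
  - have cB : continuous (fun z : R => z - x)%R.
      by move=> y; apply: cvgB; [exact: cvg_id|exact: cvg_cst].
    move=> y; apply: cvgM; first exact: cG.
    exact: (continuous_comp (cB y) (@continuous_normal_pdf R 0%R t tn0 (y - x)%R)).
  - by move=> y; rewrite mulr_ge0// normal_pdf_ge0.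
pose H (u : R * R) := (G u.2 * normal_pdf 0 t (u.2 - u.1) * normal_pdf 0 s u.1)%R%:E.
have H0 u : 0 <= H u by rewrite lee_fin !mulr_ge0// normal_pdf_ge0.
have mpdf (v : R) := @measurable_normal_pdf R 0%R v.
have mH : measurable_fun setT H.
  apply/measurable_EFinP; apply: measurable_funM; last first.
    by apply: (measurableT_comp (mpdf s)); exact: measurable_fst.
  apply: measurable_funM; first by apply: (measurableT_comp mG); exact: measurable_snd.
  apply: (measurableT_comp (mpdf t)); apply: measurable_funB.
    exact: measurable_snd.
  exact: measurable_fst.
pose H1 (u : R * R) := (G u.2 * normal_pdf 0 t (u.2 - u.1))%R%:E.
have mH1 : measurable_fun setT H1.
  apply/measurable_EFinP.
  apply: measurable_funM; first by apply: (measurableT_comp mG); exact: measurable_snd.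
  apply: (measurableT_comp (mpdf t)); apply: measurable_funB.
    exact: measurable_snd.
  exact: measurable_fst.
have H10 u : 0 <= H1 u by rewrite lee_fin !mulr_ge0// normal_pdf_ge0.
have mI := @measurable_fun_fubini_tonelli_F _ _ _ _ R leb H1 mH1 H10.
transitivity (\int[normal_prob 0%R s]_x \int[leb]_z H1 (x, z)).
  by apply: eq_integral => x _; rewrite inner.
rewrite (ge0_integral_normal_prob 0%R s mI); last by move=> x; exact: integral_ge0.
transitivity (\int[leb]_x \int[leb]_z H (x, z)).
  apply: eq_integral => x _; rewrite /fubini_F -ge0_integralZr//.
  - exact: measurableT_comp.
  - by rewrite lee_fin normal_pdf_ge0.
transitivity (\int[leb]_z \int[leb]_x H (x, z)).
  exact: (@fubini_tonelli _ _ _ _ R leb leb H mH H0).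
set r := Num.sqrt _.
rewrite (ge0_integral_normal_prob 0%R r (continuous_measurable_EFin cG)); last first.
  by move=> y; rewrite lee_fin.
apply: eq_integral => z _.
transitivity (\int[leb]_x ((G z * normal_pdf 0 r z)%R%:E *
    (normal_pdf (s ^+ 2 / (s ^+ 2 + t ^+ 2) * z) (s * t / r) x)%R%:E)).
  apply: eq_integral => x _; rewrite -EFinM /H /=; congr _%:E.
  by rewrite -mulrA (normal_pdf_conv x z s0 t0) -/r mulrA.
rewrite ge0_integralZl//.
- by rewrite integral_normal_pdf mule1 EFinM.
- by apply/measurable_EFinP; exact: measurable_normal_pdf.
- by move=> x _; rewrite lee_fin normal_pdf_ge0.
- by rewrite lee_fin mulr_ge0// normal_pdf_ge0.
Qed.

End normal_integrals.

(** * Moments of the standard normal law *)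

Section normal_moments.
Context {R : realType}.
Local Open Scope ereal_scope.
Local Notation N := (normal_prob 0%R (1 : R)%R).

Lemma expR_ge_cube (y : R) : (0 <= y)%R -> (y ^+ 3 <= 27 * expR y)%R.
Proof.
move=> y0.
have -> : y = (y / 3 + y / 3 + y / 3)%R by field.
have h : (y / 3 <= expR (y / 3))%R.
  by rewrite (le_trans _ (expR_ge1Dx (y / 3)))// lerDr.
have y3 : (0 <= y / 3)%R by rewrite divr_ge0.
rewrite !expRD.
have : ((y / 3) ^+ 3 <= expR (y / 3) ^+ 3)%R by rewrite lerXn2r// nnegrE ?expR_ge0.
rewrite !exprS expr0 mulr1; set e := expR _; lra.
Qed.

(** With y = x^2 / 4, x^6 = 64 y^3 <= 1728 e^y, so x^6 times the density is at most a multiple of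
    the normal density of variance 2. *)
Lemma normal_moment6_lty : \int[N]_x (x ^+ 6)%:E < +oo.
Proof.
have s2 : (Num.sqrt 2 != 0 :> R)%R by rewrite gt_eqF// sqrtr_gt0.
pose C : R := (27 * 64 * (normal_peak 1 / normal_peak (Num.sqrt 2)))%R.
have pk : (0 < normal_peak (Num.sqrt 2) :> R)%R by exact: normal_peak_gt0.
have C0 : (0 <= C)%R by rewrite !mulr_ge0 ?normal_peak_ge0// invr_ge0 ltW.
rewrite ge0_integral_normal_prob; last 2 first.
- by apply/measurable_EFinP; exact: measurable_funX.
- by move=> x; rewrite lee_fin exprn_even_ge0.
apply: (@le_lt_trans _ _ (\int[lebesgue_measure]_x (C%:E * (normal_pdf 0 (Num.sqrt 2) x)%:E))).
  apply: ge0_le_integral => //.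
  - by move=> x _; rewrite mule_ge0 ?lee_fin ?exprn_even_ge0 ?normal_pdf_ge0.
  - apply: emeasurable_funM; apply/measurable_EFinP; first exact: measurable_funX.
    exact: measurable_normal_pdf.
  - apply: emeasurable_funM => //; apply/measurable_EFinP.
    exact: measurable_normal_pdf.
  - move=> x _; rewrite -!EFinM lee_fin !normal_pdfE ?oner_eq0// /C.
    rewrite /normal_fun !subr0 sqr_sqrtr// expr1n.
    have y0 : (0 <= x ^+ 2 / 4)%R by rewrite divr_ge0 ?sqr_ge0.
    have := expR_ge_cube y0.
    have -> : ((x ^+ 2 / 4) ^+ 3 = x ^+ 6 / 64)%R by field.
    have -> : (- x ^+ 2 / (1 *+ 2) = - (x ^+ 2 / 4) + - (x ^+ 2 / 4))%R by field.
    have -> : (- x ^+ 2 / (2 *+ 2) = - (x ^+ 2 / 4))%R by field.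
    rewrite expRD expRN; set e := expR _ => h.
    have e0 : (0 < e)%R by exact: expR_gt0.
    rewrite (_ : 27 * 64 * _ * _ = 27 * e * 64 * (normal_peak 1 * (e^-1 * e^-1)))%R; last first.
      by field; rewrite !gt_eqF.
    apply: ler_wpM2r; last lra.
    by rewrite mulr_ge0 ?normal_peak_ge0// mulr_ge0// invr_ge0 ltW.
rewrite ge0_integralZl//.
- by rewrite integral_normal_pdf mule1 ltry.
- by apply/measurable_EFinP; exact: measurable_normal_pdf.
- by move=> x _; rewrite lee_fin normal_pdf_ge0.
Qed.

Definition normal_moment (k : nat) : R := fine (\int[N]_x (x ^+ k.*2)%:E).

Let even_ge0 k (x : R) : (0 <= x ^+ k.*2)%R.
Proof. by rewrite exprn_even_ge0// odd_double. Qed.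

Let mX k : measurable_fun setT (fun x : R => (x ^+ k)%:E).
Proof. by apply/measurable_EFinP; exact: measurable_funX. Qed.

Lemma normal_momentE k : (k <= 3)%N -> \int[N]_x (x ^+ k.*2)%:E = (normal_moment k)%:E.
Proof.
move=> k3; rewrite fineK// ge0_fin_numE; last first.
  by apply: integral_ge0 => x _; rewrite lee_fin even_ge0.
apply: (@le_lt_trans _ _ (\int[N]_x ((1 : R)%:E + (x ^+ 6)%:E))).
  apply: ge0_le_integral => //.
  - by move=> x _; rewrite lee_fin even_ge0.
  - exact: mX.
  - by apply: emeasurable_funD => //; exact: mX.
  - move=> x _; rewrite -EFinD lee_fin -[k.*2]muln2 mulnC exprM.
    rewrite (_ : x ^+ 6 = (x ^+ 2) ^+ 3)%R; last by rewrite -exprM.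
    have y0 := sqr_ge0 x; set y := (x ^+ 2)%R in y0 *.
    have [y1|y1] := leP y 1%R.
      by rewrite (le_trans (exprn_ile1 _ y0 y1))// lerDl exprn_ge0.
    rewrite (@le_trans _ _ (y ^+ 3)%R)//; last by rewrite lerDr.
    by rewrite ler_eXn2l// ltW.
rewrite ge0_integralD//.
- rewrite integral_cst// mul1e.
  apply: lte_add_pinfty; last exact: normal_moment6_lty.
  by rewrite -ge0_fin_numE//; exact: fin_num_measure.
- by move=> x _; rewrite lee_fin exprn_even_ge0.
- exact: mX.
Qed.

Lemma normal_moment_ge0 k : (0 <= normal_moment k)%R.
Proof. by apply: fine_ge0; apply: integral_ge0 => x _; rewrite lee_fin even_ge0. Qed.

Lemma normal_integral_even_poly (c0 c1 c2 c3 : R) :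
  (0 <= c0)%R -> (0 <= c1)%R -> (0 <= c2)%R -> (0 <= c3)%R ->
  \int[N]_x (c0 + c1 * x ^+ 2 + c2 * x ^+ 4 + c3 * x ^+ 6)%:E =
  (c0 + c1 * normal_moment 1 + c2 * normal_moment 2 + c3 * normal_moment 3)%:E.
Proof.
move=> h0 h1 h2 h3.
have E k c : (k <= 3)%N -> (0 <= c)%R ->
    \int[N]_x (c * x ^+ k.*2)%:E = (c * normal_moment k)%:E.
  move=> k3 cc; under eq_integral do rewrite EFinM.
  rewrite ge0_integralZl_EFin//; first by rewrite normal_momentE// EFinM.
  - by move=> x _; rewrite lee_fin even_ge0.
  - exact: mX.
have mc k c : measurable_fun setT (fun x : R => (c * x ^+ k)%:E).
  by apply/measurable_EFinP; apply: measurable_funM => //; exact: measurable_funX.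
have g k (c x : R) : (0 <= c)%R -> 0 <= (c * x ^+ k.*2)%:E.
  by move=> cc; rewrite lee_fin mulr_ge0// even_ge0.
have e0 : \int[N]_x c0%:E = c0%:E.
  rewrite integral_cst// [X in _ * X](_ : _ = 1) ?mule1//.
  exact: probability_setT.
under eq_integral do rewrite !EFinD.
rewrite ge0_integralD//; last 4 first.
- by move=> x _; rewrite !adde_ge0 ?(g 1%N) ?(g 2%N).
- apply: emeasurable_funD; last exact: (mc 4%N c2).
  by apply: emeasurable_funD; last exact: (mc 2%N c1).
- by move=> x _; exact: (g 3%N).
- exact: mc.
rewrite ge0_integralD//; last 4 first.
- by move=> x _; rewrite !adde_ge0 ?(g 1%N).
- by apply: emeasurable_funD; last exact: (mc 2%N c1).
- by move=> x _; exact: (g 2%N).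
- exact: mc.
rewrite ge0_integralD//; last 2 first.
- by move=> x _; exact: (g 1%N).
- exact: mc.
by rewrite e0 (E 1%N)// (E 2%N)// (E 3%N).
Qed.

(** Passing to the even part removes odd powers before integration, leaving sums of nonnegative
    terms that split without any integrability. *)
Lemma normal_integral_symmetrize (f : R -> R) : measurable_fun setT f ->
  (forall x, 0 <= f x)%R ->
  \int[N]_x (f x)%:E = \int[N]_x ((f x + f (- x)) / 2)%:E.
Proof.
move=> mf f0.
have mfN : measurable_fun setT (fun x : R => f (- x)%R).
  by apply: measurableT_comp => //; exact: oppr_measurable.
have := @ge0_integral_normal_opp R 1%R (EFin \o f) (oner_neq0 _)
  (proj2 (measurable_EFinP _ _) mf) (fun x => f0 x).
move=> /= h.
under [RHS]eq_integral do rewrite mulrDl EFinD.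
have h2 (g : R -> R) : measurable_fun setT g -> (forall x, 0 <= g x)%R ->
    \int[N]_x (g x / 2)%:E = 2^-1%:E * \int[N]_x (g x)%:E.
  move=> mg g0; under eq_integral do rewrite mulrC EFinM.
  rewrite ge0_integralZl_EFin//; first by move=> x _; rewrite lee_fin.
  exact/measurable_EFinP.
rewrite ge0_integralD//; last 4 first.
- by move=> x _; rewrite lee_fin divr_ge0.
- by apply/measurable_EFinP; exact: measurable_funM.
- by move=> x _; rewrite lee_fin divr_ge0.
- by apply/measurable_EFinP; exact: measurable_funM.
rewrite (h2 f)// (h2 (fun x => f (- x)%R))// h -ge0_muleDl ?lee_fin ?invr_ge0//.
by rewrite -EFinD (_ : 2^-1 + 2^-1 = 1)%R ?mul1e//; field.
Qed.

Lemma normal_moment_double k : (k <= 3)%N ->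
  \int[N]_x \int[N]_y ((x + y) ^+ k.*2)%:E = (2 ^+ k * normal_moment k)%:E.
Proof.
move=> k3.
have cX1 : continuous (fun x : R => x ^+ k.*2)%R by exact: exprn_continuous.
rewrite (@ge0_integral_normal_conv R 1%R 1%R (fun x => x ^+ k.*2)%R)//.
have s2 : (0 < Num.sqrt (1 ^+ 2 + 1 ^+ 2) :> R)%R by rewrite sqrtr_gt0 addr_gt0// exprn_gt0.
rewrite (@ge0_integral_normal_affine R 0%R _ (fun x => x ^+ k.*2)%R)//.
under eq_integral do rewrite add0r exprMn EFinM.
rewrite ge0_integralZl//.
- rewrite normal_momentE// -EFinM -[in X in (X * _)%R]muln2 mulnC exprM.
  by rewrite sqr_sqrtr ?addr_ge0 ?sqr_ge0// !expr1n.
- exact: mX.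
- by move=> x _; rewrite lee_fin even_ge0.
Qed.

(* The sum of two independent copies is a copy scaled by sqrt 2, which yields
   linear equations for the moments; the value of the second moment itself is
   never needed. *)
Lemma normal_moment2E : normal_moment 2 = (3 * normal_moment 1 ^+ 2)%R.
Proof.
have e2 (x : R) : (0 <= x ^+ 2)%R := even_ge0 1 x.
have e4 (x : R) : (0 <= x ^+ 4)%R := even_ge0 2 x.
have m1 := normal_moment_ge0 1; have m2 := normal_moment_ge0 2.
have inner (x : R) : \int[N]_y ((x + y) ^+ 4)%:E =
    (normal_moment 2 + (6 * normal_moment 1) * x ^+ 2 + 1 * x ^+ 4 + 0 * x ^+ 6)%:E.
  rewrite (@normal_integral_symmetrize (fun y => (x + y) ^+ 4)%R); last 2 first.
  - by apply: measurable_funX; exact: measurable_funD.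
  - by move=> y.
  transitivity (\int[N]_y (x ^+ 4 + (6 * x ^+ 2) * y ^+ 2 + 1 * y ^+ 4 + 0 * y ^+ 6)%:E).
    by apply: eq_integral => y _; congr _%:E; field.
  rewrite normal_integral_even_poly//; last by rewrite mulr_ge0.
  by congr _%:E; ring.
have := @normal_moment_double 2 isT.
under eq_integral => x _ do rewrite inner.
rewrite normal_integral_even_poly//; last by rewrite mulr_ge0.
move=> -[]; lra.
Qed.

Lemma normal_moment3E : normal_moment 3 = (15 * normal_moment 1 ^+ 3)%R.
Proof.
have e2 (x : R) : (0 <= x ^+ 2)%R := even_ge0 1 x.
have e4 (x : R) : (0 <= x ^+ 4)%R := even_ge0 2 x.
have e6 (x : R) : (0 <= x ^+ 6)%R := even_ge0 3 x.
have m1 := normal_moment_ge0 1; have m2 := normal_moment_ge0 2.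
have m3 := normal_moment_ge0 3.
have inner (x : R) : \int[N]_y ((x + y) ^+ 6)%:E =
    (normal_moment 3 + (15 * normal_moment 2) * x ^+ 2 + (15 * normal_moment 1) * x ^+ 4 +
     1 * x ^+ 6)%:E.
  rewrite (@normal_integral_symmetrize (fun y => (x + y) ^+ 6)%R); last 2 first.
  - by apply: measurable_funX; exact: measurable_funD.
  - by move=> y.
  transitivity (\int[N]_y (x ^+ 6 + (15 * x ^+ 4) * y ^+ 2 + (15 * x ^+ 2) * y ^+ 4 + 1 * y ^+ 6)%:E).
    by apply: eq_integral => y _; congr _%:E; field.
  rewrite normal_integral_even_poly//; try by rewrite mulr_ge0.
  by congr _%:E; ring.
have := @normal_moment_double 3 isT.
under eq_integral => x _ do rewrite inner.
rewrite normal_integral_even_poly//; try by rewrite mulr_ge0.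
rewrite normal_moment2E => -[]; lra.
Qed.

End normal_moments.

(** * Marginals of the Gaussian vector *)

Section gaussian_marginals.
Context {R : realType}.
Local Open Scope ereal_scope.
Local Notation N := (normal_prob 0%R (1 : R)%R).
Local Notation m1 := (@normal_moment R 1).

Lemma normal_prob_sqr_shift (m s c : R) : (0 < s)%R ->
  \int[normal_prob m s]_x ((x + c) ^+ 2)%:E = ((m + c) ^+ 2 + s ^+ 2 * m1)%:E.
Proof.
move=> s0.
have cG : continuous (fun x : R => (x + c) ^+ 2)%R.
  move=> x; apply: (@continuous_comp _ _ _ (fun x => x + c)%R (fun x => x ^+ 2)%R).
    by apply: cvgD; [exact: cvg_id|exact: cvg_cst].
  exact: exprn_continuous.
rewrite (ge0_integral_normal_affine m s0 cG); last by move=> x; exact: sqr_ge0.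
rewrite (@normal_integral_symmetrize _ (fun x => (m + s * x + c) ^+ 2)%R); last 2 first.
- apply: measurable_funX; apply: measurable_funD => //.
  by apply: measurable_funD => //; exact: measurable_funM.
- by move=> x; exact: sqr_ge0.
transitivity (\int[N]_x ((m + c) ^+ 2 + s ^+ 2 * x ^+ 2 + 0 * x ^+ 4 + 0 * x ^+ 6)%:E).
  by apply: eq_integral => x _; congr _%:E; field.
rewrite normal_integral_even_poly ?sqr_ge0//.
by congr _%:E; ring.
Qed.

Context {disp : measure_display} {T : measurableType disp} {d : nat}.
Variables (P : probability T R) (Z : {RV P >-> 'rV[R]_d}).

Lemma measurable_dotr_RV (u : 'rV[R]_d) : measurable_fun setT (fun t => dotr u (Z t)).
Proof.
apply: measurable_fun_dotr; first exact: measurable_cst.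
exact: measurable_funPT.
Qed.

Let mZ i : measurable_fun setT (fun t => Z t ord0 i).
Proof. by apply: measurable_coord_comp; exact: measurable_funPT. Qed.

Variable v : R.
Hypothesis Z_mean : has_mean Z 0.
Hypothesis Z_cov : has_covariance Z v%:M.

Let cov i j : \int[P]_t (Z t ord0 i * Z t ord0 j)%:E = (v%:M i j)%:E.
Proof.
have := Z_cov i j; rewrite covariance.unlock !Z_mean !mxE /= expectation.unlock => <-.
apply: eq_integral => t _; congr _%:E.
by rewrite -[RHS]/((Z t ord0 i - 0) * (Z t ord0 j - 0))%R !subr0.
Qed.

(** A real covariance forces a finite second moment; the integrability of products and coordinates
    below is drawn from it. *)
Let int_sqr i : P.-integrable setT (fun t => (Z t ord0 i ^+ 2)%:E).
Proof.
apply/integrableP; split; first by apply/measurable_EFinP; exact: measurable_funX.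
rewrite (_ : \int[P]_t _ = (v%:M i i)%:E) ?ltry// -cov.
by apply: eq_integral => t _; rewrite gee0_abs ?lee_fin ?sqr_ge0// expr2.
Qed.

Let int_mul i j : P.-integrable setT (fun t => (Z t ord0 i * Z t ord0 j)%:E).
Proof.
apply: (@le_integrable _ _ _ P setT _ _ (fun t => (Z t ord0 i ^+ 2)%:E + (Z t ord0 j ^+ 2)%:E)) => //.
- by apply/measurable_EFinP; exact: measurable_funM.
- move=> t _; rewrite -EFinD !abse_EFin lee_fin.
  rewrite [leRHS]ger0_norm ?addr_ge0 ?sqr_ge0//.
  by rewrite ler_norml; apply/andP; split; nra.
- exact: integrableD.
Qed.

Let int_coord i : P.-integrable setT (fun t => (Z t ord0 i)%:E).
Proof.
apply: (@le_integrable _ _ _ P setT _ _ (fun t => (1 : R)%:E + (Z t ord0 i ^+ 2)%:E)) => //.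
- exact/measurable_EFinP.
- move=> t _; rewrite -EFinD !abse_EFin lee_fin.
  rewrite [leRHS]ger0_norm ?addr_ge0 ?sqr_ge0//.
  by rewrite ler_norml; apply/andP; split; nra.
- apply: integrableD => //; exact: finite_measure_integrable_cst.
Qed.

(** The shift c packs mean and variance into one nonnegative integrand: c = 0, 1, -1 determine both
    parameters of a marginal. *)
Lemma dotr_second_moment (u : 'rV[R]_d) (c : R) :
  \int[P]_t ((dotr u (Z t) + c) ^+ 2)%:E = (v * dotr u u + c ^+ 2)%:E.
Proof.
pose A t : \bar R := \sum_(i < d) \sum_(j < d) (u ord0 i * u ord0 j)%:E * (Z t ord0 i * Z t ord0 j)%:E.
pose B t : \bar R := \sum_(i < d) (2 * c * u ord0 i)%:E * (Z t ord0 i)%:E.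
have iA1 i j : P.-integrable setT (fun t => (u ord0 i * u ord0 j)%:E * (Z t ord0 i * Z t ord0 j)%:E).
  exact: integrableZl.
have iA2 i : P.-integrable setT (fun t => \sum_(j < d) (u ord0 i * u ord0 j)%:E * (Z t ord0 i * Z t ord0 j)%:E).
  by apply: integrable_sum => //.
have iA : P.-integrable setT A by apply: integrable_sum.
have iB1 i : P.-integrable setT (fun t => (2 * c * u ord0 i)%:E * (Z t ord0 i)%:E).
  exact: integrableZl.
have iB : P.-integrable setT B by apply: integrable_sum.
have iC : P.-integrable setT (cst (c ^+ 2)%:E) by exact: finite_measure_integrable_cst.
transitivity (\int[P]_t ((A t + B t) + (c ^+ 2)%:E)).
  apply: eq_integral => t _; rewrite /A /B sqrrD.
  under [in RHS]eq_bigr do under eq_bigr do rewrite -EFinM.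
  under [in RHS]eq_bigr do rewrite sumEFin.
  under [X in _ = _ + X + _]eq_bigr do rewrite -EFinM.
  rewrite !sumEFin -!EFinD; congr (_ + _ + _)%:E.
    rewrite /dotr expr2 mulr_suml; apply: eq_bigr => i _.
    by rewrite mulr_sumr; apply: eq_bigr => j _; ring.
  rewrite /dotr mulr_suml -mulr_natl mulr_sumr.
  by apply: eq_bigr => i _; ring.
rewrite integralD//; last exact: integrableD.
rewrite integralD//.
rewrite /A integral_sum//.
under eq_bigr => i _.
  rewrite integral_sum//.
  under eq_bigr => j _.
    rewrite integralZl// cov -EFinM mxE.
    over.
  rewrite sumEFin.
  over.
rewrite sumEFin /B integral_sum//.
rewrite (@eq_bigr _ _ _ _ _ _ _ (fun=> 0)); last first.
  move=> i _; rewrite integralZl//.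
  by have := Z_mean i; rewrite unlock mxE => ->; rewrite mule0.
rewrite [X in _ + X + _]big1// adde0 integral_cst//.
rewrite [X in _ * X](_ : _ = 1); last exact: probability_setT.
rewrite mule1 -EFinD; congr (_ + _)%:E.
rewrite /dotr mulr_sumr; apply: eq_bigr => i _.
rewrite (bigD1 i)//= eqxx mulr1n big1 ?addr0; first by ring.
by move=> j ij; rewrite eq_sym (negbTE ij) mulr0n mulr0.
Qed.

Lemma gaussian_vector_unit_marginal (u : 'rV[R]_d) : gaussian_vector Z -> (0 < v)%R ->
  enorm u = 1%R ->
  exists2 s : R, (0 < s)%R /\ (s ^+ 2 * m1 = v)%R & forall B : set R, measurable B ->
    distribution P Z ((dotr u) @^-1` B) = normal_prob 0%R s B.
Proof.
move=> gZ v0 u1.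
have [m [s [s0 law]]] := gZ u.
have uu : (dotr u u = 1)%R by rewrite -sqr_enorm u1 expr1n.
have mu : measurable_fun setT (fun t => dotr u (Z t) : measurableTypeR R).
  exact: measurable_dotr_RV.
have E (c : R) : (v + c ^+ 2)%:E = if s == 0%R then ((m + c) ^+ 2)%:E
    else ((m + c) ^+ 2 + s ^+ 2 * m1)%:E.
  have := dotr_second_moment u c; rewrite uu mulr1 => <-.
  have mf : measurable_fun setT (fun x : R => ((x + c) ^+ 2)%:E).
    by apply/measurable_EFinP; apply: measurable_funX; exact: measurable_funD.
  have -> : \int[P]_t ((dotr u (Z t) + c) ^+ 2)%:E =
      \int[pushforward P (fun t => dotr u (Z t) : measurableTypeR R)]_x ((x + c) ^+ 2)%:E.
    by rewrite (@ge0_integral_pushforward _ _ _ _ _ _ mu)// => x _; rewrite lee_fin sqr_ge0.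
  move: law; rewrite /normal_law; case: (eqVneq s 0%R) => [_|sn0] law.
    transitivity (\int[\d_(m : measurableTypeR R)]_x ((x + c) ^+ 2)%:E).
      by apply: eq_measure_integral => A mA _; exact: law.
    by rewrite integral_dirac// diracT mul1e.
  transitivity (\int[normal_prob m s]_x ((x + c) ^+ 2)%:E).
    by apply: eq_measure_integral => A mA _; exact: law.
  by rewrite normal_prob_sqr_shift// lt_neqAle eq_sym sn0.
move: E law; rewrite /normal_law; case: (eqVneq s 0%R) => [_|sn0] E law.
  (* A Dirac marginal at m would give (m + c)^2 = v + c^2 for these c, hence m = 0 and v = 0. *)
  by have [] := E 0%R; have [] := E 1%R; have [] := E (-1)%R; nra.
have s0' : (0 < s)%R by rewrite lt_neqAle eq_sym sn0.
have m0 : m = 0%R.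
  by have [] := E 1%R; have [] := E (-1)%R; nra.
exists s; first by split => //; have [] := E 0%R; rewrite m0; lra.
by move=> B mB; rewrite -m0 -law.
Qed.

(** One s serves all directions, since s > 0 is determined by s^2 [m1] = v; that [m1] is nonzero
    follows from v > 0. *)
Lemma gaussian_vector_marginals : gaussian_vector Z -> (0 < d)%N -> (0 < v)%R ->
  exists2 s : R, (0 < s)%R /\ (s ^+ 2 * m1 = v)%R &
    forall u : 'rV[R]_d, enorm u = 1%R -> forall B : set R, measurable B ->
    distribution P Z ((dotr u) @^-1` B) = normal_prob 0%R s B.
Proof.
move=> gZ d0 v0.
have [s [s0 sm] _] := gaussian_vector_unit_marginal gZ v0 (enorm_delta (Ordinal d0)).
exists s => // u u1 B mB.
have [s' [s'0 s'm] law] := gaussian_vector_unit_marginal gZ v0 u1.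
rewrite (law B mB).
have m10 : (0 < m1)%R.
  by rewrite lt_neqAle normal_moment_ge0 andbT; apply: contraTneq v0 => m0; rewrite -sm -m0 mulr0 ltxx.
congr (normal_prob 0%R _ B).
have : (s' ^+ 2 = s ^+ 2)%R by apply: (mulIf (lt0r_neq0 m10)); rewrite sm s'm.
by move/eqP; rewrite eqrXn2// ?ltW// => /eqP.
Qed.

End gaussian_marginals.

(** * From one-dimensional projections to moments of the norm *)

Section projection.
Context {R : realType} {d : nat}.
Variable mu : probability 'rV[R]_d R.
Hypothesis mu_unif : sphere_law mu.
Variable i : 'I_d.
Local Open Scope ereal_scope.

Definition coord_powR_mean (p : R) : \bar R := \int[mu]_x (`|x ord0 i| `^ p)%:E.

Let mcoord p : measurable_fun setT (fun x : 'rV[R]_d => `|x ord0 i| `^ p)%R.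
Proof.
apply: measurable_powR_comp; apply: measurableT_comp => //; exact: measurable_coord.
Qed.

Lemma coord_powR_mean_fin p : (0 <= p)%R -> coord_powR_mean p \is a fin_num.
Proof.
move=> p0; rewrite ge0_fin_numE; last first.
  by apply: integral_ge0 => x _; rewrite lee_fin powR_ge0.
rewrite /coord_powR_mean ge0_integral_sphere//; last first.
  exact/measurable_EFinP.
apply: (@le_lt_trans _ _ (\int[mu]_(x in sphere) (1 : R)%:E)).
  apply: ge0_le_integral => //.
  - exact: measurable_sphere.
  - by apply/measurable_EFinP; exact: measurable_funTS.
  - move=> x xs; rewrite lee_fin.
    have := @ge0_ler_powR R p p0 `|x ord0 i|%R 1%R; rewrite powR1 !nnegrE; apply => //.
    exact: sphere_coord_le1.
rewrite integral_cst//; last exact: measurable_sphere.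
by rewrite mul1e (le_lt_trans (probability_le1 mu measurable_sphere))// ltry.
Qed.

(** Otherwise the coordinate would vanish almost everywhere, against its second moment 1 / d. Being
    also finite, this constant can be divided out. *)
Lemma coord_powR_mean_neq0 p : (0 < p)%R -> coord_powR_mean p != 0.
Proof.
move=> p0; apply/eqP => k0.
have m2 : measurable_fun setT (fun x : 'rV[R]_d => (x ord0 i ^+ 2)%:E).
  by apply/measurable_EFinP; apply: measurable_funX; exact: measurable_coord.
have h : \int[mu]_x (x ord0 i ^+ 2)%:E = 0.
  have : \int[mu]_x `|(x ord0 i ^+ 2)%:E| = 0.
    apply/(ae_eq_integral_abs mu measurableT m2).
    have /(ae_eq_integral_abs mu measurableT) : \int[mu]_x `|(`|x ord0 i| `^ p)%:E| = 0.
      rewrite -[RHS]k0; apply: eq_integral => x _.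
      by rewrite gee0_abs// lee_fin powR_ge0.
    move=> /(_ (proj2 (measurable_EFinP _ _) (mcoord p))).
    apply: filterS => x /= /(_ Logic.I) [] /eqP.
    by rewrite powR_eq0 normr_eq0 => /andP[/eqP -> _] _; rewrite expr0n.
  move=> h; rewrite -[RHS]h; apply: eq_integral => x _.
  by rewrite gee0_abs// lee_fin sqr_ge0.
have := sphere_moment2 mu_unif i.
rewrite /Rintegral -(ge0_integral_sphere mu_unif)//; last first.
  by move=> x; rewrite lee_fin sqr_ge0.
rewrite h /= => /esym/eqP; rewrite invr_eq0 pnatr_eq0.
by case: d i => [[]|].
Qed.

Lemma coord_powR_mean_even k :
  coord_powR_mean k.*2%:R = (\int[mu]_(x in sphere) (x ord0 i ^+ k.*2))%R%:E.
Proof.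
rewrite /Rintegral -(ge0_integral_sphere mu_unif)//; last 2 first.
- by apply/measurable_EFinP; apply: measurable_funX; exact: measurable_coord.
- by move=> x; rewrite lee_fin exprn_even_ge0// odd_double.
have e : coord_powR_mean k.*2%:R = \int[mu]_x (x ord0 i ^+ k.*2)%:E.
  apply: eq_integral => x _; rewrite powR_mulrn//.
  by rewrite -[in RHS]muln2 -[in LHS]muln2 mulnC !exprM real_normK ?num_real.
by rewrite -e fineK// coord_powR_mean_fin.
Qed.

Lemma coord_powR_mean_dotr p (x : 'rV[R]_d) : (0 < p)%R ->
  \int[mu]_u (`|dotr x u| `^ p)%:E = (enorm x `^ p)%:E * coord_powR_mean p.
Proof.
move=> p0; have mg : measurable_fun setT (fun r : R => (`|r| `^ p)%:E).
  by apply/measurable_EFinP; apply: measurable_powR_comp; exact: normr_measurable.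
rewrite (@ge0_integral_dotr _ _ mu mu_unif (fun r => (`|r| `^ p)%:E) x i mg); last first.
  by move=> r; rewrite lee_fin powR_ge0.
rewrite /coord_powR_mean -ge0_integralZl//; last 2 first.
- exact/measurable_EFinP.
- by rewrite lee_fin powR_ge0.
apply: eq_integral => u _; rewrite -EFinM; congr _%:E.
by rewrite normrM (ger0_norm (enorm_ge0 _)) powRM// enorm_ge0.
Qed.

Section mixture.
Context {disp : measure_display} {T : measurableType disp}.
Variable nu : {sigma_finite_measure set T -> \bar R}.
Variable f : T -> 'rV[R]_d.
Hypothesis mf : measurable_fun setT f.

(* Averaging |<v, u>|^p over the sphere gives a fixed multiple of |v|^p, so
   moments of |v| only depend on the one-dimensional marginals of v. *)
Lemma integral_enorm_powR_project p : (0 < p)%R ->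
  coord_powR_mean p * \int[nu]_t (enorm (f t) `^ p)%:E =
  \int[mu]_(u in sphere) \int[nu]_t (`|dotr (f t) u| `^ p)%:E.
Proof.
move=> p0; pose H (z : T * 'rV[R]_d) : \bar R := (`|dotr (f z.1) z.2| `^ p)%:E.
have mH : measurable_fun setT H.
  apply/measurable_EFinP; apply: measurable_powR_comp; apply: measurableT_comp => //.
  apply: measurable_fun_dotr; last exact: measurable_snd.
  by apply: (measurableT_comp mf); exact: measurable_fst.
have H0 z : 0 <= H z by rewrite lee_fin powR_ge0.
have mE : measurable_fun setT (fun t => (enorm (f t) `^ p)%:E).
  apply/measurable_EFinP; apply: measurable_powR_comp.
  exact: measurable_fun_enorm.
rewrite -ge0_integralZl//; last 2 first.
- by move=> x _; rewrite lee_fin powR_ge0.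
- by apply: integral_ge0 => x _; rewrite lee_fin powR_ge0.
transitivity (\int[nu]_t \int[mu]_u H (t, u)).
  apply: eq_integral => t _; rewrite muleC.
  exact/esym/(coord_powR_mean_dotr (f t) p0).
transitivity (\int[mu]_u \int[nu]_t H (t, u)).
  exact: (@fubini_tonelli _ _ _ _ R nu mu H mH H0).
apply: ge0_integral_sphere => //.
- exact: (@measurable_fun_fubini_tonelli_G _ _ _ _ R nu H mH H0).
- by move=> u; exact: integral_ge0.
Qed.

End mixture.

(** A Cramer-Wold device for one moment: both sides, multiplied by the same nonzero constant, are
    averages over u of the projected moments. *)
Lemma eq_integral_enorm_powR {disp disp' : measure_display}
  {T : measurableType disp} {T' : measurableType disp'}
  (nu : {sigma_finite_measure set T -> \bar R})
  (nu' : {sigma_finite_measure set T' -> \bar R})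
  (f : T -> 'rV[R]_d) (f' : T' -> 'rV[R]_d) p : (0 < p)%R ->
  measurable_fun setT f -> measurable_fun setT f' ->
  (forall u, enorm u = 1%R -> \int[nu]_t (`|dotr (f t) u| `^ p)%:E =
     \int[nu']_t (`|dotr (f' t) u| `^ p)%:E) ->
  \int[nu]_t (enorm (f t) `^ p)%:E = \int[nu']_t (enorm (f' t) `^ p)%:E.
Proof.
move=> p0 mf mf' ff'.
have [k kE k0] : exists2 k : R, coord_powR_mean p = k%:E & (k != 0)%R.
  exists (fine (coord_powR_mean p)).
    by rewrite fineK// coord_powR_mean_fin// ltW.
  by rewrite fine_eq0 ?coord_powR_mean_neq0// coord_powR_mean_fin// ltW.
have := integral_enorm_powR_project nu mf p0.
have := integral_enorm_powR_project nu' mf' p0.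
rewrite (@eq_integral _ _ _ _ sphere (fun u => \int[nu]_t (`|dotr (f t) u| `^ p)%:E)); last first.
  by move=> u; rewrite inE => us; rewrite ff'.
move=> <-; rewrite kE => /(congr1 (fun a => (k^-1)%:E * a)).
by rewrite !muleA -EFinM mulVf// !mul1e.
Qed.

End projection.

Section powR_continuity.
Context {R : realType}.

Lemma continuous_norm_powR (p : R) : 1 <= p -> continuous (fun x : R => `|x| `^ p).
Proof.
move=> p1 x; have p0 : 0 < p by rewrite (lt_le_trans _ p1).
have [->|x0] := eqVneq x 0.
  rewrite /continuous_at normr0 powR0 ?gt_eqF//.
  (* At 0: |y|^p <= |y| when |y| <= 1, because p >= 1. *)
  apply/cvgr0Pnorm_lt => e e0; apply/nbhs_ballP.
  exists (Num.min 1 e); first by rewrite /= lt_min ltr01.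
  move=> y; rewrite /ball /= sub0r normrN lt_min => /andP[y1 ye].
  rewrite ger0_norm ?powR_ge0//.
  have [->|y0] := eqVneq y 0; first by rewrite normr0 powR0 ?gt_eqF.
  apply: le_lt_trans ye.
  rewrite -[leRHS]powRr1//; apply: ger_powR => //.
  by rewrite normr_gt0 y0 ltW.
have nx : 0 < `|x| by rewrite normr_gt0.
have c1 : {for `|x|, continuous (fun y => y `^ p)}.
  apply: differentiable_continuous; apply/derivable1_diffP.
  have := is_derive_powR p nx; by case.
exact: (continuous_comp (@norm_continuous _ _ x) c1).
Qed.

End powR_continuity.

(** * Polar form and stability of the Gaussian law *)

Section gaussian_law.
Context {R : realType} {d : nat}.
Variable rho : probability 'rV[R]_d R.
Local Open Scope ereal_scope.

Definition normal_marginals (s : R) := forall u : 'rV[R]_d, enorm u = 1%R ->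
  forall B : set R, measurable B -> rho (dotr u @^-1` B) = normal_prob 0%R s B.

Variable s0 : R.
Hypothesis s0_gt0 : (0 < s0)%R.
Hypothesis rho_normal : normal_marginals s0.

Let N0 := normal_prob 0%R s0.

Let mdotr (u : 'rV[R]_d) : measurable_fun setT (fun z => dotr u z : measurableTypeR R).
Proof. by apply: measurable_fun_dotr. Qed.

Lemma ge0_integral_normal_marginal (g : R -> \bar R) (x : 'rV[R]_d) :
  measurable_fun setT g -> (forall r, 0 <= g r) ->
  \int[rho]_z g (dotr x z) = \int[N0]_r g (enorm x * r)%R.
Proof.
have [->|x0] := eqVneq x 0%R.
  move=> _ _; rewrite enorm0.
  under eq_integral do rewrite dotr0l.
  under [RHS]eq_integral do rewrite mul0r.
  rewrite !integral_cst// [X in _ * X = _](_ : _ = 1); last exact: probability_setT.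
  by congr (_ * _); exact/esym/probability_setT.
have xn : enorm x != 0%R by apply: contra_neq x0 => /enorm_eq0.
pose e := ((enorm x)^-1 *: x)%R.
have e1 : enorm e = 1%R by rewrite enormZ ger0_norm ?invr_ge0 ?enorm_ge0// mulVf.
move=> mg g0; pose h r := g (enorm x * r)%R.
have mh : measurable_fun setT h by apply: measurableT_comp => //; exact: measurable_funM.
transitivity (\int[rho]_z h (dotr e z)).
  by apply: eq_integral => z _; rewrite /h dotrZl mulrA mulfV// mul1r.
transitivity (\int[pushforward rho (fun z => dotr e z : measurableTypeR R)]_r h r).
  by rewrite (@ge0_integral_pushforward _ _ _ _ _ _ (mdotr e))// => r _; exact: g0.
by apply: eq_measure_integral => A mA _; exact: rho_normal.
Qed.

Variable mu : probability 'rV[R]_d R.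
Hypothesis mu_unif : sphere_law mu.
Variable i : 'I_d.
Variable p : R.
Hypothesis p1 : (1 <= p)%R.

Let p0 : (0 < p)%R. Proof. exact: lt_le_trans p1. Qed.

Let cG (c : R) : continuous (fun r : R => `|c + r| `^ p)%R.
Proof.
move=> x; apply: (@continuous_comp _ _ _ (fun r => c + r)%R (fun r => `|r| `^ p)%R).
  by apply: cvgD; [exact: cvg_cst|exact: cvg_id].
exact: continuous_norm_powR.
Qed.

Let mG (c a : R) : measurable_fun setT (fun r : R => (`|c + a * r| `^ p)%:E).
Proof.
apply/measurable_EFinP; apply: measurable_powR_comp; apply: measurableT_comp => //.
by apply: measurable_funD => //; exact: measurable_funM.
Qed.

Let G0 (c a r : R) : 0 <= (`|c + a * r| `^ p)%:E.
Proof. by rewrite lee_fin powR_ge0. Qed.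

Let rho_unit (u : 'rV[R]_d) (c a : R) : enorm u = 1%R ->
  \int[rho]_z (`|c + a * dotr u z| `^ p)%:E = \int[N0]_r (`|c + a * r| `^ p)%:E.
Proof.
move=> u1; pose g (r : R) : \bar R := (`|c + a * r| `^ p)%:E.
transitivity (\int[N0]_r g (enorm u * r)%R).
  exact: (@ge0_integral_normal_marginal g u (mG c a) (G0 c a)).
by apply: eq_integral => r _; rewrite u1 mul1r.
Qed.

Let mu_dotr (x : 'rV[R]_d) (c a : R) :
  \int[mu]_v (`|c + a * dotr x v| `^ p)%:E =
  \int[mu]_v (`|c + a * (enorm x * v ord0 i)| `^ p)%:E.
Proof.
pose g (r : R) : \bar R := (`|c + a * r| `^ p)%:E.
exact: (@ge0_integral_dotr _ _ mu mu_unif g x i (mG c a) (G0 c a)).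
Qed.

Let mrow (disp : measure_display) (T : measurableType disp)
  (f g : T -> 'rV[R]_d) (c : T -> R) : measurable_fun setT f ->
  measurable_fun setT c -> measurable_fun setT g ->
  measurable_fun setT (fun t => f t + c t *: g t)%R.
Proof. by move=> mf mc mg; apply: measurable_fun_rowD => //; exact: measurable_fun_rowZ. Qed.

(* Rotation invariance of the Gaussian law, obtained from its marginals. *)
Lemma integral_normal_marginals_polar (x : 'rV[R]_d) (a : R) : (0 <= a)%R ->
  \int[rho]_z (enorm (x + a *: z)%R `^ p)%:E =
  \int[rho]_z \int[mu]_u (enorm (x + (a * enorm z) *: u)%R `^ p)%:E.
Proof.
move=> a0; pose f (z : 'rV[R]_d * 'rV[R]_d) := (x + (a * enorm z.1) *: z.2)%R.
have mf : measurable_fun setT f.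
  apply: measurable_fun_rowD => //; apply: measurable_fun_rowZ.
    apply: measurable_funM => //; apply: measurable_fun_enorm; exact: measurable_fst.
  exact: measurable_snd.
pose nu := product_subprobability (rho : subprobability _ _, mu : subprobability _ _).
have m1 : measurable_fun setT (fun z => (enorm (f z) `^ p)%:E).
  by apply/measurable_EFinP; apply: measurable_powR_comp; exact: measurable_fun_enorm.
have h1 z : 0 <= (enorm (f z) `^ p)%:E by rewrite lee_fin powR_ge0.
transitivity (\int[nu]_z (enorm (f z) `^ p)%:E); last first.
  exact: (@fubini_tonelli1 _ _ _ _ R rho mu _ m1 h1).
apply: (@eq_integral_enorm_powR _ _ mu mu_unif i _ _ _ _ rho nu) => //.
  by apply: mrow.
move=> u u1.
have m2 : measurable_fun setT (fun z => (`|dotr (f z) u| `^ p)%:E).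
  apply/measurable_EFinP; apply: measurable_powR_comp; apply: measurableT_comp => //.
  by apply: measurable_fun_dotr.
have h2 z : 0 <= (`|dotr (f z) u| `^ p)%:E by rewrite lee_fin powR_ge0.
transitivity (\int[rho]_z \int[mu]_v (`|dotr (f (z, v)) u| `^ p)%:E); last first.
  by symmetry; exact: (@fubini_tonelli1 _ _ _ _ R rho mu _ m2 h2).
(* For fixed z, |z| <u, v> and <z, v> have the same law under [mu], that of |z| v_i. With <z, v>,
   exchanging the integrals lets each unit v see one and the same normal marginal. *)
transitivity (\int[rho]_z \int[mu]_v (`|dotr x u + a * dotr z v| `^ p)%:E).
  pose H (t : 'rV[R]_d * 'rV[R]_d) := (`|dotr x u + a * dotr t.1 t.2| `^ p)%:E.
  have mH : measurable_fun setT H.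
    apply/measurable_EFinP; apply: measurable_powR_comp; apply: measurableT_comp => //.
    apply: measurable_funD => //; apply: measurable_funM => //.
    by apply: measurable_fun_dotr.
  have H0 t : 0 <= H t by rewrite lee_fin powR_ge0.
  have mHG := @measurable_fun_fubini_tonelli_G _ _ _ _ R rho H mH H0.
  transitivity (\int[mu]_v \int[rho]_z H (z, v)); last first.
    exact/esym/(@fubini_tonelli _ _ _ _ R rho mu H mH H0).
  rewrite [RHS](ge0_integral_sphere mu_unif mHG); last by move=> v; exact: integral_ge0.
  transitivity (\int[mu]_(v in sphere) \int[N0]_r (`|dotr x u + a * r| `^ p)%:E).
    rewrite integral_cst; last exact: measurable_sphere.
    rewrite [X in _ * X](_ : _ = 1); last exact: mu_unif.1.
    rewrite mule1.
    transitivity (\int[rho]_z (`|dotr x u + a * dotr u z| `^ p)%:E).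
      by apply: eq_integral => z _; rewrite dotrDl dotrZl (dotrC z).
    exact: rho_unit.
  apply: eq_integral => v; rewrite inE => v1.
  transitivity (\int[rho]_z (`|dotr x u + a * dotr v z| `^ p)%:E); last first.
    by apply: eq_integral => z _; rewrite /H /= (dotrC z).
  exact/esym/rho_unit.
apply: eq_integral => z _; rewrite mu_dotr.
transitivity (\int[mu]_v (`|dotr x u + a * enorm z * dotr u v| `^ p)%:E).
  by rewrite mu_dotr; apply: eq_integral => v _; rewrite u1 mul1r mulrA.
by apply: eq_integral => v _; rewrite /f dotrDl dotrZl (dotrC v).
Qed.

(** Only projections on unit vectors matter, and there this is the stability of normal laws on the
    line. Zero scales are split off because the one-dimensional statement needs both positive. *)
Lemma integral_normal_marginals_conv (x : 'rV[R]_d) (a b : R) : (0 <= a)%R -> (0 <= b)%R ->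
  \int[rho]_z \int[rho]_y (enorm (x + a *: z + b *: y)%R `^ p)%:E =
  \int[rho]_z (enorm (x + Num.sqrt (a ^+ 2 + b ^+ 2) *: z)%R `^ p)%:E.
Proof.
have Icst (c : \bar R) : \int[rho]_z c = c.
  rewrite integral_cst// [X in _ * X](_ : _ = 1) ?mule1//; exact: probability_setT.
rewrite le_eqVlt => /predU1P[<- b0|a0].
  rewrite expr0n add0r sqrtr_sqr ger0_norm//.
  under eq_integral do under eq_integral do rewrite scale0r addr0.
  exact: Icst.
rewrite le_eqVlt => /predU1P[<-|b0].
  rewrite expr0n addr0 sqrtr_sqr gtr0_norm//.
  apply: eq_integral => z _; under eq_integral do rewrite scale0r addr0.
  exact: Icst.
pose f (z : 'rV[R]_d * 'rV[R]_d) := (x + a *: z.1 + b *: z.2)%R.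
have mf : measurable_fun setT f.
  apply: measurable_fun_rowD; last by apply: measurable_fun_rowZ => //; exact: measurable_snd.
  apply: measurable_fun_rowD => //.
  by apply: measurable_fun_rowZ => //; exact: measurable_fst.
pose nu := product_subprobability (rho : subprobability _ _, rho : subprobability _ _).
have m1 : measurable_fun setT (fun z => (enorm (f z) `^ p)%:E).
  by apply/measurable_EFinP; apply: measurable_powR_comp; exact: measurable_fun_enorm.
have h1 z : 0 <= (enorm (f z) `^ p)%:E by rewrite lee_fin powR_ge0.
transitivity (\int[nu]_z (enorm (f z) `^ p)%:E).
  exact/esym/(@fubini_tonelli1 _ _ _ _ R rho rho _ m1 h1).
set c := Num.sqrt _.
apply: (@eq_integral_enorm_powR _ _ mu mu_unif i _ _ _ _ nu rho) => //.
  by apply: mrow.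
move=> u u1.
have m2 : measurable_fun setT (fun z => (`|dotr (f z) u| `^ p)%:E).
  apply/measurable_EFinP; apply: measurable_powR_comp; apply: measurableT_comp => //.
  by apply: measurable_fun_dotr.
have h2 z : 0 <= (`|dotr (f z) u| `^ p)%:E by rewrite lee_fin powR_ge0.
transitivity (\int[rho]_z \int[rho]_v (`|dotr (f (z, v)) u| `^ p)%:E).
  exact: (@fubini_tonelli1 _ _ _ _ R rho rho _ m2 h2).
have as0 : (0 < a * s0)%R by exact: mulr_gt0.
have bs0 : (0 < b * s0)%R by exact: mulr_gt0.
have scale t (c' : R) : (0 < t)%R -> \int[N0]_r (`|c' + t * r| `^ p)%:E =
    \int[normal_prob 0%R (t * s0)]_r (`|c' + r| `^ p)%:E.
  move=> t0; have ts0 : (0 < t * s0)%R by exact: mulr_gt0.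
  have cGt : continuous (fun r : R => `|c' + t * r| `^ p)%R.
    move=> y; apply: (@continuous_comp _ _ _ (fun r => t * r)%R (fun r => `|c' + r| `^ p)%R).
      by apply: cvgM; [exact: cvg_cst|exact: cvg_id].
    exact: cG.
  rewrite (ge0_integral_normal_affine 0%R s0_gt0 cGt); last by move=> r; exact: powR_ge0.
  transitivity (\int[normal_prob 0%R 1%R]_r (`|c' + (0 + t * s0 * r)| `^ p)%:E).
    by apply: eq_integral => r _; rewrite !add0r mulrA.
  symmetry; pose G (r : R) : R := (`|c' + r| `^ p)%R.
  have cG' : continuous G by move=> r; exact: cG.
  have G'0 r : (0 <= G r)%R by exact: powR_ge0.
  exact: (ge0_integral_normal_affine 0%R ts0 cG' G'0).
have c0 : (0 < c)%R by rewrite sqrtr_gt0 addr_gt0// exprn_gt0.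
transitivity (\int[rho]_z \int[normal_prob 0%R (b * s0)]_r (`|dotr x u + a * dotr u z + r| `^ p)%:E).
  apply: eq_integral => z _; rewrite -scale//.
  transitivity (\int[rho]_y (`|dotr x u + a * dotr u z + b * dotr u y| `^ p)%:E).
    by apply: eq_integral => y _; rewrite /f !dotrDl !dotrZl !(dotrC u).
  exact: rho_unit.
pose H (t : measurableTypeR R * measurableTypeR R) := (`|dotr x u + a * t.1 + t.2| `^ p)%:E.
have mH : measurable_fun setT H.
  apply/measurable_EFinP; apply: measurable_powR_comp; apply: measurableT_comp => //.
  apply: measurable_funD; last exact: measurable_snd.
  apply: measurable_funD => //; apply: measurable_funM => //; exact: measurable_fst.
have H0 t : 0 <= H t by rewrite lee_fin powR_ge0.
pose K r := \int[normal_prob 0%R (b * s0)]_y H (r, y).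
have mK : measurable_fun setT K.
  exact: (@measurable_fun_fubini_tonelli_F _ _ _ _ R (normal_prob 0%R (b * s0)) H mH H0).
transitivity (\int[N0]_r K r).
  rewrite (@ge0_integral_normal_marginal K u mK); last by move=> r; exact: integral_ge0.
  by apply: eq_integral => r _; rewrite u1 mul1r.
transitivity (\int[normal_prob 0%R (b * s0)]_y \int[N0]_r H (r, y)).
  exact: (@fubini_tonelli _ _ _ _ R N0 (normal_prob 0%R (b * s0)) H mH H0).
transitivity (\int[normal_prob 0%R (b * s0)]_y \int[normal_prob 0%R (a * s0)]_r
    (`|dotr x u + (y + r)| `^ p)%:E).
  apply: eq_integral => y _; rewrite /H /=.
  transitivity (\int[N0]_r (`|(dotr x u + y) + a * r| `^ p)%:E).
    by apply: eq_integral => r _; rewrite addrAC.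
  by rewrite (scale a (dotr x u + y)%R a0); apply: eq_integral => r _; rewrite addrA.
transitivity (\int[normal_prob 0%R (Num.sqrt ((b * s0) ^+ 2 + (a * s0) ^+ 2))]_r
    (`|dotr x u + r| `^ p)%:E).
  pose G (r : R) : R := (`|dotr x u + r| `^ p)%R.
  have cG' : continuous G by move=> r; exact: cG.
  have G'0 r : (0 <= G r)%R by exact: powR_ge0.
  exact: (ge0_integral_normal_conv bs0 as0 cG' G'0).
have -> : Num.sqrt ((b * s0) ^+ 2 + (a * s0) ^+ 2) = (c * s0)%R.
  by rewrite !exprMn -mulrDl addrC sqrtrM ?addr_ge0 ?sqr_ge0// sqrtr_sqr gtr0_norm.
rewrite -scale//.
transitivity (\int[rho]_z (`|dotr x u + c * dotr u z| `^ p)%:E); last first.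
  by apply: eq_integral => z _; rewrite dotrDl dotrZl (dotrC u).
exact/esym/rho_unit.
Qed.

End gaussian_law.

(** * Moments of the Gaussian norm *)

Section gaussian_moments.
Context {R : realType} {d : nat}.
Variables (rho mu : probability 'rV[R]_d R).
Hypothesis mu_unif : sphere_law mu.
Variable i : 'I_d.
Variable s0 : R.
Hypothesis s0_gt0 : 0 < s0.
Hypothesis s0_var : s0 ^+ 2 * normal_moment 1 = d%:R^-1.
Hypothesis rho_normal : normal_marginals rho s0.
Local Open Scope ereal_scope.

Let d0 : (0 < d%:R :> R)%R.
Proof. by rewrite ltr0n; case: d i => [[]|]. Qed.

Let even_ge0 k (x : R) : (0 <= x ^+ k.*2)%R.
Proof. by rewrite exprn_even_ge0// odd_double. Qed.

(** The projection formula at p = 2 k, whose right side is a one-dimensional normal moment. Dividing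
    by the coordinate moment of the sphere yields E |z|^(2k). *)
Lemma normal_marginals_moment k : (0 < k <= 3)%N ->
  ((\int[mu]_(x in sphere) (x ord0 i ^+ k.*2))%R)%:E *
    \int[rho]_z (enorm z ^+ k.*2)%:E = (s0 ^+ k.*2 * normal_moment k)%:E.
Proof.
move=> /andP[k0 k3].
have p0 : (0 < k.*2%:R :> R)%R by rewrite ltr0n double_gt0.
have norm_even (r : R) : (`|r| `^ k.*2%:R = r ^+ k.*2)%R.
  by rewrite powR_mulrn// -!muln2 mulnC !exprM real_normK ?num_real.
have := @integral_enorm_powR_project _ _ mu mu_unif i _ _ rho id (@measurable_id _ _ setT) _ p0.
rewrite coord_powR_mean_even//.
rewrite (eq_integral (fun z => (enorm z ^+ k.*2)%:E)); last first.
  by move=> z _; rewrite powR_mulrn ?enorm_ge0.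
move=> ->.
have mg : measurable_fun setT (fun r : R => (`|r| `^ k.*2%:R)%:E).
  by apply/measurable_EFinP; apply: measurable_powR_comp; exact: normr_measurable.
rewrite (@eq_integral _ _ _ _ sphere (fun=> (s0 ^+ k.*2 * normal_moment k)%:E)).
  rewrite integral_cst; last exact: measurable_sphere.
  by rewrite [X in _ * X](_ : _ = 1) ?mule1//; exact: mu_unif.1.
move=> u; rewrite inE => us.
transitivity (\int[rho]_z (`|dotr u z| `^ k.*2%:R)%:E).
  by apply: eq_integral => z _; rewrite dotrC.
have g0 (r : R) : 0 <= (`|r| `^ k.*2%:R)%:E by rewrite lee_fin powR_ge0.
rewrite (ge0_integral_normal_marginal rho_normal u mg g0).
transitivity (\int[normal_prob 0%R s0]_r (r ^+ k.*2)%:E).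
  by apply: eq_integral => r _; rewrite (us : enorm u = 1%R) mul1r norm_even.
rewrite (@ge0_integral_normal_affine R 0%R s0 (fun r => r ^+ k.*2)%R)//; last first.
  exact: exprn_continuous.
under eq_integral do rewrite add0r exprMn EFinM.
rewrite ge0_integralZl_EFin//; first by rewrite normal_momentE.
- by move=> x _; rewrite lee_fin.
- by apply/measurable_EFinP; exact: measurable_funX.
Qed.

Let M2 : (\int[mu]_(x in sphere) (x ord0 i ^+ 2) = d%:R^-1)%R.
Proof. exact: sphere_moment2. Qed.

Let M4 : (\int[mu]_(x in sphere) (x ord0 i ^+ 4) = 3 / (d%:R * (d%:R + 2)))%R.
Proof.
have := sphere_moment_rec mu_unif i 2; rewrite M2 => h.
have d2 : (d%:R + 2 != 0 :> R)%R by rewrite gt_eqF// addr_gt0.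
by apply: (mulfI d2); rewrite h; field; rewrite d2 gt_eqF.
Qed.

Let M6 : (\int[mu]_(x in sphere) (x ord0 i ^+ 6) = 15 / (d%:R * (d%:R + 2) * (d%:R + 4)))%R.
Proof.
have := sphere_moment_rec mu_unif i 4; rewrite M4 => h.
have d2 : (d%:R + 2 != 0 :> R)%R by rewrite gt_eqF// addr_gt0.
have d4 : (d%:R + 4 != 0 :> R)%R by rewrite gt_eqF// addr_gt0.
by apply: (mulfI d4); rewrite h; field; rewrite d2 d4 gt_eqF.
Qed.

Let cancel_fin (c b r : R) (a : \bar R) : (c != 0)%R -> c%:E * a = b%:E -> (b = c * r)%R -> a = r%:E.
Proof.
move=> c0 /(congr1 (fun a => (c^-1)%:E * a)); rewrite muleA -!EFinM mulVf// mul1e => -> ->.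
by rewrite mulKf.
Qed.

Lemma gaussian_moment2 : \int[rho]_z (enorm z ^+ 2)%:E = 1.
Proof.
have := @normal_marginals_moment 1 isT; rewrite M2 s0_var => h.
by apply: (cancel_fin _ h); rewrite ?mulr1 ?invr_eq0 ?gt_eqF.
Qed.

Lemma gaussian_moment4 : \int[rho]_z (enorm z ^+ 4)%:E = (1 + 2 / d%:R)%:E.
Proof.
have := @normal_marginals_moment 2 isT; rewrite M4.
rewrite (_ : s0 ^+ 4 * _ = 3 / d%:R ^+ 2)%R; last first.
  by rewrite normal_moment2E -exprVn -s0_var; ring.
have d2 : (d%:R + 2 != 0 :> R)%R by rewrite gt_eqF// addr_gt0.
move=> h; apply: (cancel_fin _ h).
  by rewrite gt_eqF// divr_gt0// ?mulr_gt0// ?addr_gt0.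
by field; rewrite d2 gt_eqF.
Qed.

Lemma gaussian_moment6 :
  \int[rho]_z (enorm z ^+ 6)%:E = ((1 + 2 / d%:R) * (1 + 4 / d%:R))%:E.
Proof.
have := @normal_marginals_moment 3 isT; rewrite M6.
rewrite (_ : s0 ^+ 6 * _ = 15 / d%:R ^+ 3)%R; last first.
  by rewrite normal_moment3E -exprVn -s0_var; ring.
have d2 : (d%:R + 2 != 0 :> R)%R by rewrite gt_eqF// addr_gt0.
have d4 : (d%:R + 4 != 0 :> R)%R by rewrite gt_eqF// addr_gt0.
move=> h; apply: (cancel_fin _ h).
  by rewrite gt_eqF// divr_gt0// ?mulr_gt0// ?addr_gt0.
by field; rewrite d2 d4 gt_eqF.
Qed.

(** The variable |z|^2 - 1 has first three moments 0, 2 / d and 8 / d^2. The integral of [G] may be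
    infinite; that case is immediate. *)
Lemma gaussian_polynomial_le (G : 'rV[R]_d -> \bar R) (c0 c1 c2 c3 : R) :
  measurable_fun setT G -> (forall z, 0 <= G z) ->
  (forall z, (c0 + c1 * (enorm z ^+ 2 - 1) + c2 * (enorm z ^+ 2 - 1) ^+ 2 +
     c3 * (enorm z ^+ 2 - 1) ^+ 3)%:E <= G z) ->
  (c0 + c2 * (2 / d%:R) + c3 * (8 / d%:R ^+ 2))%:E <= \int[rho]_z G z.
Proof.
move=> mG G0 hG.
have mE k : measurable_fun setT (fun z : 'rV[R]_d => (enorm z ^+ k)%:E).
  by apply/measurable_EFinP; apply: measurable_funX; exact: measurable_fun_enorm.
have intE k (c : R) : \int[rho]_z (enorm z ^+ k.*2)%:E = c%:E ->
    rho.-integrable setT (fun z => (enorm z ^+ k.*2)%:E).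
  move=> h; apply/integrableP; split => //.
  rewrite (eq_integral (fun z => (enorm z ^+ k.*2)%:E)) ?h ?ltry// => z _.
  by rewrite gee0_abs ?lee_fin.
have i2 := intE 1%N _ gaussian_moment2.
have i4 := intE 2%N _ gaussian_moment4.
have i6 := intE 3%N _ gaussian_moment6.
pose e0 := (c0 - c1 + c2 - c3)%R; pose e1 := (c1 - 2 * c2 + 3 * c3)%R.
pose e2 := (c2 - 3 * c3)%R.
pose h (z : 'rV[R]_d) : \bar R := cst e0%:E z + (e1%:E * (enorm z ^+ 2)%:E + (e2%:E * (enorm z ^+ 4)%:E + c3%:E * (enorm z ^+ 6)%:E)).
have ic : rho.-integrable setT (cst e0%:E) by exact: finite_measure_integrable_cst.
have j2 := integrableZl measurableT e1 i2.
have j4 := integrableZl measurableT e2 i4.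
have j6 := integrableZl measurableT c3 i6.
have k46 := integrableD measurableT j4 j6.
have k246 := integrableD measurableT j2 k46.
have ih : rho.-integrable setT h by exact: (integrableD measurableT ic k246).
have -> : (c0 + c2 * (2 / d%:R) + c3 * (8 / d%:R ^+ 2))%:E = \int[rho]_z h z.
  rewrite /h (integralD measurableT ic k246) (integralD measurableT j2 k46).
  rewrite (integralD measurableT j4 j6) (integralZl measurableT i2).
  rewrite (integralZl measurableT i4) (integralZl measurableT i6).
  rewrite gaussian_moment2 gaussian_moment4 gaussian_moment6 integral_cst//.
  rewrite [X in _ * X + _](_ : _ = 1); last exact: probability_setT.
  rewrite mule1 -!EFinM -!EFinD; congr _%:E; rewrite /e0 /e1 /e2.
  by field; rewrite gt_eqF.
have hG' z : h z <= G z.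
  apply: le_trans (hG z).
  rewrite /h /= -!EFinM -!EFinD lee_fin le_eqVlt; apply/orP; left; apply/eqP.
  by rewrite /e0 /e1 /e2; ring.
have [Goo|Gfin] := eqVneq (\int[rho]_z G z) +oo; first by rewrite Goo leey.
apply: le_integral => //.
apply/integrableP; split => //.
rewrite (eq_integral G); last by move=> z _; rewrite gee0_abs.
by rewrite lt_neqAle Gfin leey.
Qed.

End gaussian_moments.

(** * Removing the shift by e *)

Section shifted_powR.
Context {R : realType}.

Lemma powR_tangent (q w u : R) : 1 <= q -> 0 < w -> 0 <= u ->
  w `^ q + q * w `^ (q - 1) * (u - w) <= u `^ q.
Proof.
move=> q1 w0 u0; have q0 : 0 < q by lra.
have wE : w * w `^ (q - 1) = w `^ q by rewrite mulr_powRB1 ?ltW.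
have [->|un0] := eqVneq u 0.
  rewrite powR0 ?gt_eqF// -wE; have := powR_ge0 w (q - 1); set y := w `^ _ => y0.
  have : 0 <= (q - 1) * (w * y) by rewrite mulr_ge0 ?subr_ge0// mulr_ge0// ltW.
  by nra.
have v0 : 0 < u / w by rewrite divr_gt0// lt_neqAle eq_sym un0.
have h : 1 + q * (u / w - 1) <= (u / w) `^ q by apply: powR_bernoulli => //; nra.
have -> : u `^ q = w `^ q * (u / w) `^ q.
  by rewrite -powRM ?ltW// mulrC divfK ?gt_eqF.
have := ler_wpM2l (powR_ge0 w q) h; apply: le_trans; rewrite -wE.
by rewrite le_eqVlt; apply/orP; left; apply/eqP; field; rewrite gt_eqF.
Qed.

(** Convexity of the q-th power: (u + e) / (1 + e) is the mean of u and 1 with weights 1 / (1 + e)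
    and e / (1 + e). Being affine in u^q, the bound survives integration, so e tends to 0 in a real
    inequality and no limit passes under an integral. *)
Lemma powR_add_le (q e u : R) : 1 <= q -> 0 < e -> 0 <= u ->
  (u + e) `^ q <= (1 + e) `^ (q - 1) * (u `^ q + e).
Proof.
move=> q1 e0 u0; have e1 : 0 < 1 + e by rewrite addr_gt0.
have ue : 0 < u + e by lra.
pose w := (u + e) / (1 + e).
have w0 : 0 < w by rewrite divr_gt0.
have h1 := powR_tangent q1 w0 u0.
have := powR_tangent q1 w0 (ler01 : 0 <= 1 :> R); rewrite powR1 => h2.
have h3 : (1 + e) * w `^ q <= u `^ q + e.
  have e2 : (u - w) + e * (1 - w) = 0 by rewrite /w; field; rewrite gt_eqF.
  have := ler_wpM2l (ltW e0) h2; rewrite mulr1 => h4.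
  have := lerD h1 h4; set y := q * _; move=> h5.
  suff : y * ((u - w) + e * (1 - w)) = 0 by move=> h6; lra.
  by rewrite e2 mulr0.
have -> : (u + e) `^ q = (1 + e) `^ (q - 1) * ((1 + e) * w `^ q).
  rewrite mulrA [_ `^ (q - 1) * _]mulrC mulr_powRB1 ?ltW//; last by lra.
  by rewrite -powRM ?ltW// mulrC divfK ?gt_eqF.
by apply: ler_wpM2l => //; exact: powR_ge0.
Qed.

Lemma le_of_shifted_powR (q L I : R) : 0 <= I ->
  (forall e, 0 < e <= 1 / 2 -> L <= (1 + e) `^ (q - 1) * (I + e)) -> L <= I.
Proof.
move=> I0 h.
have c1 : (fun e : R => (1 + e) `^ (q - 1)) @ 0^'+ --> (1 : R).
  have e1 : (1 + 0 : R) `^ (q - 1) = 1 by rewrite addr0 powR1.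
  rewrite -[X in _ --> X]e1.
  apply: cvg_at_right_filter.
  have d1 : {for (1 + 0 : R), continuous (fun y : R => y `^ (q - 1))}.
    apply: differentiable_continuous; apply/derivable1_diffP.
    have h1 : 0 < 1 + 0 :> R by rewrite addr0.
    by have := is_derive_powR (q - 1) h1; case.
  have c2 : {for (0 : R), continuous (fun e : R => 1 + e)}.
    by apply: cvgD; [exact: cvg_cst|exact: cvg_id].
  exact: (continuous_comp c2 d1).
have c : (fun e : R => (1 + e) `^ (q - 1) * (I + e)) @ 0^'+ --> I.
  rewrite -[X in _ --> X]mul1r; apply: cvgM => //.
  rewrite -[X in _ --> X]addr0; apply: cvgD; first exact: cvg_cst.
  by apply: cvg_at_right_filter; exact: cvg_id.
apply: (cvgr_to_ge c); near=> e; apply: h; apply/andP; split; near: e.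
  exact: nbhs_right_gt.
by apply: nbhs_right_le; lra.
Unshelve. all: by end_near. Qed.

End shifted_powR.

(** * The exchange inequality at a fixed point *)

Section swap.
Context {R : realType} {d : nat}.
Variables (rho mu : probability 'rV[R]_d R).
Hypothesis mu_unif : sphere_law mu.
Variable i : 'I_d.
Variable s0 : R.
Hypothesis s0_gt0 : 0 < s0.
Hypothesis s0_var : s0 ^+ 2 * normal_moment 1 = d%:R^-1.
Hypothesis rho_normal : normal_marginals rho s0.
Local Open Scope ereal_scope.

Let d0 : (0 < d%:R :> R)%R.
Proof. by rewrite ltr0n; case: d i => [[]|]. Qed.

Lemma enorm_powR2 (q : R) (x : 'rV[R]_d) : (enorm x `^ (2 * q) = (enorm x ^+ 2) `^ q)%R.
Proof. by rewrite powRrM powR_mulrn ?enorm_ge0. Qed.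

Lemma sqr_enorm_shift (r : R) (x u : 'rV[R]_d) : enorm u = 1%R ->
  (enorm (x + r *: u) ^+ 2 = enorm x ^+ 2 + r ^+ 2 + 2 * r * dotr x u)%R.
Proof.
move=> u1; have uu : (dotr u u = 1)%R by rewrite -sqr_enorm u1 expr1n.
rewrite !sqr_enorm dotrDl !dotrDr !dotrZl !dotrZr uu (dotrC u x); ring.
Qed.

Lemma sqr_dist_powR_bounded_mfun (q e s r : R) : (0 <= q)%R -> (0 <= e)%R ->
  (0 <= s)%R -> bounded_mfun (fun z => (sqr_dist s r z + e) `^ q)%R.
Proof.
move=> q0 e0 s0'; split.
  by apply: measurable_powR_comp; apply: measurable_funD => //; exact: measurable_sqr_dist.
exists (((s + `|r|) ^+ 2 + e) `^ q)%R => z z1.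
rewrite ger0_norm ?powR_ge0//; apply: ge0_ler_powR => //.
- by rewrite nnegrE addr_ge0// sqr_dist_ge0.
- by rewrite nnegrE addr_ge0// sqr_ge0.
- by rewrite lerD2r; exact: sqr_dist_le.
Qed.

(** Expanding |x + r u|^2 leaves <x, u> as the only dependence on u, and invariance replaces it by
    |x| u_i. *)
Lemma integral_sphere_shift (f : R -> R) (r : R) (x : 'rV[R]_d) :
  measurable_fun setT f -> (forall y, 0 <= f y)%R ->
  bounded_mfun (fun z => f (sqr_dist (enorm x) r z)) ->
  \int[mu]_u (f (enorm (x + r *: u)%R ^+ 2))%:E =
  (sphere_mean mu i (fun z => f (sqr_dist (enorm x) r z)))%:E.
Proof.
move=> mf f0 bf.
have := bounded_mfun_integrable mu i bf => intf.
rewrite /sphere_mean /Rintegral fineK; last first.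
  by apply: integrable_fin_num => //; exact: measurable_sphere.
pose g (t : R) : \bar R := (f (enorm x ^+ 2 + r ^+ 2 + 2 * r * t))%:E.
have mg : measurable_fun setT g.
  apply/measurable_EFinP; apply: measurableT_comp => //.
  by apply: measurable_funD => //; exact: measurable_funM.
have g0 t : 0 <= g t by rewrite lee_fin.
have mfu : measurable_fun setT (fun u : 'rV[R]_d => (f (enorm (x + r *: u)%R ^+ 2))%:E).
  apply/measurable_EFinP; apply: measurableT_comp => //; apply: measurable_funX.
  apply: measurable_fun_enorm; apply: measurable_fun_rowD => //.
  by apply: measurable_fun_rowZ.
rewrite (ge0_integral_sphere mu_unif mfu); last by move=> u; rewrite lee_fin.
transitivity (\int[mu]_(u in sphere) g (dotr x u)).
  by apply: eq_integral => u; rewrite inE => us; rewrite /g sqr_enorm_shift.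
have mgx : measurable_fun setT (fun u : 'rV[R]_d => g (dotr x u)).
  by apply: (measurableT_comp mg); apply: measurable_fun_dotr.
have mgx' : measurable_fun setT (fun u : 'rV[R]_d => g (enorm x * u ord0 i)%R).
  apply: (measurableT_comp mg); apply: measurable_funM => //; exact: measurable_coord.
transitivity (\int[mu]_u g (dotr x u)).
  by symmetry; apply: (ge0_integral_sphere mu_unif mgx) => u; exact: g0.
rewrite (ge0_integral_dotr mu_unif x i mg g0).
rewrite (ge0_integral_sphere mu_unif mgx'); last by move=> u; exact: g0.
by apply: eq_integral => u _; rewrite /g /sqr_dist /= !mulrA.
Qed.

Lemma integral_sphere_shift_powR (q e r : R) (x : 'rV[R]_d) : (0 <= q)%R -> (0 <= e)%R ->
  \int[mu]_u ((enorm (x + r *: u)%R ^+ 2 + e) `^ q)%:E =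
  (sphere_mean mu i (fun z => (sqr_dist (enorm x) r z + e) `^ q)%R)%:E.
Proof.
move=> q0 e0; apply: (@integral_sphere_shift (fun y => (y + e) `^ q)%R).
- by apply: measurable_powR_comp; exact: measurable_funD.
- by move=> y; exact: powR_ge0.
- by apply: sqr_dist_powR_bounded_mfun => //; exact: enorm_ge0.
Qed.

(** The lower bound, taken at r = a |z|, is a cubic in |z|^2 - 1 and is integrated over z. [D] is
    independent of e, while k, c2 and c3 may depend on it, so e disappears from the conclusion. *)
Lemma swap_of_tangent (q a D : R) (x : 'rV[R]_d) : (1 <= q)%R -> (0 < a)%R ->
  (forall e, 0 < e <= 1 / 2 -> exists k c2 c3 : R, (forall r, 0 <= r ->
     sphere_mean mu i (fun z => (sqr_dist (enorm x) a z + e) `^ q) +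
       k * (r ^+ 2 - a ^+ 2) + c2 * (r ^+ 2 - a ^+ 2) ^+ 2 + c3 * (r ^+ 2 - a ^+ 2) ^+ 3 <=
     sphere_mean mu i (fun z => (sqr_dist (enorm x) r z + e) `^ q)) /\
     D <= c2 * a ^+ 4 * (2 / d%:R) + c3 * a ^+ 6 * (8 / d%:R ^+ 2))%R ->
  \int[mu]_u (enorm (x + a *: u)%R `^ (2 * q))%:E + D%:E <=
  \int[rho]_z (enorm (x + a *: z)%R `^ (2 * q))%:E.
Proof.
move=> q1 a0 tangent.
have q0 : (0 <= q)%R by exact: le_trans q1.
have p1 : (1 <= 2 * q)%R by lra.
have S0 r : \int[mu]_u (enorm (x + r *: u)%R `^ (2 * q))%:E =
    (sphere_mean mu i (fun z => (sqr_dist (enorm x) r z + 0) `^ q)%R)%:E.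
  rewrite -(integral_sphere_shift_powR r x q0 (lexx 0%R)).
  by apply: eq_integral => u _; rewrite enorm_powR2 addr0.
rewrite S0 -EFinD.
set I := \int[rho]_z _.
have I0 : 0 <= I by apply: integral_ge0 => z _; rewrite lee_fin powR_ge0.
(* No finiteness of the Gaussian moment is assumed; if it is infinite there is nothing to prove. *)
have [->|Ifin] := eqVneq I +oo; first by rewrite leey.
have IE : I = (fine I)%:E by rewrite fineK// ge0_fin_numE// lt_neqAle Ifin leey.
rewrite IE lee_fin; apply: (@le_of_shifted_powR _ q); first exact: fine_ge0.
move=> e e12; have /andP[e0 _] := e12.
have [k [c2 [c3 [tan De]]]] := tangent e e12.
have e1 : (0 < 1 + e)%R by rewrite addr_gt0.
pose M := ((1 + e) `^ (q - 1))%R.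
have M0 : (0 <= M)%R by exact: powR_ge0.
(* By [powR_add_le], this dominates the shifted spherical mean of radius a |z|; by the polar form,
   its integral is M (I + e). *)
pose G (z : 'rV[R]_d) : \bar R :=
  M%:E * (\int[mu]_u (enorm (x + (a * enorm z) *: u)%R `^ (2 * q))%:E + e%:E).
pose H (t : 'rV[R]_d * 'rV[R]_d) : \bar R := (enorm (x + (a * enorm t.1) *: t.2)%R `^ (2 * q))%:E.
have mH : measurable_fun setT H.
  apply/measurable_EFinP; apply: measurable_powR_comp; apply: measurable_fun_enorm.
  apply: measurable_fun_rowD => //; apply: measurable_fun_rowZ.
    by apply: measurable_funM => //; apply: measurable_fun_enorm; exact: measurable_fst.
  exact: measurable_snd.
have H0 t : 0 <= H t by rewrite lee_fin powR_ge0.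
have mI := @measurable_fun_fubini_tonelli_F _ _ _ _ R mu H mH H0.
have mIe : measurable_fun setT (fun z => \int[mu]_u H (z, u) + e%:E) by apply: emeasurable_funD.
have mG : measurable_fun setT G by apply: emeasurable_funM.
have Ie0 z : 0 <= \int[mu]_u H (z, u) + e%:E.
  by apply: adde_ge0; [exact: integral_ge0|rewrite lee_fin ltW].
have G0 z : 0 <= G z.
  by apply: mule_ge0; [rewrite lee_fin|exact: (Ie0 z)].
have GE : \int[rho]_z G z = (M * (fine I + e))%:E.
  transitivity (M%:E * \int[rho]_z (\int[mu]_u H (z, u) + e%:E)).
    by apply: ge0_integralZl_EFin => // z _; exact: Ie0.
  rewrite ge0_integralD; last 5 first.
  - exact: measurableT.
  - by move=> z _; exact: integral_ge0.
  - exact: mI.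
  - by move=> z _; rewrite lee_fin ltW.
  - exact: measurable_cst.
  rewrite integral_cst// [X in _ * (_ + _ * X)](_ : _ = 1); last exact: probability_setT.
  rewrite mule1 EFinM EFinD -IE; congr (_ * (_ + _)).
  exact/esym/(integral_normal_marginals_polar rho_normal mu_unif i p1 x (ltW a0)).
pose Sa := sphere_mean mu i (fun z => (sqr_dist (enorm x) a z + e) `^ q)%R.
have PG (z : 'rV[R]_d) : (Sa + (k * a ^+ 2) * (enorm z ^+ 2 - 1) +
    (c2 * a ^+ 4) * (enorm z ^+ 2 - 1) ^+ 2 +
    (c3 * a ^+ 6) * (enorm z ^+ 2 - 1) ^+ 3)%:E <= G z.
  have az0 : (0 <= a * enorm z)%R by rewrite mulr_ge0 ?enorm_ge0// ltW.
  have bnd r := sqr_dist_powR_bounded_mfun r q0.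
  apply: (@le_trans _ _ (sphere_mean mu i (fun t => (sqr_dist (enorm x) (a * enorm z) t + e) `^ q)%R)%:E).
    rewrite lee_fin; apply: le_trans (tan _ az0); rewrite -/Sa exprMn.
    by rewrite le_eqVlt; apply/orP; left; apply/eqP; ring.
  rewrite /G S0 -EFinD -EFinM lee_fin.
  have bq := sqr_dist_powR_bounded_mfun (a * enorm z) q0 (lexx 0%R) (enorm_ge0 x).
  have be := sqr_dist_powR_bounded_mfun (a * enorm z) q0 (ltW e0) (enorm_ge0 x).
  have bc := @bounded_mfun_cst R.
  rewrite -[X in (_ + X)%R](sphere_mean_cst mu_unif i e) -sphere_meanD// -sphere_meanZ; last exact: bounded_mfunD.
  apply: le_sphere_mean => //; first by apply: bounded_mfunM => //; exact: bounded_mfunD.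
  move=> t t1; rewrite addr0; apply: powR_add_le => //.
  exact: sqr_dist_ge0.
have := gaussian_polynomial_le mu_unif i s0_gt0 s0_var rho_normal mG G0 PG.
rewrite GE lee_fin; apply: le_trans.
(* On the uniform side the shift can simply be dropped, as it only increases the mean. *)
have : (sphere_mean mu i (fun z => (sqr_dist (enorm x) a z + 0) `^ q) <= Sa)%R.
  apply: le_sphere_mean.
  - by apply: sqr_dist_powR_bounded_mfun => //; exact: enorm_ge0.
  - by apply: sqr_dist_powR_bounded_mfun => //; [exact: ltW|exact: enorm_ge0].
  - move=> t t1; apply: ge0_ler_powR => //.
    + by rewrite nnegrE addr0 sqr_dist_ge0.
    + by rewrite nnegrE addr_ge0 ?sqr_dist_ge0// ltW.
    + by rewrite lerD2l ltW.
by move: De; clear; lra.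
Qed.
End swap.

Section powR_taylor_scaled.
Context {R : realType}.

Lemma powR_taylor2_scaled (q b c : R) : 2 <= q -> 0 < b -> 0 < b + c ->
  b `^ q + q * b `^ (q - 1) * c + (q - 1) * b `^ (q - 2) * c ^+ 2 <= (b + c) `^ q.
Proof.
move=> q2 b0 bc0; have bn0 : b != 0 by rewrite gt_eqF.
have v0 : 0 < 1 + c / b by rewrite -(mulfV bn0) -mulrDl divr_gt0.
have h := ler_wpM2l (powR_ge0 b q) (powR_taylor2 q2 v0).
have eM : b `^ q * (1 + c / b) `^ q = (b + c) `^ q.
  by rewrite -powRM ?ltW// mulrDr mulr1 mulrC divfK.
have e1 : b `^ q = b `^ (q - 1) * b by rewrite mulrC mulr_powRB1 ?ltW//; lra.
have e2 : b `^ (q - 1) = b `^ (q - 2) * b.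
  have -> : q - 2 = q - 1 - 1 by ring.
  by rewrite mulrC mulr_powRB1 ?ltW//; lra.
rewrite eM in h; apply: le_trans h; rewrite e1 e2.
by rewrite le_eqVlt; apply/orP; left; apply/eqP; field.
Qed.

Lemma powR_taylor3_scaled (q b c : R) : 3 <= q -> 0 < b -> 0 < b + c ->
  b `^ q + q * b `^ (q - 1) * c + q * (q - 1) / 2 * b `^ (q - 2) * c ^+ 2 +
  q * (q - 1) * (q - 2) / 6 * (b `^ (q - 2) / b) * c ^+ 3 <= (b + c) `^ q.
Proof.
move=> q3 b0 bc0; have bn0 : b != 0 by rewrite gt_eqF.
have v0 : 0 < 1 + c / b by rewrite -(mulfV bn0) -mulrDl divr_gt0.
have h := ler_wpM2l (powR_ge0 b q) (powR_taylor3 q3 v0).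
have eM : b `^ q * (1 + c / b) `^ q = (b + c) `^ q.
  by rewrite -powRM ?ltW// mulrDr mulr1 mulrC divfK.
have e1 : b `^ q = b `^ (q - 1) * b by rewrite mulrC mulr_powRB1 ?ltW//; lra.
have e2 : b `^ (q - 1) = b `^ (q - 2) * b.
  have -> : q - 2 = q - 1 - 1 by ring.
  by rewrite mulrC mulr_powRB1 ?ltW//; lra.
rewrite eM in h; apply: le_trans h; rewrite e1 e2.
by rewrite le_eqVlt; apply/orP; left; apply/eqP; field.
Qed.

(** For b <= 1 because b^g >= b, for b >= 1 because b^g >= 1 and (b / 2 - 1)^2 >= 0. It trades a
    real power of |x|^2 + a^2 for its first two moments. *)
Lemma powR_ge_quadratic (g b : R) : 0 <= g <= 1 -> 0 < b -> b - b ^+ 2 / 4 <= b `^ g.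
Proof.
move=> /andP[g0 g1] b0; have [b1|/ltW b1] := leP b 1.
  apply: (@le_trans _ _ b); first by rewrite gerBl divr_ge0 ?sqr_ge0.
  by rewrite -[leLHS]powRr1 ?(ltW b0)//; apply: ger_powR => //; rewrite b0 b1.
apply: (@le_trans _ _ 1); first by have := sqr_ge0 (b / 2 - 1); lra.
by rewrite -[leLHS](powRr0 b); apply: ler_powR.
Qed.

End powR_taylor_scaled.

Section swap_cases.
Context {R : realType} {d : nat}.
Variables (rho mu : probability 'rV[R]_d R).
Hypothesis mu_unif : sphere_law mu.
Variable i : 'I_d.
Variable s0 : R.
Hypothesis s0_gt0 : 0 < s0.
Hypothesis s0_var : s0 ^+ 2 * normal_moment 1 = d%:R^-1.
Hypothesis rho_normal : normal_marginals rho s0.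
Variables (q a : R) (x : 'rV[R]_d).
Hypothesis a_gt0 : 0 < a.

Let d0 : 0 < d%:R :> R.
Proof. by rewrite ltr0n; case: d i => [[]|]. Qed.

Local Notation sphere_side := (\int[mu]_u (enorm (x + a *: u)%R `^ (2 * q))%:E)%E.
Local Notation gauss_side := (\int[rho]_z (enorm (x + a *: z)%R `^ (2 * q))%:E)%E.

(** Negative parts of the deficit move to the right, so that only nonnegative functions of x have to
    be integrated later. *)
Let move_deficit (A B : R) (u v : \bar R) : (u + (A - B)%:E <= v ->
  u + A%:E <= v + B%:E)%E.
Proof.
move=> h; have -> : (u + A%:E = u + (A - B)%:E + B%:E)%E.
  by rewrite -addeA -EFinD subrK.
exact: leeD2r.
Qed.

(** The terms on the right stem from the sixth-power correction: its quadratic coefficient depends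
    on |x|^2, and its cubic one has the unfavourable sign. *)
Lemma swap_small (C K1 K2 : R) : (2 <= d)%N -> 1 <= q <= 2 ->
  C = q * (q - 1) * (4 * q - 4 + 2 * d%:R) * (4 * q - 8 + 2 * d%:R) ->
  K1 = C * (1 + (2 - q) / 2) / (8 * d%:R * (d%:R + 2)) ->
  K2 = C * (2 - q) / (24 * (d%:R + 2) * (d%:R + 4)) ->
  (sphere_side + (K1 * a ^+ 4 * (2 / d%:R))%:E <=
   gauss_side + (K2 * a ^+ 6 * (6 / d%:R + 8 / d%:R ^+ 2) +
     K2 * (3 + 12 / d%:R) * a ^+ 4 * (2 / d%:R) * enorm x ^+ 2)%:E)%E.
Proof.
move=> d2 q12 CE K1E K2E; apply: move_deficit.
have q1 : 1 <= q by case/andP: q12.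
apply: (swap_of_tangent mu_unif s0_gt0 s0_var rho_normal q1 a_gt0) => e e12.
have [k hk] := sphere_mean_powR_small mu_unif i d2 q12 e12 (enorm_ge0 x) a_gt0.
exists k, (K1 - K2 * (3 * a ^+ 2 + (3 + 12 / d%:R) * enorm x ^+ 2)), (- K2).
split; first by move=> r r0; apply: le_trans (hk r r0); rewrite mulNr K1E K2E CE.
by rewrite le_eqVlt; apply/orP; left; apply/eqP; field; rewrite gt_eqF.
Qed.

(** With b = |x|^2 + a^2, the quadratic Taylor bound has coefficient (q - 1) b^(q-2), up to e, and
    the power, of exponent in [0, 1], is at least b - b^2 / 4. *)
Lemma swap_mid : 2 <= q <= 3 ->
  (sphere_side + ((q - 1) * (2 / d%:R) * a ^+ 4 * (enorm x ^+ 2 + a ^+ 2))%:E <=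
   gauss_side + ((q - 1) / (2 * d%:R) * a ^+ 4 * (enorm x ^+ 2 + a ^+ 2) ^+ 2)%:E)%E.
Proof.
move=> /andP[q2 q3]; apply: move_deficit.
have q1 : 1 <= q by lra.
apply: (swap_of_tangent mu_unif s0_gt0 s0_var rho_normal q1 a_gt0) => e /andP[e0 _].
have [k hk] := sphere_mean_powR_large mu_unif i q2 e0 (enorm_ge0 x) a_gt0.
set b0 := enorm x ^+ 2 + a ^+ 2.
have b0_gt0 : 0 < b0 by rewrite ltr_wpDl ?sqr_ge0// exprn_gt0.
have b_gt0 : 0 < b0 + e by rewrite addr_gt0.
exists (k + q * (b0 + e) `^ (q - 1)), ((q - 1) * (b0 + e) `^ (q - 2)), 0.
split=> [r r0|].
  apply: le_trans (hk r r0).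
  have bc : 0 < b0 + e + (r ^+ 2 - a ^+ 2).
    have -> : b0 + e + (r ^+ 2 - a ^+ 2) = enorm x ^+ 2 + r ^+ 2 + e by rewrite /b0; ring.
    by rewrite ltr_wpDl// addr_ge0 ?sqr_ge0.
  have := powR_taylor2_scaled q2 b_gt0 bc.
  have -> : b0 + e + (r ^+ 2 - a ^+ 2) = enorm x ^+ 2 + r ^+ 2 + e by rewrite /b0; ring.
  rewrite mul0r addr0; set S := sphere_mean _ _ _; set T := _ `^ q; lra.
have W : b0 - b0 ^+ 2 / 4 <= (b0 + e) `^ (q - 2).
  have g01 : 0 <= q - 2 <= 1 by apply/andP; split; lra.
  apply: (le_trans (powR_ge_quadratic g01 b0_gt0)).
  apply: ge0_ler_powR; rewrite ?nnegrE ?(ltW b0_gt0) ?(ltW b_gt0)//.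
    by case/andP: g01.
  by rewrite lerDl ltW.
rewrite !mul0r addr0.
have pos : 0 <= (q - 1) * a ^+ 4 * (2 / d%:R).
  have a4 : 0 <= a ^+ 4 by rewrite exprn_ge0// ltW.
  have d2 : 0 <= 2 / d%:R :> R by rewrite divr_ge0// ltW.
  by apply: mulr_ge0 => //; apply: mulr_ge0 => //; lra.
have -> : (q - 1) * (2 / d%:R) * a ^+ 4 * b0 - (q - 1) / (2 * d%:R) * a ^+ 4 * b0 ^+ 2 =
    (q - 1) * a ^+ 4 * (2 / d%:R) * (b0 - b0 ^+ 2 / 4).
  by field; rewrite gt_eqF.
rewrite [leRHS](_ : _ = (q - 1) * a ^+ 4 * (2 / d%:R) * (b0 + e) `^ (q - 2)); last by ring.
exact: ler_wpM2l.
Qed.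

(** The cubic Taylor term is needed for the quadratic coefficient q (q - 1) / 2, which alone would
    be too large below the expansion point; its own contribution is nonnegative and dropped.
    Bernoulli's inequality makes b^(q-2) affine in b = |x|^2 + a^2. *)
Lemma swap_large : 3 <= q ->
  (sphere_side + (q * (q - 1) / d%:R * a ^+ 4 * (1 + (q - 2) * (enorm x ^+ 2 + a ^+ 2)))%:E <=
   gauss_side + (q * (q - 1) * (q - 2) / d%:R * a ^+ 4)%:E)%E.
Proof.
move=> q3; apply: move_deficit.
have q1 : 1 <= q by lra.
have q2 : 2 <= q by lra.
apply: (swap_of_tangent mu_unif s0_gt0 s0_var rho_normal q1 a_gt0) => e /andP[e0 _].
have [k hk] := sphere_mean_powR_large mu_unif i q2 e0 (enorm_ge0 x) a_gt0.
set b0 := enorm x ^+ 2 + a ^+ 2.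
have b0_gt0 : 0 < b0 by rewrite ltr_wpDl ?sqr_ge0// exprn_gt0.
have b_gt0 : 0 < b0 + e by rewrite addr_gt0.
pose W := (b0 + e) `^ (q - 2).
exists (k + q * (b0 + e) `^ (q - 1)), (q * (q - 1) / 2 * W),
  (q * (q - 1) * (q - 2) / 6 * (W / (b0 + e))).
split=> [r r0|].
  apply: le_trans (hk r r0).
  have bc : 0 < b0 + e + (r ^+ 2 - a ^+ 2).
    have -> : b0 + e + (r ^+ 2 - a ^+ 2) = enorm x ^+ 2 + r ^+ 2 + e by rewrite /b0; ring.
    by rewrite ltr_wpDl// addr_ge0 ?sqr_ge0.
  have := powR_taylor3_scaled q3 b_gt0 bc.
  have -> : b0 + e + (r ^+ 2 - a ^+ 2) = enorm x ^+ 2 + r ^+ 2 + e by rewrite /b0; ring.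
  rewrite -/W; set S := sphere_mean _ _ _; set T := _ `^ q.
  set Y := _ * _ ^+ 3; set X := _ * _ ^+ 2; lra.
have hW : 1 + (q - 2) * (b0 - 1) <= W.
  apply: (@le_trans _ _ (1 + (q - 2) * (b0 + e - 1))).
    by rewrite lerD2l ler_wpM2l//; lra.
  by apply: powR_bernoulli => //; nra.
have W0 : 0 <= W by exact: powR_ge0.
have q0 : 0 <= q * (q - 1) by rewrite mulr_ge0; lra.
have h3 : 0 <= q * (q - 1) * (q - 2) / 6 * (W / (b0 + e)) * a ^+ 6 * (8 / d%:R ^+ 2).
  have h6 : 0 <= q * (q - 1) * (q - 2) / 6 by rewrite divr_ge0// mulr_ge0//; lra.
  have hb : 0 <= W / (b0 + e) by rewrite divr_ge0// ltW.
  rewrite mulr_ge0 ?divr_ge0 ?exprn_ge0 ?(ltW d0)//.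
  by rewrite mulr_ge0 ?exprn_ge0 ?(ltW a_gt0)// mulr_ge0.
have pos : 0 <= q * (q - 1) / d%:R * a ^+ 4.
  by apply: mulr_ge0; [rewrite divr_ge0// ltW|rewrite exprn_ge0// ltW].
have -> : q * (q - 1) / 2 * W * a ^+ 4 * (2 / d%:R) = q * (q - 1) / d%:R * a ^+ 4 * W.
  by field; rewrite gt_eqF.
have -> : q * (q - 1) / d%:R * a ^+ 4 * (1 + (q - 2) * b0) - q * (q - 1) * (q - 2) / d%:R * a ^+ 4 =
    q * (q - 1) / d%:R * a ^+ 4 * (1 + (q - 2) * (b0 - 1)) by ring.
have := ler_wpM2l pos hW; lra.
Qed.

End swap_cases.

(** * The replacement argument *)

Section second_moments.
Context {R : realType} {d : nat}.
Variables (rho mu : probability 'rV[R]_d R).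
Hypothesis mu_unif : sphere_law mu.
Variable i : 'I_d.
Local Open Scope ereal_scope.

Lemma integral_sphere_enorm_sqr (x : 'rV[R]_d) (r : R) :
  \int[mu]_u (enorm (x + r *: u)%R ^+ 2)%:E = (enorm x ^+ 2 + r ^+ 2)%:E.
Proof.
transitivity (\int[mu]_u ((enorm (x + r *: u)%R ^+ 2 + 0) `^ 1)%:E).
  by apply: eq_integral => u _; rewrite addr0 powRr1 ?sqr_ge0.
rewrite (integral_sphere_shift_powR mu_unif i r x ler01 (lexx 0%R)); congr _%:E.
have bc := @bounded_mfun_cst R.
have bi := @bounded_mfun_id R.
transitivity (sphere_mean mu i (fun z => (enorm x ^+ 2 + r ^+ 2) + 2 * r * enorm x * z)%R).
  by apply: eq_sphere_mean => z z1; rewrite addr0 powRr1 ?sqr_dist_ge0.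
rewrite sphere_meanD//; last exact: bounded_mfunM.
rewrite sphere_meanZ// sphere_mean_cst//.
have -> : sphere_mean mu i id = 0%R.
  rewrite -[RHS](sphere_moment1 mu_unif i); apply: eq_Rintegral => u _.
  by rewrite expr1.
by rewrite mulr0 addr0.
Qed.

(** Jensen's inequality for the square, the excess being the variance (2 r |x|)^2 / d. *)
Lemma integral_sphere_enorm4_ge (x : 'rV[R]_d) (r : R) :
  ((enorm x ^+ 2 + r ^+ 2) ^+ 2)%:E <= \int[mu]_u (enorm (x + r *: u)%R `^ (2 * 2))%:E.
Proof.
rewrite [leRHS](_ : _ = \int[mu]_u ((enorm (x + r *: u)%R ^+ 2 + 0) `^ 2)%:E); last first.
  by apply: eq_integral => u _; rewrite addr0 enorm_powR2.
rewrite (integral_sphere_shift_powR mu_unif i r x (ler0n R 2) (lexx 0%R)) lee_fin.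
rewrite (_ : sphere_mean _ _ _ = sphere_mean mu i
    (fun z => ((enorm x ^+ 2 + r ^+ 2) + (2 * r * enorm x) * z) ^+ 2)%R); last first.
  by apply: eq_sphere_mean => z z1; rewrite addr0 powR_mulrn ?sqr_dist_ge0.
by rewrite sphere_mean_sqr// lerDl divr_ge0 ?sqr_ge0.
Qed.

Variable s0 : R.
Hypothesis s0_gt0 : (0 < s0)%R.
Hypothesis s0_var : (s0 ^+ 2 * normal_moment 1 = d%:R^-1)%R.
Hypothesis rho_normal : normal_marginals rho s0.

Lemma integral_gaussian_enorm_sqr (x : 'rV[R]_d) (a : R) : (0 <= a)%R ->
  \int[rho]_z (enorm (x + a *: z)%R ^+ 2)%:E = (enorm x ^+ 2 + a ^+ 2)%:E.
Proof.
move=> a0.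
transitivity (\int[rho]_z (enorm (x + a *: z)%R `^ 2)%:E).
  by apply: eq_integral => z _; rewrite powR_mulrn ?enorm_ge0.
rewrite (integral_normal_marginals_polar rho_normal mu_unif i (ler1n R 2) x a0).
transitivity (\int[rho]_z ((enorm x ^+ 2)%:E + (a ^+ 2)%:E * (enorm z ^+ 2)%:E)).
  apply: eq_integral => z _.
  transitivity (\int[mu]_u (enorm (x + (a * enorm z) *: u)%R ^+ 2)%:E).
    by apply: eq_integral => u _; rewrite powR_mulrn ?enorm_ge0.
  by rewrite integral_sphere_enorm_sqr exprMn EFinD EFinM.
have mz : measurable_fun setT (fun z : 'rV[R]_d => (enorm z ^+ 2)%:E).
  by apply/measurable_EFinP; apply: measurable_funX; exact: measurable_fun_enorm.
rewrite ge0_integralD; last 5 first.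
- exact: measurableT.
- by move=> z _; rewrite lee_fin sqr_ge0.
- exact: measurable_cst.
- by move=> z _; rewrite -EFinM lee_fin mulr_ge0// sqr_ge0.
- exact: emeasurable_funM.
rewrite ge0_integralZl_EFin; last 4 first.
- exact: measurableT.
- by move=> z _; rewrite lee_fin sqr_ge0.
- exact: mz.
- exact: sqr_ge0.
rewrite (gaussian_moment2 mu_unif i s0_gt0 s0_var rho_normal) mule1 integral_cst//.
by rewrite [X in _ * X + _](_ : _ = 1) ?mule1//; exact: probability_setT.
Qed.

End second_moments.

(** * Integrating the exchange over the remaining sum *)

Section integrated_swap.
Context {R : realType} {d : nat}.
Variable sigma : probability 'rV[R]_d R.
Local Open Scope ereal_scope.

(** Nonnegative coefficients allow the integrals to be split even when infinite. The fourth-moment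
    bound is multiplied by [b2], so it is void for [b2] = 0. *)
Lemma integrated_swap (A C : 'rV[R]_d -> \bar R) (a m M a0 a1 b0 b1 b2 : R) :
  measurable_fun setT A -> (forall x, 0 <= A x) ->
  measurable_fun setT C -> (forall x, 0 <= C x) ->
  (0 <= a0)%R -> (0 <= a1)%R -> (0 <= b0)%R -> (0 <= b1)%R -> (0 <= b2)%R ->
  (forall x, A x + (a0 + a1 * enorm x ^+ 2)%:E <=
     C x + (b0 + b1 * enorm x ^+ 2 + b2 * (enorm x ^+ 2 + a ^+ 2) ^+ 2)%:E) ->
  \int[sigma]_x (enorm x ^+ 2)%:E = m%:E ->
  b2%:E * \int[sigma]_x ((enorm x ^+ 2 + a ^+ 2) ^+ 2)%:E <= (b2 * M)%:E ->
  \int[sigma]_x A x + (a0 + a1 * m - (b0 + b1 * m + b2 * M))%:E <= \int[sigma]_x C x.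
Proof.
move=> mA A0 mC C0 ha0 ha1 hb0 hb1 hb2 AC Em EM.
have mE : measurable_fun setT (fun x : 'rV[R]_d => (enorm x ^+ 2)%R).
  by apply: measurable_funX; exact: measurable_fun_enorm.
have mE4 : measurable_fun setT (fun x : 'rV[R]_d => (enorm x ^+ 2 + a ^+ 2) ^+ 2)%R.
  by apply: measurable_funX; exact: measurable_funD.
have mL c0 c1 : measurable_fun setT (fun x : 'rV[R]_d => (c0 + c1 * enorm x ^+ 2)%:E).
  by apply/measurable_EFinP; apply: measurable_funD => //; exact: measurable_funM.
have mb : measurable_fun setT (fun x : 'rV[R]_d =>
    (b0 + b1 * enorm x ^+ 2 + b2 * (enorm x ^+ 2 + a ^+ 2) ^+ 2)%:E).
  apply/measurable_EFinP; apply: measurable_funD; last exact: measurable_funM.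
  by apply: measurable_funD => //; exact: measurable_funM.
have L0 (c0 c1 : R) : (0 <= c0)%R -> (0 <= c1)%R -> forall x : 'rV[R]_d,
    0 <= (c0 + c1 * enorm x ^+ 2)%:E.
  by move=> ? ? x; rewrite lee_fin addr_ge0// mulr_ge0// sqr_ge0.
have b40 (x : 'rV[R]_d) : 0 <= (b2 * (enorm x ^+ 2 + a ^+ 2) ^+ 2)%:E.
  by rewrite lee_fin mulr_ge0// sqr_ge0.
have IL (c0 c1 : R) : (0 <= c0)%R -> (0 <= c1)%R ->
    \int[sigma]_x (c0 + c1 * enorm x ^+ 2)%:E = (c0 + c1 * m)%:E.
  move=> hc0 hc1; under eq_integral do rewrite EFinD EFinM.
  rewrite ge0_integralD; last 5 first.
  - exact: measurableT.
  - by move=> x _; rewrite lee_fin.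
  - exact: measurable_cst.
  - by move=> x _; rewrite -EFinM lee_fin mulr_ge0// sqr_ge0.
  - by apply: emeasurable_funM => //; exact/measurable_EFinP.
  rewrite ge0_integralZl_EFin; last 4 first.
  - exact: measurableT.
  - by move=> z _; rewrite lee_fin sqr_ge0.
  - exact/measurable_EFinP.
  - exact: hc1.
  rewrite Em integral_cst// [X in _ * X + _](_ : _ = 1); last exact: probability_setT.
  by rewrite mule1.
have h : \int[sigma]_x A x + (a0 + a1 * m)%:E <= \int[sigma]_x C x + (b0 + b1 * m + b2 * M)%:E.
  rewrite -IL// -ge0_integralD; last 5 first.
  - exact: measurableT.
  - by move=> x _; exact: A0.
  - exact: mA.
  - by move=> x _; exact: L0.
  - exact: mL.
  apply: (@le_trans _ _ (\int[sigma]_x (C x +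
    (b0 + b1 * enorm x ^+ 2 + b2 * (enorm x ^+ 2 + a ^+ 2) ^+ 2)%:E))).
    apply: ge0_le_integral => //.
    - by move=> x _; apply: adde_ge0; [exact: A0|exact: L0].
    - exact: emeasurable_funD.
    - exact: emeasurable_funD.
  rewrite ge0_integralD; last 5 first.
  - exact: measurableT.
  - by move=> x _; exact: C0.
  - exact: mC.
  - by move=> x _; rewrite EFinD; apply: adde_ge0; [exact: L0|exact: b40].
  - exact: mb.
  apply: leeD2l; rewrite [leRHS]EFinD -(IL _ _ hb0 hb1).
  under eq_integral do rewrite EFinD.
  rewrite ge0_integralD; last 5 first.
  - exact: measurableT.
  - by move=> x _; exact: L0.
  - exact: mL.
  - by move=> x _; exact: b40.
  - by apply/measurable_EFinP; exact: measurable_funM.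
  apply: leeD2l.
  under eq_integral do rewrite EFinM.
  rewrite ge0_integralZl_EFin//.
  - by move=> z _; rewrite lee_fin sqr_ge0.
  - exact/measurable_EFinP.
by rewrite [X in _ + X]EFinB addeA leeBlDr.
Qed.

End integrated_swap.

Section deficit_bounds.
Context {R : realFieldType}.
Implicit Types q D : R.

(** Clearing denominators in [deficit_const (2 * q) d] <= (q - 1) / d, for q > 2. *)
Lemma deficit_bound_mid q D : 2 <= D -> 2 <= q <= 3 ->
  (2 * q + D - 2) * (2 * q + D - 4) <= (q - 1) * (24 * D * (D + 2)).
Proof.
move=> D2 /andP[q2 q3].
have h1 : 0 <= 2 * q + D - 2 <= 3 * D by apply/andP; split; lra.
have h2 : 0 <= 2 * q + D - 4 <= D + 2 by apply/andP; split; lra.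
move: h1 h2 => /andP[u0 u1] /andP[v0 v1].
apply: (@le_trans _ _ (3 * D * (D + 2))); first exact: ler_pM.
have : 0 <= D * (D + 2) by apply: mulr_ge0; lra.
by nra.
Qed.

(** The factors compare one by one. This shows that q (q - 1) / d exceeds the deficit constant with
    a factor 24 to spare. *)
Lemma deficit_bound_large q D : 2 <= D -> 3 <= q ->
  (2 * q + D - 2) * (2 * q + D - 4) <= q * D * ((q - 1) * (D + 2)).
Proof.
move=> D2 q3.
have h1 : 0 <= 2 * q + D - 2 <= q * D by apply/andP; split; nra.
have h2 : 0 <= 2 * q + D - 4 <= (q - 1) * (D + 2) by apply/andP; split; nra.
by move: h1 h2 => /andP[u0 u1] /andP[v0 v1]; exact: ler_pM.
Qed.

End deficit_bounds.

Section deficit.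
Context {R : realType} {d : nat}.
Variables (rho mu sigma : probability 'rV[R]_d R).
Hypothesis mu_unif : sphere_law mu.
Variable i : 'I_d.
Variable s0 : R.
Hypothesis s0_gt0 : (0 < s0)%R.
Hypothesis s0_var : (s0 ^+ 2 * normal_moment 1 = d%:R^-1)%R.
Hypothesis rho_normal : normal_marginals rho s0.
Hypothesis d_ge2 : (2 <= d)%N.
Variable q a : R.
Hypothesis q_ge1 : (1 <= q)%R.
Hypothesis a_gt0 : (0 < a)%R.
Hypothesis sigma_sqr : (\int[sigma]_x (enorm x ^+ 2)%:E = (1 - a ^+ 2)%:E)%E.
Hypothesis sigma_sqr_sqr :
  2 < q -> (\int[sigma]_x ((enorm x ^+ 2 + a ^+ 2) ^+ 2)%:E <= 2%:E)%E.

Let d2 : 2 <= d%:R :> R. Proof. by rewrite (ler_nat R 2 d). Qed.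
Let d0 : 0 < d%:R :> R. Proof. exact: lt_le_trans d2. Qed.

Local Notation A := (fun x => (\int[mu]_u (enorm (x + a *: u)%R `^ (2 * q))%:E)%E).
Local Notation C := (fun x => (\int[rho]_z (enorm (x + a *: z)%R `^ (2 * q))%:E)%E).

Lemma measurable_integral_shift (nu : probability 'rV[R]_d R) (t p : R) :
  measurable_fun setT (fun x : 'rV[R]_d => (\int[nu]_u (enorm (x + t *: u)%R `^ p)%:E)%E).
Proof.
pose H (z : 'rV[R]_d * 'rV[R]_d) : \bar R := (enorm (z.1 + t *: z.2) `^ p)%:E.
have mH : measurable_fun setT H.
  apply/measurable_EFinP; apply: measurable_powR_comp; apply: measurable_fun_enorm.
  apply: measurable_fun_rowD; first exact: measurable_fst.
  by apply: measurable_fun_rowZ => //; exact: measurable_snd.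
have H0 z : (0 <= H z)%E by rewrite lee_fin powR_ge0.
exact: (@measurable_fun_fubini_tonelli_F _ _ _ _ R nu H mH H0).
Qed.

Lemma integral_shift_ge0 (nu : probability 'rV[R]_d R) (t p : R) (x : 'rV[R]_d) :
  (0 <= \int[nu]_u (enorm (x + t *: u)%R `^ p)%:E)%E.
Proof. by apply: integral_ge0 => u _; rewrite lee_fin powR_ge0. Qed.

Let le_deficit (D D' : R) : D' <= D ->
  (\int[sigma]_x A x + D%:E <= \int[sigma]_x C x)%E ->
  (\int[sigma]_x A x + D'%:E <= \int[sigma]_x C x)%E.
Proof. by move=> h; apply: le_trans; apply: leeD2l; rewrite lee_fin. Qed.

Let mA := measurable_integral_shift mu a (2 * q).
Let mC := measurable_integral_shift rho a (2 * q).
Let A0 := integral_shift_ge0 mu a (2 * q).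
Let C0 := integral_shift_ge0 rho a (2 * q).

Let a4 : 0 <= a ^+ 4. Proof. by rewrite exprn_ge0// ltW. Qed.
Let a2 : 0 <= a ^+ 2. Proof. exact: sqr_ge0. Qed.

(** The three exchange bounds integrated with E |x|^2 = 1 - a^2; only 2 < q <= 3 calls on the fourth
    moment. The value q = 2, that is p = 4, falls in the first case, as in [deficit_const]. *)
Lemma integrated_deficit :
  (\int[sigma]_x A x + (deficit_const (2 * q) d * a ^+ 4)%:E <= \int[sigma]_x C x)%E.
Proof.
have dn0 : d%:R != 0 :> R by rewrite gt_eqF.
have e2 : d%:R + 2 != 0 :> R by rewrite gt_eqF// addr_gt0.
have e4 : d%:R + 4 != 0 :> R by rewrite gt_eqF// addr_gt0.
have [q2|q2] := leP q 2.
  have q12 : 1 <= q <= 2 by rewrite q_ge1.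
  pose K := q * (q - 1) * (4 * q - 4 + 2 * d%:R) * (4 * q - 8 + 2 * d%:R).
  pose K1 := K * (1 + (2 - q) / 2) / (8 * d%:R * (d%:R + 2)).
  pose K2 := K * (2 - q) / (24 * (d%:R + 2) * (d%:R + 4)).
  have K0 : 0 <= K.
    have h1 : 0 <= 4 * q - 4 + 2 * d%:R by have := d2; lra.
    have h2 : 0 <= 4 * q - 8 + 2 * d%:R by have := d2; lra.
    have h3 : 0 <= q * (q - 1) by apply: mulr_ge0; lra.
    by apply: mulr_ge0 => //; apply: mulr_ge0.
  have K10 : 0 <= K1.
    by rewrite divr_ge0//; apply: mulr_ge0 => //; lra.
  have K20 : 0 <= K2.
    by rewrite divr_ge0//; apply: mulr_ge0 => //; lra.
  have sw x := swap_small mu_unif i s0_gt0 s0_var rho_normal x a_gt0 d_ge2 q12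
    (erefl K) (erefl K1) (erefl K2).
  have a6 : 0 <= a ^+ 6 by rewrite exprn_ge0// ltW.
  have id0 : 0 <= d%:R^-1 :> R by rewrite invr_ge0 ltW.
  have c1 : 0 <= K1 * a ^+ 4 * (2 / d%:R).
    by apply: mulr_ge0; [exact: mulr_ge0|exact: mulr_ge0].
  have c2 : 0 <= K2 * a ^+ 6 * (6 / d%:R + 8 / d%:R ^+ 2).
    by apply: mulr_ge0; [exact: mulr_ge0|rewrite addr_ge0// divr_ge0// exprn_ge0// ltW].
  have c3 : 0 <= K2 * (3 + 12 / d%:R) * a ^+ 4 * (2 / d%:R).
    apply: mulr_ge0; last exact: mulr_ge0.
    by apply: mulr_ge0 => //; apply: mulr_ge0 => //; rewrite addr_ge0// divr_ge0// ltW.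
  have h := @integrated_swap _ _ sigma A C a (1 - a ^+ 2) 0 _ 0 _ _ 0 mA A0 mC C0
    c1 (lexx 0) c2 c3 (lexx 0).
  apply: (le_deficit _ (h _ sigma_sqr _)).
  - have -> : deficit_const (2 * q) d = K / (8 * d%:R ^+ 2 * (d%:R + 2)).
      rewrite /deficit_const ifT; last by lra.
      by rewrite /K; field; rewrite dn0 e2.
    rewrite !mul0r !addr0.
    (* After cancellation the coefficient of a^4 is q K / (8 d^2 (d + 2)), that is q times the
       deficit constant; the surplus factor q - 1 and the a^6 term are nonnegative. *)
    have -> : K1 * a ^+ 4 * (2 / d%:R) - (K2 * a ^+ 6 * (6 / d%:R + 8 / d%:R ^+ 2) +
        K2 * (3 + 12 / d%:R) * a ^+ 4 * (2 / d%:R) * (1 - a ^+ 2)) =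
        K / (8 * d%:R ^+ 2 * (d%:R + 2)) * a ^+ 4 +
        (K / (8 * d%:R ^+ 2 * (d%:R + 2)) * ((q - 1) * a ^+ 4) + 16 / d%:R ^+ 2 * (K2 * a ^+ 6)).
      by rewrite /K1 /K2; field; rewrite dn0 e2 e4.
    rewrite lerDl; apply: addr_ge0; apply: mulr_ge0.
    + rewrite divr_ge0// mulr_ge0 ?addr_ge0 ?mulr_ge0// ?exprn_ge0//; exact: ltW.
    + by apply: mulr_ge0 => //; lra.
    + by rewrite divr_ge0// exprn_ge0// ltW.
    + exact: mulr_ge0.
  - by move=> x; rewrite !mul0r !addr0; exact: sw.
  - by rewrite mul0e mul0r.
have dc : deficit_const (2 * q) d = (2 * q + d%:R - 2) * (2 * q + d%:R - 4) / (24 * d%:R ^+ 2 * (d%:R + 2)).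
  by rewrite /deficit_const ifF ?mulr1//; apply/negbTE; rewrite -ltNge; lra.
have den : 0 < 24 * d%:R ^+ 2 * (d%:R + 2) :> R.
  by rewrite mulr_gt0 ?addr_gt0// mulr_gt0// exprn_gt0.
have [q3|q3] := leP q 3.
  have q23 : 2 <= q <= 3 by rewrite q3 ltW.
  have sw x := swap_mid mu_unif i s0_gt0 s0_var rho_normal x a_gt0 q23.
  pose c := (q - 1) * (2 / d%:R) * a ^+ 4.
  have c0 : 0 <= c.
    apply: mulr_ge0 => //; apply: mulr_ge0; first by lra.
    by rewrite divr_ge0// ltW.
  have c1 : 0 <= c * a ^+ 2 by exact: mulr_ge0.
  have c2 : 0 <= (q - 1) / (2 * d%:R) * a ^+ 4.
    by apply: mulr_ge0 => //; apply: divr_ge0; [lra|rewrite mulr_ge0// ltW].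
  have h := @integrated_swap _ _ sigma A C a (1 - a ^+ 2) 2 _ _ _ _ _ mA A0 mC C0
    c1 c0 (lexx 0) (lexx 0) c2.
  apply: (le_deficit _ (h _ sigma_sqr _)).
  - rewrite dc mul0r !addr0 add0r.
    (* For b = |x|^2 + a^2, E b = 1 and E b^2 <= 2 give the factor 2 / d - 1 / d. *)
    have -> : c * a ^+ 2 + c * (1 - a ^+ 2) - (q - 1) / (2 * d%:R) * a ^+ 4 * 2 =
        (q - 1) / d%:R * a ^+ 4.
      by rewrite /c; field; rewrite dn0.
    apply: ler_wpM2r => //; rewrite ler_pdivrMr//.
    have -> : (q - 1) / d%:R * (24 * d%:R ^+ 2 * (d%:R + 2)) = (q - 1) * (24 * d%:R * (d%:R + 2)).
      by field; rewrite dn0.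
    exact: deficit_bound_mid.
  - move=> x; apply: le_trans (_ : _ <= _)%E (le_trans (sw x) _).
      by apply: leeD2l; rewrite lee_fin le_eqVlt /c; apply/orP; left; apply/eqP; ring.
    by apply: leeD2l; rewrite lee_fin le_eqVlt; apply/orP; left; apply/eqP; ring.
  - by rewrite [leRHS]EFinM; apply: lee_wpmul2l; [rewrite lee_fin|exact: sigma_sqr_sqr].
have q3' : 3 <= q by exact: ltW.
have sw x := swap_large mu_unif i s0_gt0 s0_var rho_normal x a_gt0 q3'.
pose c := q * (q - 1) / d%:R * a ^+ 4.
have c0 : 0 <= c.
  by apply: mulr_ge0 => //; apply: divr_ge0; [apply: mulr_ge0; lra|exact: ltW].
have c1 : 0 <= c * (1 + (q - 2) * a ^+ 2).
  by apply: mulr_ge0 => //; apply: addr_ge0 => //; apply: mulr_ge0 => //; lra.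
have c2 : 0 <= c * (q - 2) by apply: mulr_ge0 => //; lra.
have h := @integrated_swap _ _ sigma A C a (1 - a ^+ 2) 0 _ _ _ _ 0 mA A0 mC C0
  c1 c2 c2 (lexx 0) (lexx 0).
apply: (le_deficit _ (h _ sigma_sqr _)).
- rewrite dc !mul0r !addr0.
  (* The affine bound 1 + (q - 2) (b - 1) has mean 1, as E b = 1. *)
  have -> : c * (1 + (q - 2) * a ^+ 2) + c * (q - 2) * (1 - a ^+ 2) - c * (q - 2) = q * (q - 1) / d%:R * a ^+ 4.
    by rewrite /c; ring.
  apply: ler_wpM2r => //; rewrite ler_pdivrMr//.
  have -> : q * (q - 1) / d%:R * (24 * d%:R ^+ 2 * (d%:R + 2)) = 24 * (q * d%:R) * ((q - 1) * (d%:R + 2)).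
    by field; rewrite dn0.
  apply: (le_trans (deficit_bound_large d2 q3')).
  rewrite -(mulrA 24) ler_peMl//; last by lra.
  apply: mulr_ge0; first by apply: mulr_ge0; [lra|exact: ltW].
  by apply: mulr_ge0; [lra|exact: addr_ge0 (ltW d0) _].
- move=> x; apply: le_trans (_ : _ <= _)%E (le_trans (sw x) _).
    by apply: leeD2l; rewrite lee_fin le_eqVlt /c; apply/orP; left; apply/eqP; ring.
  by apply: leeD2l; rewrite lee_fin le_eqVlt /c; apply/orP; left; apply/eqP; ring.
- by rewrite mul0e mul0r.
Qed.

End deficit.

Section laws.
Context {R : realType} {d : nat}.
Local Open Scope ereal_scope.

Lemma exists_law {disp : measure_display} {T : measurableType disp}
    (P : probability T R) (X : T -> 'rV[R]_d) : measurable_fun setT X ->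
  exists lam : probability 'rV[R]_d R,
    (forall A, lam A = P (X @^-1` A)) /\
    forall f : 'rV[R]_d -> \bar R, measurable_fun setT f -> (forall x, 0 <= f x) ->
      \int[lam]_x f x = \int[P]_t f (X t).
Proof.
move=> mX.
pose m := isMeasurableFun.Build _ _ _ _ X mX.
pose X' : {mfun T >-> 'rV[R]_d} := HB.pack X m.
exists (distribution P X'); split=> // f mf f0.
exact: (@ge0_integral_distribution _ _ _ _ _ P X' f mf f0).
Qed.

Lemma exists_convolution (lam rho : probability 'rV[R]_d R) (t : R) :
  exists sigma : probability 'rV[R]_d R,
    forall f : 'rV[R]_d -> \bar R, measurable_fun setT f -> (forall x, 0 <= f x) ->
      \int[sigma]_x f x = \int[lam]_x \int[rho]_y f (x + t *: y)%R.
Proof.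
pose X (z : 'rV[R]_d * 'rV[R]_d) := (z.1 + t *: z.2)%R.
have mX : measurable_fun setT X.
  apply: measurable_fun_rowD; first exact: measurable_fst.
  by apply: measurable_fun_rowZ => //; exact: measurable_snd.
have [sigma [_ h]] := exists_law (product_measure1 lam rho : probability _ R) mX.
exists sigma => f mf f0; rewrite (h f mf f0).
have mfX : measurable_fun setT (f \o X) by exact: measurableT_comp.
exact: (@fubini_tonelli1 _ _ _ _ R lam rho (f \o X) mfX (fun z => f0 (X z))).
Qed.

End laws.

(** * The replacement induction *)

Section lindeberg.
Context {R : realType} {d : nat}.
Hypothesis d_ge2 : (2 <= d)%N.
Variable rho : probability 'rV[R]_d R.
Variable s0 : R.
Hypothesis s0_gt0 : 0 < s0.
Hypothesis s0_var : s0 ^+ 2 * normal_moment 1 = d%:R^-1.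
Hypothesis rho_normal : normal_marginals rho s0.
Variables (mu lam : nat -> probability 'rV[R]_d R) (a : nat -> R) (n : nat).
Hypothesis mu_unif : forall k, sphere_law (mu k).
Hypothesis a_norm : \sum_(0 <= j < n) a j ^+ 2 = 1.
Hypothesis lam0 : forall f : 'rV[R]_d -> \bar R,
  measurable_fun setT f -> (forall x, 0 <= f x)%E -> (\int[lam 0]_x f x = f 0%R)%E.
Hypothesis lamS : forall k, (k < n)%N -> forall f : 'rV[R]_d -> \bar R,
  measurable_fun setT f -> (forall x, 0 <= f x)%E ->
  (\int[lam k.+1]_x f x = \int[lam k]_x \int[mu k]_u f (x + a k *: u)%R)%E.
Local Open Scope ereal_scope.

Let i : 'I_d := Ordinal (ltnW d_ge2).
Let d2 : (2 <= d%:R :> R)%R. Proof. by rewrite (ler_nat R 2 d). Qed.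
Let d0 : (0 < d%:R :> R)%R. Proof. exact: lt_le_trans d2. Qed.

(** The scale of the single Gaussian copy that stands for the summands k, ..., n - 1. *)
Let tau k : R := Num.sqrt (\sum_(k <= j < n) a j ^+ 2).

Let tau_ge0 k : (0 <= tau k)%R. Proof. exact: sqrtr_ge0. Qed.

Let sqr_tau k : (tau k ^+ 2 = \sum_(k <= j < n) a j ^+ 2)%R.
Proof. by rewrite sqr_sqrtr// sumr_ge0// => j _; exact: sqr_ge0. Qed.

Let tau_step k : (k < n)%N -> (tau k ^+ 2 = a k ^+ 2 + tau k.+1 ^+ 2)%R.
Proof. by move=> kn; rewrite !sqr_tau big_ltn. Qed.

Let mE2 : measurable_fun setT (fun x : 'rV[R]_d => (enorm x ^+ 2)%:E).
Proof.
by apply/measurable_EFinP; apply: measurable_funX; exact: measurable_fun_enorm.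
Qed.

Let integral_sqr_add (nu : probability 'rV[R]_d R) (m c : R) : (0 <= c)%R ->
  \int[nu]_x (enorm x ^+ 2)%:E = m%:E ->
  \int[nu]_x (enorm x ^+ 2 + c)%:E = (m + c)%:E.
Proof.
move=> c0 h; under eq_integral do rewrite EFinD.
rewrite ge0_integralD; last 5 first.
- exact: measurableT.
- by move=> x _; rewrite lee_fin sqr_ge0.
- exact: mE2.
- by move=> x _; rewrite lee_fin.
- exact: measurable_cst.
rewrite h integral_cst// [X in _ + _ * X](_ : _ = 1) ?mule1//.
exact: probability_setT.
Qed.

Let lam_sqr k : (k <= n)%N ->
  \int[lam k]_x (enorm x ^+ 2)%:E = (\sum_(0 <= j < k) a j ^+ 2)%R%:E.
Proof.
elim: k => [_|k IH kn].
  rewrite (lam0 mE2); last by move=> x; rewrite lee_fin sqr_ge0.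
  by rewrite big_geq// enorm0 expr0n.
rewrite (lamS kn mE2); last by move=> x; rewrite lee_fin sqr_ge0.
under eq_integral do rewrite (integral_sphere_enorm_sqr (mu_unif k) i).
rewrite (integral_sqr_add (sqr_ge0 _) (IH (ltnW kn))).
by rewrite big_nat_recr.
Qed.

(* The first k summands are uniform and the remaining ones Gaussian, these
   being merged into a single Gaussian vector. *)
Let interpolant q k := \int[lam k]_x \int[rho]_z (enorm (x + tau k *: z)%R `^ (2 * q))%:E.

Let mF p : measurable_fun setT (fun x : 'rV[R]_d => (enorm x `^ p)%:E).
Proof.
by apply/measurable_EFinP; apply: measurable_powR_comp; exact: measurable_fun_enorm.
Qed.

Section step.
Variable k : nat.
Hypothesis kn : (k < n)%N.
Variable sigma : probability 'rV[R]_d R.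
Hypothesis sigmaE : forall f : 'rV[R]_d -> \bar R, measurable_fun setT f ->
  (forall x, 0 <= f x) ->
  \int[sigma]_x f x = \int[lam k]_x \int[rho]_y f (x + tau k.+1 *: y)%R.

(** [sigma] is the law of the mixed sum without summand k; second moments add up, and the total is
    1. *)
Let sigma_sqr : \int[sigma]_x (enorm x ^+ 2)%:E = (1 - `|a k| ^+ 2)%R%:E.
Proof.
rewrite (sigmaE mE2); last by move=> x; rewrite lee_fin sqr_ge0.
under eq_integral do rewrite
  (integral_gaussian_enorm_sqr (mu_unif k) i s0_gt0 s0_var rho_normal _ (tau_ge0 k.+1)).
rewrite (integral_sqr_add (sqr_ge0 _) (lam_sqr (ltnW kn))); congr _%:E.
have e : (1 = \sum_(0 <= j < k) a j ^+ 2 + tau k ^+ 2)%R.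
  by rewrite sqr_tau -a_norm -big_cat_nat// ltnW.
by rewrite real_normK ?num_real// e (tau_step kn); ring.
Qed.

(** The exchange bounds want a positive scale; central symmetry of the sphere makes the sign of a_k
    immaterial. *)
Let sphere_abs p (y : 'rV[R]_d) :
  \int[mu k]_u (enorm (y + a k *: u)%R `^ p)%:E =
  \int[mu k]_u (enorm (y + `|a k| *: u)%R `^ p)%:E.
Proof.
have [a0|a0] := leP 0%R (a k); first by rewrite (ger0_norm a0).
rewrite (ltr0_norm a0).
have UU : orthogonal_mx (- 1%:M : 'M[R]_d).
  by rewrite /orthogonal_mx linearN /= trmx1 mulNmx mulmxN mul1mx opprK.
have mf : measurable_fun setT (fun u : 'rV[R]_d => (enorm (y + - a k *: u)%R `^ p)%:E).
  apply: (measurableT_comp (mF p)); apply: measurable_fun_rowD => //.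
  by apply: measurable_fun_rowZ.
rewrite -[RHS](ge0_integral_mulmx (mu_unif k) UU mf); last first.
  by move=> u; rewrite lee_fin powR_ge0.
by apply: eq_integral => u _; rewrite mulmxN mulmx1 scalerN scaleNr opprK.
Qed.

Let interpolant_succ q : interpolant q k.+1 =
  \int[sigma]_y \int[mu k]_u (enorm (y + `|a k| *: u)%R `^ (2 * q))%:E.
Proof.
have mI := measurable_integral_shift rho (tau k.+1) (2 * q).
have I0 := integral_shift_ge0 rho (tau k.+1) (2 * q).
rewrite /interpolant (lamS kn mI I0).
rewrite (sigmaE (measurable_integral_shift (mu k) `|a k| (2 * q))
  (integral_shift_ge0 (mu k) `|a k| (2 * q))).
apply: eq_integral => x _.
pose H (z : 'rV[R]_d * 'rV[R]_d) : \bar R :=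
  (enorm (x + a k *: z.1 + tau k.+1 *: z.2)%R `^ (2 * q))%:E.
have mH : measurable_fun setT H.
  apply: (measurableT_comp (mF (2 * q))); apply: measurable_fun_rowD.
    by apply: measurable_fun_rowD => //; apply: measurable_fun_rowZ => //; exact: measurable_fst.
  by apply: measurable_fun_rowZ => //; exact: measurable_snd.
have H0 z : 0 <= H z by rewrite lee_fin powR_ge0.
transitivity (\int[rho]_z \int[mu k]_u H (u, z)).
  exact: (@fubini_tonelli _ _ _ _ R (mu k) rho H mH H0).
apply: eq_integral => z _.
transitivity (\int[mu k]_u (enorm (x + tau k.+1 *: z + a k *: u)%R `^ (2 * q))%:E);
  last exact: sphere_abs.
by apply: eq_integral => u _; rewrite /H /= addrAC.
Qed.

(** The Gaussian summand k is split off again from the merged copy of scale [tau k]. *)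
Let interpolant_conv q : (1 <= q)%R -> interpolant q k =
  \int[sigma]_y \int[rho]_z (enorm (y + `|a k| *: z)%R `^ (2 * q))%:E.
Proof.
move=> q1; have p1 : (1 <= 2 * q)%R by lra.
rewrite (sigmaE (measurable_integral_shift rho `|a k| (2 * q))
  (integral_shift_ge0 rho `|a k| (2 * q))).
apply: eq_integral => x _.
rewrite (integral_normal_marginals_conv s0_gt0 rho_normal (mu_unif k) i p1 x (tau_ge0 k.+1) (normr_ge0 (a k))).
have -> : Num.sqrt (tau k.+1 ^+ 2 + `|a k| ^+ 2) = tau k.
  by rewrite real_normK ?num_real// addrC -(tau_step kn) sqrtr_sqr ger0_norm.
by [].
Qed.

Let interpolant_step_of_bound q : (1 <= q)%R ->
  ((2 < q)%R -> \int[sigma]_x ((enorm x ^+ 2 + `|a k| ^+ 2) ^+ 2)%:E <= 2%:E) ->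
  interpolant q k.+1 + (deficit_const (2 * q) d * a k ^+ 4)%:E <= interpolant q k.
Proof.
move=> q1 hq; rewrite interpolant_succ (interpolant_conv q1).
have [a0|a0] := eqVneq (a k) 0%R.
  rewrite a0 normr0 expr0n mulr0 adde0.
  have cst (nu : probability 'rV[R]_d R) (x : 'rV[R]_d) :
      \int[nu]_u (enorm (x + 0 *: u)%R `^ (2 * q))%:E = (enorm x `^ (2 * q))%:E.
    under eq_integral do rewrite scale0r addr0.
    by rewrite integral_cst// [X in _ * X](_ : _ = 1) ?mule1//; exact: probability_setT.
  by under eq_integral do rewrite cst; under [leRHS]eq_integral do rewrite cst.
have a4 : (a k ^+ 4 = `|a k| ^+ 4)%R.
  by rewrite (exprM _ 2 2) -[(a k ^+ 2)%R]real_normK ?num_real// -exprM.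
rewrite a4.
have na : (0 < `|a k|)%R by rewrite normr_gt0.
exact: (integrated_deficit (mu_unif k) i s0_gt0 s0_var rho_normal d_ge2 q1 na sigma_sqr hq).
Qed.

(** By Jensen on the sphere, the fourth-moment condition on [sigma] follows from a bound on the
    interpolant of exponent 4, a quantity that can be followed along k. *)
Lemma interpolant_step_aux q : (1 <= q)%R ->
  ((2 < q)%R -> interpolant 2 k.+1 <= 2%:E) ->
  interpolant q k.+1 + (deficit_const (2 * q) d * a k ^+ 4)%:E <= interpolant q k.
Proof.
move=> q1 h; apply: interpolant_step_of_bound => // q2.
apply: le_trans (h q2); rewrite interpolant_succ.
apply: ge0_le_integral => //.
- by move=> x _; rewrite lee_fin sqr_ge0.
- apply/measurable_EFinP; apply: measurable_funX; apply: measurable_funD => //.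
  by apply: measurable_funX; exact: measurable_fun_enorm.
- exact: measurable_integral_shift.
- move=> x _; exact: (integral_sphere_enorm4_ge (mu_unif k) i).
Qed.

End step.

Let interpolant_step k q : (k < n)%N -> (1 <= q)%R ->
  ((2 < q)%R -> interpolant 2 k.+1 <= 2%:E) ->
  interpolant q k.+1 + (deficit_const (2 * q) d * a k ^+ 4)%:E <= interpolant q k.
Proof.
move=> kn q1 h; have [sigma sE] := exists_convolution (lam k) rho (tau k.+1).
exact: (interpolant_step_aux kn sE q1 h).
Qed.

Let interpolant0 q : interpolant q 0 = \int[rho]_z (enorm z `^ (2 * q))%:E.
Proof.
rewrite /interpolant (lam0 (measurable_integral_shift rho (tau 0) (2 * q))
  (integral_shift_ge0 rho (tau 0) (2 * q))).
by apply: eq_integral => z _; rewrite add0r /tau a_norm sqrtr1 scale1r.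
Qed.

Let interpolant_n q : interpolant q n = \int[lam n]_x (enorm x `^ (2 * q))%:E.
Proof.
apply: eq_integral => x _; rewrite /tau big_geq// sqrtr0.
under eq_integral do rewrite scale0r addr0.
by rewrite integral_cst// [X in _ * X](_ : _ = 1) ?mule1//; exact: probability_setT.
Qed.

(** Bootstrap: at q = 2 the step carries no fourth-moment condition and the deficit is nonnegative,
    so these interpolants decrease from E |Z|^4 = 1 + 2 / d, which is at most 2 as d >= 2. *)
Let interpolant2_le k : (k <= n)%N -> interpolant 2 k <= 2%:E.
Proof.
elim: k => [_|k IH kn].
  rewrite interpolant0.
  rewrite (eq_integral (fun z => (enorm z ^+ 4)%:E)); last first.
    by move=> z _; rewrite -natrM powR_mulrn ?enorm_ge0.
  rewrite (gaussian_moment4 (mu_unif 0) i s0_gt0 s0_var rho_normal) lee_fin.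
  have : (2 / d%:R <= 1 :> R)%R by rewrite ler_pdivrMr// mul1r.
  lra.
apply: le_trans (IH (ltnW kn)).
have h := @interpolant_step k 2%R kn.
apply: le_trans (h _ _); last 2 first.
- by rewrite ler1n.
- by rewrite ltxx.
rewrite leeDl// lee_fin mulr_ge0//; last first.
  by rewrite (exprM _ 2 2) sqr_ge0.
rewrite /deficit_const ifT; last by lra.
apply: mulr_ge0; last by lra.
apply: divr_ge0; last by rewrite mulr_ge0 ?mulr_ge0 ?sqr_ge0 ?addr_ge0 ?(ltW d0).
by have := d2; move=> ?; apply: mulr_ge0; lra.
Qed.

Lemma lindeberg q : (1 <= q)%R ->
  \int[lam n]_x (enorm x `^ (2 * q))%:E +
    (deficit_const (2 * q) d * \sum_(0 <= j < n) a j ^+ 4)%R%:E <=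
  \int[rho]_z (enorm z `^ (2 * q))%:E.
Proof.
move=> q1; rewrite -interpolant_n -interpolant0.
suff : forall k, (k <= n)%N -> interpolant q k +
    (deficit_const (2 * q) d * \sum_(0 <= j < k) a j ^+ 4)%R%:E <= interpolant q 0 by apply.
elim=> [_|k IH kn]; first by rewrite big_geq// mulr0 adde0.
apply: le_trans (IH (ltnW kn)).
set c := deficit_const _ _; set S := (\sum_(0 <= j < k) _)%R.
have -> : (c * \sum_(0 <= j < k.+1) a j ^+ 4)%R%:E = (c * a k ^+ 4)%:E + (c * S)%:E.
  by rewrite -EFinD -mulrDr addrC (@big_nat_recr _ _ _ k 0).
have := interpolant_step kn q1 (fun _ => interpolant2_le kn).
move: (interpolant q k) (interpolant q k.+1) => u v; rewrite -/c addeA => h.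
exact: leeD2r.
Qed.

End lindeberg.

(** * Laws of the partial sums *)

Section independent_sums.
Context {R : realType} {d : nat}.
Context {disp : measure_display} {T : measurableType disp} (P : probability T R).
Variable xi : nat -> {RV P >-> 'rV[R]_d}.
Hypothesis xi_indep : independent xi.
Variable a : nat -> R.
Local Open Scope ereal_scope.

Definition partial_sum (k : nat) (t : T) : 'rV[R]_d := (\sum_(0 <= j < k) a j *: xi j t)%R.

Let cylinder (J : seq nat) (B : nat -> set 'rV[R]_d) : set T :=
  \bigcap_(j in [set` J]) (xi j @^-1` B j).

Let cylinder_nil B : cylinder [::] B = setT.
Proof. by apply/seteqP; split=> // t _ j. Qed.

Let cylinder_cons j J B : cylinder (j :: J) B = (xi j @^-1` B j) `&` cylinder J B.
Proof.
apply/seteqP; split=> [t h|t [h1 h2] l].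
  split; first by apply: h; rewrite /= inE eqxx.
  by move=> l lJ; apply: h; rewrite /= inE; apply/orP; right.
by rewrite /= inE => /orP[/eqP ->//|lJ]; exact: h2.
Qed.

Let eq_cylinder J B B' : (forall j, j \in J -> B j = B' j) -> cylinder J B = cylinder J B'.
Proof.
by move=> BB; apply/seteqP; split=> t h j jJ; have := h j jJ; rewrite (BB _ jJ).
Qed.

Let mxi j (B : set 'rV[R]_d) : measurable B -> measurable (xi j @^-1` B).
Proof. by move=> mB; rewrite -[X in measurable X]setTI; exact: measurable_funP. Qed.

Let measurable_cylinder J B : (forall j, measurable (B j)) -> measurable (cylinder J B).
Proof.
move=> mB; elim: J => [|j J IH]; first by rewrite cylinder_nil.
by rewrite cylinder_cons; apply: measurableI => //; exact: mxi.
Qed.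

Let probability_cylinder_cons j J B : uniq (j :: J) -> (forall j, measurable (B j)) ->
  P (cylinder (j :: J) B) = P (xi j @^-1` B j) * P (cylinder J B).
Proof.
move=> uJ mB; have := xi_indep uJ mB; rewrite big_cons => h.
have uJ' : uniq J by case/andP: uJ.
by have := xi_indep uJ' mB; rewrite -/(cylinder J B) => ->.
Qed.

Lemma measurable_partial_sum k : measurable_fun setT (partial_sum k).
Proof.
elim: k => [|k IH].
  rewrite (_ : partial_sum 0 = cst 0%R); first exact: measurable_cst.
  by apply/funext => t; rewrite /partial_sum big_geq.
rewrite (_ : partial_sum k.+1 = (fun t => partial_sum k t + a k *: xi k t)%R).
  by apply: measurable_fun_rowD => //; apply: measurable_fun_rowZ.
by apply/funext => t; rewrite /partial_sum big_nat_recr.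
Qed.

Let mS k (A : set 'rV[R]_d) : measurable A -> measurable (partial_sum k @^-1` A).
Proof. by move=> mA; rewrite -[X in measurable X]setTI; exact: measurable_partial_sum. Qed.

(** The partial sum involves the indices below k, the cylinder those from k on. Keeping a whole
    cylinder in the statement lets the induction absorb one variable at a time. *)
Let past_indep k := forall J B A, uniq J -> (forall j, j \in J -> (k <= j)%N) ->
  (forall j, measurable (B j)) -> measurable A ->
  P (partial_sum k @^-1` A `&` cylinder J B) = P (partial_sum k @^-1` A) * P (cylinder J B).

Variable lam : nat -> probability 'rV[R]_d R.
Hypothesis lamE : forall k A, lam k A = P (partial_sum k @^-1` A).

Let joint k t := (partial_sum k t, xi k t).

Let measurable_joint k : measurable_fun setT (joint k).
Proof.
apply/measurable_fun_pairP; split; first exact: measurable_partial_sum.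
exact: measurable_funPT.
Qed.

(* On the event E := cylinder J B of the future, P(. | E) gives (S_k, xi_k) the
   product law; J = [::] is the unconditional statement. *)
Let joint_law k J B : past_indep k -> uniq J -> (forall j, j \in J -> (k < j)%N) ->
  (forall j, measurable (B j)) -> forall X, measurable X ->
  P (joint k @^-1` X `&` cylinder J B) =
  P (cylinder J B) * (lam k \x distribution P (xi k)) X.
Proof.
move=> indk uJ kJ mB X mX; set E := cylinder J B.
have mE : measurable E by exact: measurable_cylinder.
have mjX : measurable (joint k @^-1` X).
  by rewrite -[X in measurable X]setTI; exact: measurable_joint.
have [PE0|PE0] := eqVneq (P E) 0.
  rewrite PE0 mul0e; apply: (@subset_measure0 _ _ _ P _ E) => //.
    exact: measurableI.
have PEfin : P E \is a fin_num by exact: fin_num_measure.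
have e0 : (0 < fine (P E))%R by rewrite fine_gt0// lt_neqAle eq_sym PE0 measure_ge0 ltey_eq PEfin.
have c0 : (0 <= (fine (P E))^-1)%R by rewrite invr_ge0 ltW.
(* Conditional probability given E. Its image under the joint map is identified with the product
   measure by its values on rectangles. *)
pose Q := mscale (NngNum c0) (mrestr P mE).
pose m0 : {measure set ('rV[R]_d * 'rV[R]_d) -> \bar R} := pushforward Q (joint k).
pose m' := m0 (@measurable_joint k).
have m'E Y : m' Y = (fine (P E))^-1%:E * P (joint k @^-1` Y `&` E) by [].
rewrite (@product_measure_unique _ _ _ _ R (lam k) (distribution P (xi k)) m' _ X mX).
  rewrite m'E muleA -{1}(fineK PEfin) -EFinM mulfV ?gt_eqF// mul1e//.
move=> A C mA mC; rewrite m'E.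
(* Putting C at index k, which J avoids, turns the rectangle into a cylinder over k :: J. *)
pose B' j := if j == k then C else B j.
have mB' j : measurable (B' j) by rewrite /B'; case: ifP.
have kNJ : k \notin J by apply/negP => /kJ; rewrite ltnn.
have uJ' : uniq (k :: J) by rewrite /= kNJ.
have EB' : E = cylinder J B'.
  apply: eq_cylinder => j jJ; rewrite /B' ifF//; apply/negP => /eqP jk.
  by move: kNJ; rewrite -jk jJ.
have -> : joint k @^-1` (A `*` C) `&` E = partial_sum k @^-1` A `&` cylinder (k :: J) B'.
  rewrite cylinder_cons -EB' /B' eqxx setIA; congr (_ `&` _).
have kJ' j : j \in k :: J -> (k <= j)%N by rewrite inE => /orP[/eqP ->//|/kJ/ltnW].
rewrite (indk _ _ _ uJ' kJ' mB' mA) (probability_cylinder_cons uJ' mB') -EB'.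
rewrite /B' eqxx muleCA; congr (_ * _); first exact/esym/lamE.
rewrite [X in _ * X]muleC muleA -(fineK PEfin) /= -EFinM mulVf ?gt_eqF// mul1e//.
Qed.

Let indep_past k : past_indep k.
Proof.
elim: k => [|k IH] J B A uJ kJ mB mA.
  have mE := measurable_cylinder J mB.
  have -> : partial_sum 0 = cst 0%R.
    by apply/funext => t; rewrite /partial_sum big_geq.
  rewrite preimage_cst; case: ifP => _.
    by rewrite setTI probability_setT mul1e.
  by rewrite set0I measure0 mul0e.
pose X : set ('rV[R]_d * 'rV[R]_d) := (fun z => z.1 + a k *: z.2)%R @^-1` A.
have mX : measurable X.
  rewrite /X -[X in measurable X]setTI.
  suff : measurable_fun setT (fun z : 'rV[R]_d * 'rV[R]_d => z.1 + a k *: z.2)%R by apply.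
  apply: measurable_fun_rowD; first exact: measurable_fst.
  by apply: measurable_fun_rowZ => //; exact: measurable_snd.
have SX : partial_sum k.+1 @^-1` A = joint k @^-1` X.
  by apply/funext => t; rewrite /X /preimage /= /partial_sum big_nat_recr.
(* Applied with the future event and with none; the second identifies the product measure of X as
   the probability that the next partial sum lies in A. *)
have h := joint_law IH uJ kJ mB mX.
have h0 := @joint_law k [::] B IH isT (fun j (H : j \in [::]) => match notF H with end) mB X mX.
rewrite cylinder_nil setIT probability_setT mul1e in h0.
by rewrite SX h h0 muleC.
Qed.

Lemma law_partial_sumS k (f : 'rV[R]_d -> \bar R) :
  measurable_fun setT f -> (forall x, 0 <= f x) ->
  \int[P]_t f (partial_sum k.+1 t) =
  \int[lam k]_x \int[distribution P (xi k)]_u f (x + a k *: u)%R.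
Proof.
move=> mf f0.
pose g (z : 'rV[R]_d * 'rV[R]_d) := f (z.1 + a k *: z.2)%R.
have mg : measurable_fun setT g.
  apply: measurableT_comp => //; apply: measurable_fun_rowD; first exact: measurable_fst.
  by apply: measurable_fun_rowZ => //; exact: measurable_snd.
have g0 z : 0 <= g z by exact: f0.
transitivity (\int[P]_t g (joint k t)).
  by apply: eq_integral => t _; rewrite /g /= /partial_sum big_nat_recr.
rewrite -[LHS](@ge0_integral_pushforward _ _ _ _ _ _ (@measurable_joint k) P setT g)//.
transitivity (\int[lam k \x distribution P (xi k)]_z g z).
  apply: eq_measure_integral => X mX _.
  have := @joint_law k [::] (fun=> setT) (@indep_past k) isT
    (fun j (H : j \in [::]) => match notF H with end) (fun=> measurableT) X mX.
  by rewrite cylinder_nil setIT probability_setT mul1e.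
exact: (@fubini_tonelli1 _ _ _ _ R (lam k) (distribution P (xi k)) g mg g0).
Qed.

End independent_sums.

Theorem theorem1 (R : realType) (d : nat) (d_ge2 : (2 <= d)%N)
  (disp : measure_display) (T : measurableType disp) (P : probability T R)
  (xi : nat -> {RV P >-> 'rV[R]_d})
  (xi_indep : independent xi)
  (xi_unif : forall j : nat, uniform_on_sphere (xi j))
  (disp' : measure_display) (T' : measurableType disp') (P' : probability T' R)
  (Z : {RV P' >-> 'rV[R]_d})
  (Z_gauss : gaussian_vector Z)
  (Z_mean : has_mean Z 0)
  (Z_cov : has_covariance Z ((d%:R^-1)%:M))
  (p : R) (p_ge2 : 2 <= p)
  (n : nat) (n_ge1 : (1 <= n)%N) (a : 'I_n -> R)
  (a_norm : \sum_(j < n) a j ^+ 2 = 1) :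
  ('E_P[fun t => (enorm (\sum_(j < n) a j *: xi j t) `^ p)%R] <=
   'E_P'[fun t => (enorm (Z t) `^ p)%R] -
   (deficit_const p d * \sum_(j < n) a j ^+ 4)%:E)%E.
Proof.
have d0 : 0 < d%:R :> R by rewrite ltr0n ltnW.
have v0 : 0 < d%:R^-1 :> R by rewrite invr_gt0.
have [s0 [s0_gt0 s0_var] rho_normal] :=
  gaussian_vector_marginals Z_mean Z_cov Z_gauss (ltnW d_ge2) v0.
(* Extension by 0 beyond n, so that the induction runs over sequences; sums up to n do not see the
   default. *)
pose b j : R := if insub j is Some i then a i else 0.
have bE (i : 'I_n) : b i = a i by rewrite /b valK.
have sumE k : \sum_(0 <= j < n) b j ^+ k = \sum_(j < n) a j ^+ k.
  by rewrite big_mkord; apply: eq_bigr => i _; rewrite bE.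
have b_norm : \sum_(0 <= j < n) b j ^+ 2 = 1 by rewrite sumE.
pose lam k := projT1 (cid (exists_law P (measurable_partial_sum xi b k))).
have lamE k := (projT2 (cid (exists_law P (measurable_partial_sum xi b k)))).1.
have lam_int k := (projT2 (cid (exists_law P (measurable_partial_sum xi b k)))).2.
have lam0 (f : 'rV[R]_d -> \bar R) : measurable_fun setT f ->
    (forall x, 0 <= f x)%E -> (\int[lam 0%N]_x f x = f 0%R)%E.
  move=> mf f0; rewrite (lam_int 0%N f mf f0).
  under eq_integral do rewrite /partial_sum big_geq//.
  rewrite integral_cst// [X in (_ * X)%E](_ : _ = 1%E) ?mule1//.
  exact: probability_setT.
have lamS k : (k < n)%N -> forall f : 'rV[R]_d -> \bar R, measurable_fun setT f ->
    (forall x, 0 <= f x)%E -> (\int[lam k.+1]_x f x =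
    \int[lam k]_x \int[distribution P (xi k)]_u f (x + b k *: u)%R)%E.
  move=> _ f mf f0; rewrite (lam_int k.+1 f mf f0).
  exact: (law_partial_sumS xi_indep lamE).
have q1 : 1 <= p / 2 by lra.
(* [xi_unif] is accepted as the family of [sphere_law] hypotheses by conversion, with the k-th
   uniform law being that of [xi k]. *)
have := lindeberg d_ge2 s0_gt0 s0_var rho_normal xi_unif b_norm lam0 lamS q1.
have -> : 2 * (p / 2) = p by field.
have mF : measurable_fun setT (fun x : 'rV[R]_d => (enorm x `^ p)%:E).
  by apply/measurable_EFinP; apply: measurable_powR_comp; exact: measurable_fun_enorm.
have F0 (x : 'rV[R]_d) : (0 <= (enorm x `^ p)%:E)%E by rewrite lee_fin powR_ge0.
rewrite (lam_int n _ mF F0) (ge0_integral_distribution Z mF F0) sumE => h.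
rewrite !expectation.unlock leeBrDr; last by [].
have -> : (\int[P]_t (enorm (\sum_(j < n) a j *: xi j t)%R `^ p)%:E)%E =
    (\int[P]_t (enorm (partial_sum xi b n t) `^ p)%:E)%E; last exact: h.
apply: eq_integral => t _; congr ((enorm _ `^ p)%:E).
by rewrite /partial_sum big_mkord; apply: eq_bigr => j _; rewrite bE.
Qed.
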